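(* Let $\Sigma$ be an ordered alphabet and $\$\notin\Sigma$. Let $T$ be a string of length $n\ge 3$ with $T[1]=T[n]=\$$ and $T[2..n-1]\in\Sigma^*$, and let $m$ be the run-length encoding size of $T$, i.e. the number of maximal runs of equal characters in $T[2..n-1]$. Then there exists a data structure of size $O(m)$ (words) which can output all minimal absent words for $T$ in $O(|\mathsf{MAW}(T)|)$ time.
   Context: A string $w\in\Sigma^*$ is an absent word for $T$ if $w$ does not occur as a substring of $T$; it is a minimal absent word (MAW) for $T$ if it is absent and every proper substring of $w$ occurs in $T$. $\mathsf{MAW}(T)$ denotes the set of all MAWs for $T$. The run-length encoding of a string represents each maximal run of a character $a$ of length $p$ as $a^p$. The model of computation is the word RAM with word size $\Omega(\log|T|)$; space is measured in words. A MAW $w$ is output via an $O(1)$-word encoding (a quadruple $(a,k,p,r)$ with $a\in\Sigma$, $0\le k\le |T|$, $0\le p,r\le m$) from which, together with the stored run-length encoding of $T$, the run-length encoding of $w$ can be recovered. *)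

(* Defs.v *)
From mathcomp Require Import all_boot all_order.

Set Implicit Arguments.
Unset Strict Implicit.
Unset Printing Implicit Defensive.

(** * Strings over [Sigma] and [$], the latter encoded as [None : option Sigma] *)

Section Strings.
Context {Sigma : eqType}.
Implicit Types (T : seq (option Sigma)) (v w : seq Sigma).

Definition occurs w T : bool := infix [seq Some c | c <- w] T.

Definition is_maw T w : Prop :=
  ~~ occurs w T /\ (forall v, infix v w -> v != w -> occurs v T).

(* Adds the run [q] in front of [R], merging it with the first run of [R] when
   both runs have the same character. *)
Definition push_run (q : Sigma * nat) (R : seq (Sigma * nat)) :=
  if R is (c, l) :: R' then
    if q.1 == c then (c, q.2 + l) :: R' else q :: R
  else [:: q].

Definition merge_runs (R : seq (Sigma * nat)) := foldr push_run [::] R.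

Definition rle w : seq (Sigma * nat) := merge_runs [seq (c, 1) | c <- w].

(** Output format.  Let [x_1^{l_1} ... x_m^{l_m}] be the run-length encoding of
    the text.  The quadruple [(a, k, p, r)] denotes the string
      [a^k]                                               if [p = 0] or [r = 0],
      [x_p^k a]                                           if [1 <= p = r],
      [x_p x_{p+1}^{l_{p+1}} ... x_{r-1}^{l_{r-1}} x_r^k a]   if [1 <= p < r],
      [a x_r^{l_r} ... x_{p-1}^{l_{p-1}} x_p^k]            if [1 <= r < p].
    These forms cover every MAW [w]: the first one those with a single run.  If
    [w] has several runs and its first run has length [e >= 2], then every
    occurrence of [w] minus its first character starts with a run of length
    exactly [e - 1] (last form).  If the first run of [w] has length 1, then
    [w] minus its last character occurs in the text, starts with the last
    character of a run and has, apart from its first and last one, only full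
    runs (second and third forms). *)
Definition quad : Type := Sigma * nat * nat * nat.

Definition quad_ok (n m : nat) (q : quad) : bool :=
  let: (a, k, p, r) := q in [&& k <= n, p <= m & r <= m].

Definition decode (R : seq (Sigma * nat)) (q : quad) : seq (Sigma * nat) :=
  let: (a, k, p, r) := q in
  let x i := (nth (a, 0) R i.-1).1 in
  merge_runs
    (if (p == 0) || (r == 0) then [:: (a, k)]
     else if p == r then [:: (x p, k); (a, 1)]
     else if p < r then
       (x p, 1) :: drop p (take r.-1 R) ++ [:: (x r, k); (a, 1)]
     else (a, 1) :: drop r.-1 (take p.-1 R) ++ [:: (x p, k)]).

End Strings.

Arguments quad : clear implicits.

(** * Machine representation: a character is represented by its rank in the
    ordered alphabet, i.e. the alphabet is [{0, ..., #|Sigma| - 1}] *)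

Section Codes.
Context {d : Order.disp_t} {Sigma : finOrderType d}.

Definition code (c : Sigma) : nat := Order.enum_rank c.

Definition code_quad (q : quad Sigma) : seq nat :=
  let: (a, k, p, r) := q in [:: code a; k; p; r].

(* Number of runs first, so that a program can find the end of the encoding. *)
Definition code_rle (R : seq (Sigma * nat)) : seq nat :=
  size R :: flatten [seq [:: code q.1; q.2] | q <- R].

End Codes.

(** * Word RAM with [b]-bit words

    Every step costs one unit of time.  The memory consists of finitely many
    cells; its length never changes and an access outside of it is a fault.
    A program mentions only finitely many registers. *)

Inductive binop := OAdd | OSub | OMul | ODiv | OMod
                 | OAnd | OOr | OXor | OShl | OShr.

Inductive instr :=
  | IConst (x v : nat)               (* x := v *)
  | IOp (o : binop) (x y z : nat)    (* x := y o z *)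
  | ILoad (x y : nat)                (* x := memory[y] *)
  | IStore (x y : nat)               (* memory[x] := y *)
  | IJump (l : nat)
  | IJumpEq (x y l : nat)
  | IJumpLt (x y l : nat)
  | IEmit (x : nat)                  (* append x to the output *)
  | IHalt.

Record state := State {
  pc : nat;
  regs : nat -> nat;
  memory : seq nat;
  output : seq nat
}.

Definition is_word (b x : nat) : bool := x < 2 ^ b.

Definition eval_op (b : nat) (o : binop) (u v : nat) : nat :=
  match o with
  | OAdd => u + v
  | OSub => u + (2 ^ b - v)
  | OMul => u * v
  | ODiv => u %/ v
  | OMod => u %% v
  | OAnd => Nat.land u v
  | OOr => Nat.lor u v
  | OXor => Nat.lxor u v
  | OShl => u * 2 ^ v
  | OShr => u %/ 2 ^ v
  end %% 2 ^ b.

(* [None] when the machine has halted or faults. *)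
Definition step (b : nat) (P : seq instr) (s : state) : option state :=
  let: State i g M out := s in
  match onth P i with
  | Some (IConst x v) => Some (State i.+1 [eta g with x |-> v %% 2 ^ b] M out)
  | Some (IOp o x y z) =>
      Some (State i.+1 [eta g with x |-> eval_op b o (g y) (g z)] M out)
  | Some (ILoad x y) =>
      if onth M (g y) is Some v then Some (State i.+1 [eta g with x |-> v] M out)
      else None
  | Some (IStore x y) =>
      if g x < size M then Some (State i.+1 g (set_nth 0 M (g x) (g y)) out)
      else None
  | Some (IJump l) => Some (State l g M out)
  | Some (IJumpEq x y l) => Some (State (if g x == g y then l else i.+1) g M out)
  | Some (IJumpLt x y l) => Some (State (if g x < g y then l else i.+1) g M out)
  | Some (IEmit x) => Some (State i.+1 g M (rcons out (g x)))
  | Some IHalt | None => None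
  end.

Definition init (D : seq nat) : state := State 0 (fun=> 0) D [::].

(* [P], started on memory [D], reaches [IHalt] after exactly [t] steps in state
   [s]. *)
Definition halts_in (b : nat) (P : seq instr) (D : seq nat) (t : nat)
    (s : state) : Prop :=
  iter t (obind (step b P)) (Some (init D)) = Some s /\
  onth P (pc s) = Some IHalt.

(* A query on the data structure [D] outputs [out] in [t] steps.  The memory is
   back to [D] at the end, so that queries can be repeated; working cells, if
   any, are part of [D]. *)
Definition query (b : nat) (P : seq instr) (D : seq nat) (t : nat)
    (out : seq nat) : Prop :=
  exists s : state, [/\ halts_in b P D t s, memory s = D & output s = out].

(* Main.v *)
Require Import Defs.
From mathcomp Require Import all_boot all_order zify.

Set Implicit Arguments.
Unset Strict Implicit.
Unset Printing Implicit Defensive.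

(* A MAW whose first or last run has length at least two is determined by the run at
   which it would start or end, so there are at most [2m] of them and they can be
   stored explicitly; so can all MAWs when there are at most [m].  Otherwise [O(m)]
   time is free, and the remaining MAWs [a u b], with [a] and [b] runs of length
   one, are enumerated by a fixed interpreter from [O(m)] instructions.  If [u] is
   empty or one run, these are products of a set of left letters and a set of right
   letters, minus pairs that occur in the text.  If [u = c^e V d^f], group by the
   core [(c, V, d)]: with [F(a, e)] the largest [f] such that [a c^e V d^f] occurs
   and [E(f, b)] the largest [e] such that [c^e V d^f b] occurs, [a c^e V d^f b] is
   a MAW iff [f <= F(a, e)], [e <= E(f, b)] and it does not occur.  For one core
   this is a dominance report: sweep the pairs [(a, e)] by increasing [e] over a
   linked list of the pairs [(f, b)] sorted by [f], deleting those with
   [E(f, b) < e], and report a prefix of the list.  The end positions of the cores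
   form a laminar family that is refined by their left contexts, which bounds by
   [2m] the number of pairs [(a, e)] over all cores; the same holds on the right. *)

(** * The interpreter *)

(** Only the existence of the data structure is claimed, so it may hold a precomputed schedule of
    list operations; a query skips the encoding of the text and replays the schedule. What has to be
    bounded is the number of items and operations. The obstacle is that the cores range over all
    factors of the run sequence, and their contexts can be quadratically many. Only contexts that
    some occurrence of the core lacks are relevant: if every occurrence of the core of [a u b] had
    the left context of the word, the occurrence inside [u b] would extend to the whole word, which
    is absent. It is these proper contexts that the laminar family counts. The second cost are pairs
    that satisfy both inequalities but occur in the text: each of them cuts a reported prefix once
    more. Such a pair is charged to the right context of the core enlarged by the left letter, or to
    the left context if the former is not proper. The links changed by a sweep are rewritten at its
    end, so that schedules can be concatenated. *)

(* An item [(b, lo, hi)] stands for the letter [b] with the exponents [lo .. hi].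
   The items are the nodes of linked lists. *)
Definition item : Type := nat * nat * nat.
Definition nquad : Type := nat * nat * nat * nat.

(* Make [o_v] the successor of the item [o_i]; then, for the items of the list from
   [o_s] up to but not including [o_t], output the quadruples [(b, x, o_p, o_r)]
   with [lo <= x <= minn hi o_cap]. *)
Record op := Op {
  o_i : nat; o_v : nat; o_p : nat; o_r : nat; o_cap : nat; o_s : nat; o_t : nat }.

Definition item0 : item := (0, 0, 0).
Definition op0 := Op 0 0 0 0 0 0 0.

(* [p = 0] marks the words of length one: there [x] is the letter. *)
Definition emit_at (p r b x : nat) : nquad :=
  if p == 0 then (x, 1, 0, 0) else (b, x, p, r).

(** The loop of [prog] tests its counter after writing, so every item yields at least one quadruple;
    the [.+1] reflects this, and [fits] rules out empty ranges. A visit to an item is thus paid for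
    by its output. *)
Definition emit (p r cap : nat) (it : item) : seq nquad :=
  let: (b, lo, hi) := it in
  [seq emit_at p r b x | x <- iota lo (minn hi cap - lo).+1].

Definition fits (cap : nat) (it : item) : bool :=
  let: (b, lo, hi) := it in lo <= minn hi cap.

Definition upd (nx : nat -> nat) (o : op) : nat -> nat :=
  [eta nx with o_i o |-> o_v o].

(** A relation rather than a function, because a walk along arbitrary links need not reach [t]. The
    clause [s <> t] is the test that the machine makes before it visits an item. *)
Fixpoint chain (nx : nat -> nat) (s t : nat) (l : seq nat) : Prop :=
  if l is x :: l' then [/\ s <> t, x = s & chain nx (nx s) t l'] else s = t.

Fixpoint exec (its : seq item) (nx : nat -> nat) (ops : seq op)
    (out : seq nquad) (nx' : nat -> nat) : Prop :=
  if ops is o :: ops' then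
    exists l out',
      [/\ o_i o < size its, chain (upd nx o) (o_s o) (o_t o) l,
          all (fun j => (j < size its) && fits (o_cap o) (nth item0 its j)) l,
          out = flatten [seq emit (o_p o) (o_r o) (o_cap o) (nth item0 its j)
                        | j <- l] ++ out'
        & exec its (upd nx o) ops' out' nx']
  else out = [::] /\ nx =1 nx'.

Definition flat4 (q : nquad) : seq nat := let: (x, y, z, t) := q in [:: x; y; z; t].

(* Registers: 0 and 1 hold the constants 0 and 1, 3 and 4 the addresses of the
   current operation and of the end of the operations, 5 to 11 the fields of the
   operation, 10 then walks through the items, whose fields are in 12 to 14.
   Comments give the jump targets. *)
Definition prog : seq instr := [::
  IConst 1 1;
  ILoad 2 0; IOp OAdd 2 2 2; IOp OAdd 2 2 1;
  ILoad 3 2; IOp OAdd 2 2 1;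
  ILoad 4 2;
  (* 7 *) IJumpEq 3 4 46;
  ILoad 5 3; IOp OAdd 3 3 1;
  ILoad 6 3; IOp OAdd 3 3 1;
  IStore 5 6;
  ILoad 7 3; IOp OAdd 3 3 1;
  ILoad 8 3; IOp OAdd 3 3 1;
  ILoad 9 3; IOp OAdd 3 3 1;
  ILoad 10 3; IOp OAdd 3 3 1;
  ILoad 11 3; IOp OAdd 3 3 1;
  (* 23 *) IJumpEq 10 11 7;
  ILoad 12 10; IOp OAdd 10 10 1;
  ILoad 13 10; IOp OAdd 10 10 1;
  ILoad 14 10; IOp OAdd 10 10 1;
  ILoad 10 10;
  IJumpLt 14 9 33;
  IOp OAdd 14 9 0;
  (* 33 *) IJumpEq 7 0 39;
  IEmit 12; IEmit 13; IEmit 7; IEmit 8; IJump 43;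
  (* 39 *) IEmit 13; IEmit 1; IEmit 0; IEmit 0;
  (* 43 *) IJumpEq 13 14 23;
  IOp OAdd 13 13 1;
  IJump 33;
  (* 46 *) IHalt ].

(** * Symbolic execution of the interpreter *)

Section Machine.
Variable b : nat.
Implicit Types (g : nat -> nat) (M out : seq nat).

(* Locked: register files are nested dozens of updates deep, and unification
   would otherwise unfold them. *)
Definition setr : (nat -> nat) -> nat -> nat -> nat -> nat :=
  locked (fun g x v => [eta g with x |-> v]).

Lemma setrE g x v k : setr g x v k = if k == x then v else g k.
Proof. by rewrite /setr -lock. Qed.

Lemma setr_eta g x v : ([eta g with x |-> v] : nat -> nat) = setr g x v.
Proof. by rewrite /setr -lock. Qed.

Ltac regs := solve [by rewrite ?setrE /=].

Inductive runs : nat -> state -> state -> Prop :=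
  | Runs0 s : runs 0 s s
  | RunsS t s s1 s' : step b prog s = Some s1 -> runs t s1 s' -> runs t.+1 s s'.

#[local] Hint Resolve Runs0 : core.

Lemma runs_iter t s s' : runs t s s' -> iter t (obind (step b prog)) (Some s) = Some s'.
Proof. by elim=> // {}t {}s s1 {}s' e _ IH; rewrite iterSr /= e. Qed.

Lemma runs_trans t1 t2 s1 s2 s3 : runs t1 s1 s2 -> runs t2 s2 s3 -> runs (t2 + t1) s1 s3.
Proof.
by elim=> [s|t s s' s'' e _ IH] r; rewrite ?addn0 // addnS; apply: RunsS e (IH r).
Qed.

(** This lemma and the other [st_] lemmas peel one instruction off the front of a run, so that code
    is executed by a chain of [apply]. Where register contents matter they enter as equations, and
    additions require that they do not overflow. *)
Lemma st_const t i x v g M out s' : onth prog i = Some (IConst x v) ->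
  runs t (State i.+1 (setr g x (v %% 2 ^ b)) M out) s' ->
  runs t.+1 (State i g M out) s'.
Proof. by move=> h; apply: RunsS; rewrite -?setr_eta /= h. Qed.

Lemma st_add t i x y z a c g M out s' : onth prog i = Some (IOp OAdd x y z) ->
  g y = a -> g z = c -> a + c < 2 ^ b ->
  runs t (State i.+1 (setr g x (a + c)) M out) s' ->
  runs t.+1 (State i g M out) s'.
Proof. by move=> h <- <- lt; apply: RunsS; rewrite -?setr_eta /= h /eval_op modn_small. Qed.

Lemma st_load t i x y a g M out s' : onth prog i = Some (ILoad x y) ->
  g y = a -> a < size M ->
  runs t (State i.+1 (setr g x (nth 0 M a)) M out) s' ->
  runs t.+1 (State i g M out) s'.
Proof.
by move=> h <- lt; apply: RunsS; rewrite -?setr_eta /= h onthE (nth_map 0).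
Qed.

Lemma st_store t i x y a v g M out s' : onth prog i = Some (IStore x y) ->
  g x = a -> g y = v -> a < size M ->
  runs t (State i.+1 g (set_nth 0 M a v) out) s' ->
  runs t.+1 (State i g M out) s'.
Proof. by move=> h <- <- lt; apply: RunsS; rewrite -?setr_eta /= h lt. Qed.

Lemma st_jump t i l g M out s' : onth prog i = Some (IJump l) ->
  runs t (State l g M out) s' -> runs t.+1 (State i g M out) s'.
Proof. by move=> h; apply: RunsS; rewrite -?setr_eta /= h. Qed.

Lemma st_jeq t i x y l g M out s' : onth prog i = Some (IJumpEq x y l) ->
  runs t (State (if g x == g y then l else i.+1) g M out) s' ->
  runs t.+1 (State i g M out) s'.
Proof. by move=> h; apply: RunsS; rewrite -?setr_eta /= h. Qed.

Lemma st_jlt t i x y l g M out s' : onth prog i = Some (IJumpLt x y l) ->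
  runs t (State (if g x < g y then l else i.+1) g M out) s' ->
  runs t.+1 (State i g M out) s'.
Proof. by move=> h; apply: RunsS; rewrite -?setr_eta /= h. Qed.

Lemma st_emit t i x v g M out s' : onth prog i = Some (IEmit x) -> g x = v ->
  runs t (State i.+1 g M (rcons out v)) s' ->
  runs t.+1 (State i g M out) s'.
Proof. by move=> h <-; apply: RunsS; rewrite -?setr_eta /= h. Qed.

Lemma run_emit1 g M out p r bb x : g 0 = 0 -> g 1 = 1 -> g 7 = p -> g 8 = r ->
  g 12 = bb -> g 13 = x ->
  exists2 t, t <= 6 &
    runs t (State 33 g M out) (State 43 g M (out ++ flat4 (emit_at p r bb x))).
Proof.
move=> g0 g1 g7 g8 g12 g13.
case: (eqVneq p 0) => [p0|p0].
  exists 5 => //; apply: st_jeq => //; rewrite g7 g0 p0 eqxx.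
  apply: (st_emit _ g13) => //; apply: (st_emit _ g1) => //.
  do 2!apply: (st_emit _ g0) => //.
  by rewrite /emit_at /= -!cats1 -!catA /=.
exists 6 => //; apply: st_jeq => //; rewrite g7 g0 (negPf p0).
apply: (st_emit _ g12) => //; apply: (st_emit _ g13) => //.
apply: (st_emit _ g7) => //; apply: (st_emit _ g8) => //.
apply: st_jump => //.
by rewrite /emit_at (negPf p0) /= -!cats1 -!catA /=.
Qed.

(** Nine steps per quadruple: at most six to write it and three to test and advance the counter. The
    test for equality precedes the increment, so the counter never exceeds [y] and cannot wrap
    around. *)
Lemma run_emit c g M out p r bb x y : g 0 = 0 -> g 1 = 1 -> g 7 = p -> g 8 = r ->
  g 12 = bb -> g 13 = x -> g 14 = y -> y = x + c -> y < 2 ^ b ->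
  exists t g', [/\ t <= 9 * c.+1,
    runs t (State 33 g M out)
      (State 23 g' M (out ++ flatten [seq flat4 (emit_at p r bb z) | z <- iota x c.+1]))
    & forall k, k != 13 -> g' k = g k].
Proof.
move=> g0 g1 g7 g8 g12.
elim: c g x out g0 g1 g7 g8 g12 => [|c IH] g x out g0 g1 g7 g8 g12 g13 g14 yE yb.
  have [t le rn] := run_emit1 M out g0 g1 g7 g8 g12 g13.
  exists (1 + t), g; split=> //; first by lia.
  apply: runs_trans rn _; apply: st_jeq => //; rewrite g13 g14 yE addn0 eqxx /=.
  by rewrite cats0.
have [t le rn] := run_emit1 M out g0 g1 g7 g8 g12 g13.
have [] // := IH (setr g 13 (x + 1)) (x + 1)
  (out ++ flat4 (emit_at p r bb x)); try regs; first by rewrite yE addn1 addSnnS.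
move=> t' [g' [le' rn' fr]].
exists (t'.+3 + t), g'; split; first by lia.
  apply: runs_trans rn _; apply: st_jeq => //.
  rewrite g13 g14; have -> : (x == y) = false by lia.
  apply: (st_add _ g13 g1) => //; first by lia.
  apply: st_jump => //.
  by move: rn'; rewrite addn1 /= -catA.
by move=> k kn; rewrite fr // setrE (negPf kn).
Qed.

(** * Memory layout and running time of a query *)

Section Data.
Variables (R0 : seq nat) (its : seq item) (ops : seq op).
Hypothesis R0_size : size R0 = (2 * nth 0 R0 0).+1.

Let N := size its.
Let base := size R0 + 2.
Let obase := base + 4 * N.
(** The memory consists of [R0], two cells pointing to the start and the end of the operations, four
    cells per item and seven per operation. Links are absolute addresses; [ia N], the first address
    behind the items, marks the end of a list. *)
Definition ia (i : nat) := base + 4 * i.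
Definition oa (k : nat) := obase + 7 * k.
Definition mlen := 2 + 4 * N + 7 * size ops.

Definition item_cells (nx : nat -> nat) (i : nat) : seq nat :=
  let: (x, lo, hi) := nth item0 its i in [:: x; lo; hi; ia (nx i)].
Definition op_cells (k : nat) : seq nat :=
  let: Op i v p r cap s t := nth op0 ops k in
  [:: ia i + 3; ia v; p; r; cap; ia s; ia t].

Definition cell (nx : nat -> nat) (a : nat) : nat :=
  if a < 2 then nth 0 [:: obase; oa (size ops)] a
  else if a < 2 + 4 * N then nth 0 (item_cells nx ((a - 2) %/ 4)) ((a - 2) %% 4)
  else nth 0 (op_cells ((a - 2 - 4 * N) %/ 7)) ((a - 2 - 4 * N) %% 7).

(** Only the links change during a query, so the successor map describes the whole memory; for
    [succn] it is the stored structure. *)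
Definition ram nx := R0 ++ mkseq (cell nx) mlen.

Lemma size_ram nx : size (ram nx) = size R0 + mlen.
Proof. by rewrite size_cat size_mkseq. Qed.

Lemma nth_ram nx a : a < mlen -> nth 0 (ram nx) (size R0 + a) = cell nx a.
Proof.
by move=> lt; rewrite nth_cat ltnNge leq_addr /= addKn nth_mkseq.
Qed.

Lemma ram_item nx i j : i < N -> j < 4 ->
  nth 0 (ram nx) (ia i + j) = nth 0 (item_cells nx i) j.
Proof.
move=> iN j4; have -> : ia i + j = size R0 + (2 + (i * 4 + j)) by rewrite /ia /base; lia.
rewrite nth_ram; last by rewrite /mlen; lia.
rewrite /cell; have -> : 2 + (i * 4 + j) < 2 = false by lia.
have -> : 2 + (i * 4 + j) < 2 + 4 * N by lia.
by rewrite addKn divnMDl // modnMDl divn_small // modn_small // addn0.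
Qed.

Lemma ram_op nx k j : k < size ops -> j < 7 ->
  nth 0 (ram nx) (oa k + j) = nth 0 (op_cells k) j.
Proof.
move=> iN j4.
have -> : oa k + j = size R0 + (2 + 4 * N + (k * 7 + j)).
  by rewrite /oa /obase /base; lia.
rewrite nth_ram; last by rewrite /mlen; lia.
rewrite /cell; have -> : 2 + 4 * N + (k * 7 + j) < 2 = false by lia.
have -> : 2 + 4 * N + (k * 7 + j) < 2 + 4 * N = false by lia.
have -> : 2 + 4 * N + (k * 7 + j) - 2 - 4 * N = k * 7 + j by lia.
by rewrite divnMDl // modnMDl divn_small // modn_small // addn0.
Qed.

Lemma ram_set nx i v : i < N ->
  set_nth 0 (ram nx) (ia i + 3) (ia v) = ram [eta nx with i |-> v].
Proof.
move=> iN.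
have lt : ia i + 3 < size (ram nx) by rewrite size_ram /ia /mlen /base; lia.
have sz : size (set_nth 0 (ram nx) (ia i + 3) (ia v)) = size (ram nx).
  by rewrite size_set_nth; apply/maxn_idPr.
apply: (@eq_from_nth _ 0); first by rewrite sz !size_ram.
rewrite sz size_ram => a ltA; rewrite nth_set_nth /=.
case: (ltnP a (size R0)) => ha.
  rewrite /ram !nth_cat ha; case: eqP => // aE.
  by move: ha; rewrite aE /ia /base; lia.
have aE : a = size R0 + (a - size R0) by lia.
set a' := a - size R0 in aE.
have lt' : a' < mlen by lia.
rewrite aE !nth_ram // /cell.
case: (ltnP a' 2) => h2.
  case: eqP => // e; move: e; rewrite /ia /base; lia.
case: (ltnP a' (2 + 4 * N)) => h4; last first.
  case: eqP => // e; move: e; rewrite /ia /base; lia.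
rewrite /item_cells; set q := (a' - 2) %/ 4; set u := (a' - 2) %% 4.
have qE : a' - 2 = q * 4 + u by rewrite -divn_eq.
have u4 : u < 4 by rewrite ltn_pmod.
clearbody q u.
case: (nth item0 its q) => [[x lo] hi] /=.
case: eqP => e.
  have -> : q = i by move: e; rewrite /ia /base; lia.
  have -> : u = 3 by move: e; rewrite /ia /base; lia.
  by rewrite /= eqxx.
case: u u4 qE e => [|[|[|[|]]]] //= _ qE e.
case: eqP => // qi; case: e; rewrite /ia /base; lia.
Qed.

Lemma ram_ext nx nx' : nx =1 nx' -> ram nx = ram nx'.
Proof.
move=> e; rewrite /ram; congr (_ ++ _); apply: eq_mkseq => a.
by rewrite /cell /item_cells; case: (nth item0 its _) => [[x lo] hi]; rewrite e.
Qed.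

Hypothesis small : size R0 + mlen < 2 ^ b.
Hypothesis items_small : all (fun it : item => it.2 < 2 ^ b) its.

Definition inv g := g 0 = 0 /\ g 1 = 1.

Lemma ia_lt i j nx : i < N -> j < 4 -> ia i + j < size (ram nx).
Proof. by rewrite size_ram /ia /mlen /base; lia. Qed.

Lemma oa_lt k j nx : k < size ops -> j < 7 -> oa k + j < size (ram nx).
Proof. by rewrite size_ram /oa /mlen /obase /base; lia. Qed.

Lemma oa_le k : k <= size ops -> oa k < 2 ^ b.
Proof. by move: small; rewrite /oa /mlen /obase /base; lia. Qed.

Lemma ia_lt2 i j : i < N -> j < 4 -> ia i + j < 2 ^ b.
Proof.
move=> h1 h2; apply: leq_trans (ia_lt succn h1 h2) _.
by rewrite size_ram; apply: ltnW.
Qed.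

Lemma oa_lt2 k j : k < size ops -> j < 7 -> oa k + j < 2 ^ b.
Proof.
move=> h1 h2; apply: leq_trans (oa_lt succn h1 h2) _.
by rewrite size_ram; apply: ltnW.
Qed.

Lemma eq_ia i j : (ia i == ia j) = (i == j).
Proof. by rewrite /ia; lia. Qed.

Lemma run_chain nx s t l p r cap g out : chain nx s t l ->
  all (fun j => (j < N) && fits cap (nth item0 its j)) l ->
  inv g -> g 7 = p -> g 8 = r -> g 9 = cap -> g 10 = ia s -> g 11 = ia t ->
  let o := flatten [seq emit p r cap (nth item0 its j) | j <- l] in
  exists tt g', [/\ tt <= 20 * size o + 1,
    runs tt (State 23 g (ram nx) out)
      (State 7 g' (ram nx) (out ++ flatten (map flat4 o))),
    inv g', g' 3 = g 3 & g' 4 = g 4].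
Proof.
elim: l s g out => [|x l IH] s g out /=.
  move=> -> _ ig g7 g8 g9 g10 g11; exists 1, g; split=> //.
  by apply: st_jeq => //; rewrite g10 g11 eqxx cats0.
move=> [st -> ch] /andP[/andP[sN ft] al] [g0 g1] g7 g8 g9 g10 g11.
have Hc j := @ram_item nx s j sN.
have Hl j := @ia_lt s j nx sN.
have H2 j := @ia_lt2 s j sN.
have hiB : (nth item0 its s).2 < 2 ^ b by apply: (allP items_small); apply: mem_nth.
rewrite /item_cells in Hc.
case: (nth item0 its s) Hc ft hiB => [[x0 lo] hi] Hc ft /= hiB.
rewrite /= in ft.
have Sa j : ia s + j.+1 = ia s + j + 1 by rewrite -addnA addn1.
pose g1' := (setr (setr g 12 (x0)) 10 (ia s + 1)).
pose g2' := (setr (setr g1' 13 (lo)) 10 (ia s + 2)).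
pose g3' := (setr (setr g2' 14 (hi)) 10 (ia s + 3)).
pose g4' := (setr g3' 10 (ia (nx s))).
pose g5' := if hi < cap then g4' else (setr g4' 14 (cap + 0)).
have [t1 le1 R1] : exists2 t1, t1 <= 10 & forall t' s',
    runs t' (State 33 g5' (ram nx) out) s' -> runs (t' + t1) (State 23 g (ram nx) out) s'.
  have pre t' s' : runs t' (State 31 g4' (ram nx) out) s' ->
      runs (t' + 8) (State 23 g (ram nx) out) s'.
    move=> rn; rewrite !addnS addn0.
    apply: st_jeq => //; rewrite g10 g11 eq_ia; have/eqP/negPf-> := st.
    have e0 := Hc 0 erefl; rewrite addn0 /= in e0.
    apply: (st_load _ g10) => //; first by have := Hl 0 erefl; rewrite addn0.
    rewrite e0.
    apply: (st_add (a := ia s) (c := 1)); [by []|regs|regs|by apply: (H2 1)|].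
    apply: (st_load (a := ia s + 1)); [by []|regs|by apply: (Hl 1)|].
    rewrite (Hc 1) //.
    apply: (st_add (a := ia s + 1) (c := 1)); [by []|regs|regs|by rewrite -Sa; apply: (H2 2)|].
    rewrite -Sa.
    apply: (st_load (a := ia s + 2)); [by []|regs|by apply: (Hl 2)|].
    rewrite (Hc 2) //.
    apply: (st_add (a := ia s + 2) (c := 1)); [by []|regs|regs|by rewrite -Sa; apply: (H2 3)|].
    rewrite -Sa.
    apply: (st_load (a := ia s + 3)); [by []|regs|by apply: (Hl 3)|].
    by rewrite (Hc 3).
  exists (if hi < cap then 9 else 10); first by case: ifP.
  move=> t' s'; rewrite /g5'; case: ifP => hc rn.
    have -> : t' + 9 = t'.+1 + 8 by lia.
    apply: pre; apply: st_jlt => //.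
    by have -> : g4' 14 < g4' 9 by rewrite /g4' /g3' /g2' /g1' !setrE /= g9.
  have -> : t' + 10 = t'.+2 + 8 by lia.
  apply: pre; apply: st_jlt => //.
  have -> : g4' 14 < g4' 9 = false by rewrite /g4' /g3' /g2' /g1' !setrE /= g9.
  by apply: (st_add (a := cap) (c := 0)); [by []|rewrite /g4' /g3' /g2' /g1'; regs|rewrite /g4' /g3' /g2' /g1'; regs|lia|].
have h14 : g5' 14 = minn hi cap.
  by rewrite /g5'; case: (ltnP hi cap) => hc; rewrite /g4' /g3' !setrE /=; lia.
have h5 k : k \notin [:: 10; 12; 13; 14] -> g5' k = g k.
  rewrite !inE !negb_or => /and4P[/negPf k10 /negPf k12 /negPf k13 /negPf k14].
  by rewrite /g5'; case: ifP => _; rewrite /g4' /g3' /g2' /g1' !setrE ?k10 ?k12 ?k13 ?k14.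
have h10 : g5' 10 = ia (nx s) by rewrite /g5'; case: ifP => _; rewrite /g4' /g3' /g2' /g1' !setrE.
have h12 : g5' 12 = x0 by rewrite /g5'; case: ifP => _; rewrite /g4' /g3' /g2' /g1' !setrE.
have h13 : g5' 13 = lo by rewrite /g5'; case: ifP => _; rewrite /g4' /g3' /g2' /g1' !setrE.
have [] // := @run_emit (minn hi cap - lo) g5' (ram nx) out p r x0 lo (minn hi cap);
  rewrite ?h5 //; try lia.
move=> t2 [g' [le2 R2 fr]].
have [] := IH (nx s) g' (out ++ flatten [seq flat4 (emit_at p r x0 z)
    | z <- iota lo (minn hi cap - lo).+1]) ch al.
- by rewrite /inv !fr // !h5.
- by rewrite fr // h5.
- by rewrite fr // h5.
- by rewrite fr // h5.
- by rewrite fr.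
- by rewrite fr // h5.
move=> t3 [g'' [le3 R3 ig3 g33 g34]].
exists (t3 + t2 + t1), g''; split => //.
- by rewrite size_cat size_map size_iota; lia.
- apply: R1; apply: runs_trans R2 _.
  rewrite map_cat flatten_cat -map_comp /=.
  by move: R3; rewrite /= -?catA.
- by rewrite g33 fr // h5.
- by rewrite g34 fr // h5.
Qed.

(** Reading an operation takes 16 steps and leaving its walk one more; the rest is paid for by the
    output. *)
Lemma run_ops os k nx (out : seq nquad) o nx' g : exec its nx os out nx' -> drop k ops = os ->
  k <= size ops ->
  inv g -> g 3 = oa k -> g 4 = oa (size ops) ->
  exists t g', t <= 19 * size os + 20 * size out + 1 /\
    runs t (State 7 g (ram nx) o)
      (State 46 g' (ram nx') (o ++ flatten (map flat4 out))).
Proof.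
elim: os k nx out o g => [|[oi ov op_ oR oc os_ oT] os IH] k nx out o g /=.
  move=> [-> e] dr kl ig g3 g4; exists 1, g; split => //.
  have kE : k = size ops by apply/eqP; rewrite eqn_leq kl /= -subn_eq0 -size_drop dr.
  rewrite kE in g3.
  by apply: st_jeq => //; rewrite g3 g4 eqxx cats0 (ram_ext e).
move=> [l [out' [iN ch al -> ex]]] dr _ [g0 g1] g3 g4.
have kl : k < size ops.
  by rewrite -subn_gt0 -size_drop dr.
have opE : nth op0 ops k = Op oi ov op_ oR oc os_ oT.
  by have := nth_drop k op0 ops 0; rewrite dr addn0 /= => <-.
have Hc nx1 j := @ram_op nx1 k j kl.
rewrite /op_cells opE in Hc.
have Hl nx1 j := @oa_lt k j nx1 kl.
have H2 j := @oa_lt2 k j kl.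
have L7 : oa k + 7 < 2 ^ b by have := oa_le kl; rewrite /oa; lia.
pose nx1 := upd nx (Op oi ov op_ oR oc os_ oT).
have Oa j : oa k + j.+1 = oa k + j + 1 by rewrite -addnA addn1.
pose g1' := (setr (setr g 5 (ia oi + 3)) 3 (oa k + 1)).
pose g2' := (setr (setr g1' 6 (ia ov)) 3 (oa k + 2)).
pose g3' := (setr (setr g2' 7 (op_)) 3 (oa k + 3)).
pose g4' := (setr (setr g3' 8 (oR)) 3 (oa k + 4)).
pose g5' := (setr (setr g4' 9 (oc)) 3 (oa k + 5)).
pose g6' := (setr (setr g5' 10 (ia os_)) 3 (oa k + 6)).
pose g7' := (setr (setr g6' 11 (ia oT)) 3 (oa k + 7)).
have E7 := (setrE, g0, g1).
have R1 t' s' : runs t' (State 23 g7' (ram nx1) o) s' ->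
    runs (t' + 16) (State 7 g (ram nx) o) s'.
  move=> rn; rewrite !addnS addn0.
  apply: st_jeq => //; rewrite g3 g4.
  have -> : (oa k == oa (size ops)) = false by rewrite /oa; lia.
  have e0 := Hc nx 0 erefl; rewrite addn0 /= in e0.
  apply: (st_load _ g3) => //; first by have := Hl nx 0 erefl; rewrite addn0.
  rewrite e0.
  apply: (st_add (a := oa k) (c := 1)); [by []|regs|regs|by apply: (H2 1)|].
  apply: (st_load (a := oa k + 1)); [by []|regs|by apply: (Hl _ 1)|].
  rewrite (Hc nx 1) //.
  apply: (st_add (a := oa k + 1) (c := 1)); [by []|regs|regs|by rewrite -Oa; apply: (H2 2)|].
  apply: (st_store (a := ia oi + 3) (v := ia ov)); [by []|regs|regs|exact: ia_lt|].
  rewrite ram_set // -[ram _]/(ram nx1) -Oa.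
  apply: (st_load (a := oa k + 2)); [by []|regs|by apply: (Hl _ 2)|].
  rewrite (Hc nx1 2) //.
  apply: (st_add (a := oa k + 2) (c := 1)); [by []|regs|regs|by rewrite -Oa; apply: (H2 3)|].
  rewrite -Oa.
  apply: (st_load (a := oa k + 3)); [by []|regs|by apply: (Hl _ 3)|].
  rewrite (Hc nx1 3) //.
  apply: (st_add (a := oa k + 3) (c := 1)); [by []|regs|regs|by rewrite -Oa; apply: (H2 4)|].
  rewrite -Oa.
  apply: (st_load (a := oa k + 4)); [by []|regs|by apply: (Hl _ 4)|].
  rewrite (Hc nx1 4) //.
  apply: (st_add (a := oa k + 4) (c := 1)); [by []|regs|regs|by rewrite -Oa; apply: (H2 5)|].
  rewrite -Oa.
  apply: (st_load (a := oa k + 5)); [by []|regs|by apply: (Hl _ 5)|].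
  rewrite (Hc nx1 5) //.
  apply: (st_add (a := oa k + 5) (c := 1)); [by []|regs|regs|by rewrite -Oa; apply: (H2 6)|].
  rewrite -Oa.
  apply: (st_load (a := oa k + 6)); [by []|regs|by apply: (Hl _ 6)|].
  rewrite (Hc nx1 6) //.
  apply: (st_add (a := oa k + 6) (c := 1)); [by []|regs|regs|by rewrite -Oa; exact: L7|by rewrite -Oa].
have [] := @run_chain nx1 os_ oT l op_ oR oc g7' o ch al.
- by rewrite /inv /g7' /g6' /g5' /g4' /g3' /g2' /g1' !E7.
- by rewrite /g7' /g6' /g5' /g4' /g3' /g2' /g1' !E7.
- by rewrite /g7' /g6' /g5' /g4' /g3' /g2' /g1' !E7.
- by rewrite /g7' /g6' /g5' /g4' /g3' /g2' /g1' !E7.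
- by rewrite /g7' /g6' /g5' /g4' /g3' /g2' /g1' !E7.
- by rewrite /g7' /g6' /g5' /g4' /g3' /g2' /g1' !E7.
move=> t2 [g'' [le2 R2 ig2 g23 g24]].
have [] := IH k.+1 nx1 out' (o ++ flatten (map flat4 (flatten
   [seq emit op_ oR oc (nth item0 its j) | j <- l]))) g'' ex _ kl ig2.
- by rewrite -add1n -drop_drop dr /= drop0.
- by rewrite g23 /g7' /g6' /g5' /g4' /g3' /g2' /g1' !E7 /oa /=; lia.
- by rewrite g24 /g7' /g6' /g5' /g4' /g3' /g2' /g1' !E7.
move=> t3 [g3'' [le3 R3]].
exists (t3 + t2 + 16), g3''; split.
  by rewrite size_cat; lia.
apply: R1; apply: runs_trans R2 _.
by move: R3; rewrite -catA map_cat flatten_cat.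
Qed.

(** Seven steps come first: they set the constant 1, compute the size of [R0] from its first cell
    and load the two pointers behind it. *)
Lemma run_all (out : seq nquad) : exec its succn ops out succn ->
  exists t, t <= 19 * size ops + 20 * size out + 8 /\
    query b prog (ram succn) t (flatten (map flat4 out)).
Proof.
move=> ex.
have sR : 0 < size R0 by rewrite R0_size.
have b1 : 1 < 2 ^ b by apply: leq_ltn_trans small; lia.
pose g1 := setr (fun=> 0) 1 (1 %% 2 ^ b).
pose g2 := setr (setr (setr g1 2 (nth 0 R0 0)) 2 (nth 0 R0 0 + nth 0 R0 0)) 2
  (nth 0 R0 0 + nth 0 R0 0 + 1).
pose g3 := setr (setr (setr g2 3 obase) 2 (size R0 + 1)) 4 (oa (size ops)).
have [] := @run_ops ops 0 succn out [::] succn g3 ex _ _.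
- by rewrite drop0.
- by [].
- by rewrite /inv /g3 /g2 /g1 !setrE modn_small.
- by rewrite /g3 /g2 /g1 !setrE /= /oa; lia.
- by rewrite /g3 /g2 /g1 !setrE.
move=> t [g' [le rn]].
have RE : nth 0 R0 0 + nth 0 R0 0 + 1 = size R0 by rewrite R0_size; lia.
exists (t + 7); split; first by lia.
exists (State 46 g' (ram succn) (flatten (map flat4 out))); split=> //; split=> //.
apply: runs_iter; rewrite !addnS addn0.
apply: st_const => //.
have m0 : nth 0 (ram succn) 0 = nth 0 R0 0 by rewrite /ram nth_cat sR.
apply: (st_load (a := 0)); [by []|regs|by rewrite size_ram; lia|].
rewrite m0.
apply: (st_add (a := nth 0 R0 0) (c := nth 0 R0 0)); [by []|regs|regs|lia|].
apply: (st_add (a := nth 0 R0 0 + nth 0 R0 0) (c := 1)); [by []|regs| |lia|].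
  by rewrite !setrE /= modn_small.
apply: (st_load (a := size R0)); [by []|by rewrite setrE|by rewrite size_ram /mlen; lia|].
have e0 := @nth_ram succn 0 erefl; rewrite addn0 in e0.
rewrite e0 {1}/cell /=.
apply: (st_add (a := size R0) (c := 1)); [by []|by rewrite !setrE| | |].
- by rewrite !setrE /= modn_small.
- by move: small; rewrite /mlen; lia.
apply: (st_load (a := size R0 + 1)); [by []|regs|by rewrite size_ram /mlen; lia|].
by rewrite nth_ram // {2}/cell /= -RE.
Qed.

End Data.
End Machine.

(** * Output sequences with a short description *)

Section Exec.
Implicit Types (its : seq item) (ops : seq op) (nx : nat -> nat) (out : seq nquad).

Lemma chain_ext nx nx' s t l : nx =1 nx' -> chain nx s t l -> chain nx' s t l.
Proof.
move=> e; elim: l s => //= x l IH s [st xs ch]; split=> //.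
by rewrite -e; apply: IH.
Qed.

Lemma upd_ext nx nx' o : nx =1 nx' -> upd nx o =1 upd nx' o.
Proof. by move=> e j; rewrite /upd /= e. Qed.

Lemma exec_ext its nx nx1 ops out nx' :
  nx =1 nx1 -> exec its nx ops out nx' -> exec its nx1 ops out nx'.
Proof.
elim: ops nx nx1 out => [|o ops IH] nx nx1 out e /=.
  by move=> [-> e']; split=> // j; rewrite -e.
move=> [l [out' [oN ch al -> ex]]]; exists l, out'; split=> //.
- exact: chain_ext (upd_ext o e) ch.
- exact: IH (upd_ext o e) ex.
Qed.

Lemma exec_ext_r its nx ops out nx' nx1 :
  nx' =1 nx1 -> exec its nx ops out nx' -> exec its nx ops out nx1.
Proof.
move=> e; elim: ops nx out => [|o ops IH] nx out /=.
  by move=> [-> e']; split=> // j; rewrite e' e.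
by move=> [l [out' [oN ch al -> ex]]]; exists l, out'; split=> //; apply: IH.
Qed.

Lemma exec_cat its nx nx1 nx2 ops1 ops2 out1 out2 :
  exec its nx ops1 out1 nx1 -> exec its nx1 ops2 out2 nx2 ->
  exec its nx (ops1 ++ ops2) (out1 ++ out2) nx2.
Proof.
elim: ops1 nx out1 => [|o ops IH] nx out1 /=.
  by move=> [-> e] /= ex; apply: exec_ext ex => j; rewrite e.
move=> [l [out' [oN ch al -> ex]]] ex2; exists l, (out' ++ out2); split=> //.
- by rewrite catA.
- exact: IH ex ex2.
Qed.

Lemma exec_widen its its2 nx ops out nx' :
  exec its nx ops out nx' -> exec (its ++ its2) nx ops out nx'.
Proof.
elim: ops nx out => [//|o ops IH] nx out /= [l [out' [oN ch al -> ex]]].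
exists l, out'; split=> //; last exact: IH.
- by rewrite size_cat ltn_addr.
- apply/allP => j /(allP al) /andP[jN ft].
  by rewrite size_cat ltn_addr // nth_cat jN.
- congr (flatten _ ++ _); apply/eq_in_map => j /(allP al) /andP[jN _].
  by rewrite nth_cat jN.
Qed.

(** Two item arrays side by side: the first [n0] items rest with their initial links while a
    schedule runs on the others. *)
Definition shift_next (n0 : nat) nx (j : nat) := if j < n0 then j.+1 else n0 + nx (j - n0).

Definition shift_op (n0 : nat) (o : op) :=
  Op (n0 + o_i o) (n0 + o_v o) (o_p o) (o_r o) (o_cap o) (n0 + o_s o) (n0 + o_t o).

Lemma chain_shift n0 nx s t l : chain nx s t l ->
  chain (shift_next n0 nx) (n0 + s) (n0 + t) (map (addn n0) l).
Proof.
elim: l s => [s ->|x l IH s] //= [st -> ch]; split=> //; first by lia.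
by rewrite /shift_next ltnNge leq_addr /= addKn; apply: IH.
Qed.

Lemma upd_shift n0 nx o :
  shift_next n0 (upd nx o) =1 upd (shift_next n0 nx) (shift_op n0 o).
Proof.
move=> j; rewrite /shift_next /upd /shift_op /=.
case: ltnP => h; case: (eqVneq j) => e //; try lia.
- by rewrite e addKn eqxx.
- by have -> : (j - n0 == o_i o) = false by lia.
Qed.

Lemma shift_succ n0 : shift_next n0 succn =1 succn.
Proof. by move=> j; rewrite /shift_next; case: ltnP => //=; lia. Qed.

Lemma exec_shift its0 its nx ops out nx' : exec its nx ops out nx' ->
  exec (its0 ++ its) (shift_next (size its0) nx) (map (shift_op (size its0)) ops) out
    (shift_next (size its0) nx').
Proof.
elim: ops nx out => [|o ops IH] nx out /=.
  by move=> [-> e]; split=> // j; rewrite /shift_next e.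
move=> [l [out' [oN ch al -> ex]]]; exists (map (addn (size its0)) l), out'; split=> //.
- by rewrite size_cat ltn_add2l.
- exact: chain_ext (upd_shift _ _ _) (chain_shift _ ch).
- rewrite all_map; apply/allP => j /(allP al) /andP[jN ft] /=.
  by rewrite size_cat ltn_add2l jN nth_cat ltnNge leq_addr addKn.
- congr (flatten _ ++ _); rewrite -map_comp; apply: eq_map => j /=.
  by rewrite nth_cat ltnNge leq_addr addKn.
- exact: exec_ext (upd_shift _ _ _) (IH _ _ ex).
Qed.

End Exec.

Definition wf_item (B : nat) (it : item) : bool :=
  let: (b, lo, hi) := it in [&& b < B, lo < B & hi < B].

Definition wf_op (B N : nat) (o : op) : bool :=
  [&& o_v o <= N, o_s o <= N, o_t o <= N, o_p o < B, o_r o < B & o_cap o < B].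

(* The links are [succn] at the start and again at the end, so that a query can be
   repeated. *)
Definition sch (B k : nat) (out : seq nquad) : Prop :=
  exists its ops, [/\ size its <= k, size ops <= k, all (wf_item B) its,
    all (wf_op B (size its)) ops & exec its succn ops out succn].

Lemma sch_weaken B k k' out : k <= k' -> sch B k out -> sch B k' out.
Proof.
move=> le [its [ops [h1 h2 h3 h4 h5]]].
by exists its, ops; split=> //; apply: leq_trans le.
Qed.

Lemma sch0 B k : sch B k [::].
Proof. by exists [::], [::]; split. Qed.

(** The first schedule leaves its links as it found them, and the second one, renumbered, touches
    only its own items. *)
Lemma sch_cat B k1 k2 out1 out2 :
  sch B k1 out1 -> sch B k2 out2 -> sch B (k1 + k2) (out1 ++ out2).
Proof.
move=> [its1 [ops1 [i1 o1 wi1 wo1 ex1]]] [its2 [ops2 [i2 o2 wi2 wo2 ex2]]].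
exists (its1 ++ its2), (ops1 ++ map (shift_op (size its1)) ops2); split.
- by rewrite size_cat leq_add.
- by rewrite size_cat size_map leq_add.
- by rewrite all_cat wi1.
- rewrite all_cat all_map; apply/andP; split.
    apply: sub_all wo1 => o; rewrite /wf_op size_cat => /and5P[h1 h2 h3 -> ->].
    by rewrite !(leq_trans _ (leq_addr _ _)).
  apply: sub_all wo2 => o; rewrite /wf_op size_cat /= => /and5P[h1 h2 h3 -> ->].
  by rewrite !leq_add2l h1 h2 h3.
- apply: exec_cat (exec_widen its2 ex1) _.
  apply: exec_ext_r (shift_succ (size its1)) _.
  exact: exec_ext (shift_succ _) (exec_shift its1 ex2).
Qed.

Lemma sch_flatten (X : eqType) B (s : seq X) (k : X -> nat) (out : X -> seq nquad) :
  (forall x, x \in s -> sch B (k x) (out x)) ->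
  sch B (\sum_(x <- s) k x) (flatten (map out s)).
Proof.
elim: s => [_|x s IH H] /=; first exact: sch0.
rewrite big_cons; apply: sch_cat; first by apply: H; rewrite mem_head.
by apply: IH => y ys; apply: H; rewrite inE ys orbT.
Qed.

Lemma sch_one B p r b lo hi : p < B -> r < B -> b < B -> hi < B -> lo <= hi ->
  sch B 1 (emit p r hi (b, lo, hi)).
Proof.
move=> pB rB bB hB le.
exists [:: (b, lo, hi)], [:: Op 0 1 p r hi 0 1]; split=> //=.
- by rewrite bB hB (leq_ltn_trans le hB).
- by rewrite /wf_op /= pB rB hB.
- exists [:: 0], [::]; split=> //=.
  + by rewrite minnn le.
  + by rewrite !cats0.
  + by split=> // -[].
Qed.

(** Each rejected element closes one segment, whence the [.+1]. This is where the occurring words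
    enter the cost: a list with gaps is reported at the price of one operation per gap, plus one. *)
Lemma segments (T : eqType) (P : pred T) (l : seq T) : exists segs,
  [/\ filter P l = flatten segs, size segs <= (count (predC P) l).+1
    & forall s, s \in segs -> s != [::] /\ exists l1 l3, l = l1 ++ s ++ l3].
Proof.
(* Generalised over the segment [acc] that is being read; empty segments are removed afterwards. *)
suff H acc : all P acc -> exists segs,
  [/\ filter P (acc ++ l) = flatten segs, size segs <= (count (predC P) l).+1
    & forall s, s \in segs -> exists l1 l3, acc ++ l = l1 ++ s ++ l3].
  have [segs [f1 f2 f3]] := H [::] isT.
  exists [seq s <- segs | s != [::]]; split.
  - by rewrite -[LHS]/(filter P ([::] ++ l)) f1; elim: segs {f1 f2 f3} => //= -[|x s] ss /= ->.
  - by apply: leq_trans f2; rewrite size_filter count_size.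
  - by move=> s; rewrite mem_filter => /andP[-> /f3].
elim: l acc => [|x l IH] acc Pacc /=.
  exists [:: acc]; split=> //=; first by rewrite cats0 (all_filterP Pacc).
  by move=> s; rewrite inE => /eqP->; exists [::], [::]; rewrite cats0.
case Px: (P x) => /=.
  have [|segs [f1 f2 f3]] := IH (rcons acc x); first by rewrite all_rcons Px.
  by exists segs; rewrite -cat_rcons; split.
have [segs [f1 f2 f3]] := IH [::] isT.
exists (acc :: segs); split=> //=.
- by rewrite filter_cat /= Px (all_filterP Pacc) -f1.
- move=> s; rewrite inE => /orP[/eqP->|/f3 [l1 [l3 /= ->]]].
    by exists [::], (x :: l).
  by exists (acc ++ x :: l1), l3; rewrite -catA.
Qed.

Lemma iota_infix i n l1 s l3 : iota i n = l1 ++ s ++ l3 ->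
  s = iota (i + size l1) (size s).
Proof.
move=> e.
have : take (size s) (drop (size l1) (iota i n)) = s.
  by rewrite e drop_size_cat // take_size_cat.
rewrite drop_iota take_iota => {1}<-; congr iota.
move/(congr1 size): e; rewrite size_iota !size_cat => ->; lia.
Qed.

(** * Sweeping a linked list with deletions *)

Section Group.
Variables (B : nat) (its : seq item).
Hypothesis B0 : 0 < B.
Hypothesis its_wf : all (wf_item B) its.
Let N := size its.
Implicit Types (nx : nat -> nat) (l : seq nat).

(** No head of the list is stored: every operation that walks along it names its own start. The
    index [N] serves as end marker. *)
Fixpoint linked nx l : Prop :=
  if l is y :: s then nx y = head N s /\ linked nx s else True.

Lemma linked_sub nx l1 l2 : linked nx (l1 ++ l2) -> linked nx l2.
Proof. by elim: l1 => //= x l1 IH [_ /IH]. Qed.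

Lemma linked_upd nx y v l : y \notin l -> linked nx l -> linked [eta nx with y |-> v] l.
Proof.
elim: l => //= x l IH; rewrite inE negb_or => /andP[/negPf yx yl] [xe /(IH yl) lk].
by split=> //; rewrite eq_sym yx.
Qed.

Lemma linked_delete nx l1 y x l2 : uniq (l1 ++ y :: x :: l2) ->
  linked nx (l1 ++ y :: x :: l2) -> linked [eta nx with y |-> nx x] (l1 ++ y :: l2).
Proof.
elim: l1 => [|a l1 IH].
  rewrite /= eqxx => /and3P[yl xl ul] [ye [xe lk]]; split=> //.
  by apply: linked_upd => //; move: yl; rewrite inE negb_or => /andP[].
rewrite !cat_cons /= => /andP[al ul] [ae lk]; split; last exact: IH.
have -> : (a == y) = false.
  by apply: contraNF al => /eqP->; rewrite mem_cat mem_head orbT.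
by rewrite ae; case: l1 {IH al ul ae lk}.
Qed.

Lemma linked_iota n i : i + n = N -> linked succn (iota i n).
Proof.
elim: n i => //= n IH i e; split; last by apply: IH; lia.
by case: n e {IH} => [|n] /=; lia.
Qed.

Lemma chain_linked nx l1 l2 l3 : linked nx (l1 ++ l2 ++ l3) ->
  uniq (l2 ++ l3) -> all (gtn N) (l2 ++ l3) ->
  chain nx (head N (l2 ++ l3)) (head N l3) l2.
Proof.
move/linked_sub; elim: l2 => //= x l2 IH [xe lk] /andP[xl ul] /andP[xN al]; split=> //.
  case: l3 xl {IH lk ul xe al} => [|z l3] /= xl xz; first by move: xN; rewrite xz ltnn.
  by move: xl; rewrite xz mem_cat mem_head orbT.
by rewrite xe; apply: IH.
Qed.

Definition good_next nx := (forall j, j < N -> nx j <= N) /\ (forall j, N <= j -> nx j = j.+1).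

Lemma head_le l : all (gtn N) l -> head N l <= N.
Proof. by case: l => //= x l /andP[/ltnW]. Qed.

Lemma delete_many (a : pred nat) nx l : uniq l -> all (gtn N) l -> linked nx l ->
  good_next nx -> exists ops nx',
  [/\ size ops <= count (predC a) l, all (wf_op B N) ops, exec its nx ops [::] nx',
      linked nx' (filter a l) & good_next nx'].
Proof.
have [n] := ubnP (count (predC a) l); elim: n nx l => // n IH nx l cn ul lN lk gn.
have [al|] := boolP (all a l).
  by exists [::], nx; split=> //; rewrite (all_filterP al).
rewrite -has_predC => /hasP[x xl nax].
case/splitPr: xl cn ul lN lk => l1 l2 cn ul lN lk.
have fE : filter a (l1 ++ x :: l2) = filter a (l1 ++ l2).
  by rewrite !filter_cat /= (negPf nax).
have cE : count (predC a) (l1 ++ x :: l2) = (count (predC a) (l1 ++ l2)).+1.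
  by rewrite !count_cat /= (negPf nax) /=; lia.
have ul' : uniq (l1 ++ l2).
  by move: ul; rewrite !cat_uniq /= negb_or => /and3P[-> /andP[_ ->] /andP[_ ->]].
have lN' : all (gtn N) (l1 ++ l2).
  by move: lN; rewrite !all_cat /= => /and3P[-> _ ->].
rewrite fE cE in cn *.
(* Deleting the first item changes no link and costs no operation; any other item is bypassed by its
   predecessor [y]. *)
case: (lastP l1) ul lN lk ul' lN' cn {fE cE} => [|l1' y] ul lN lk ul' lN' cn.
  have [|||||ops [nx' [h1 h2 h3 h4 h5]]] := IH nx l2.
  - by move: cn => /=; lia.
  - by [].
  - by [].
  - by case: lk.
  - by [].
  exists ops, nx'; split=> //; exact: leq_trans h1 _.
rewrite !cat_rcons in ul lN lk.
pose o := Op y (nx x) 0 0 0 0 0.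
have yN : y < N by move: lN; rewrite all_cat /= => /and3P[].
have vN : nx x <= N.
  have [-> _] : linked nx (x :: l2).
    by move: lk; rewrite -cat_rcons => /linked_sub.
  by apply: head_le; move: lN; rewrite all_cat /= => /and4P[].
have gn' : good_next (upd nx o).
  case: gn => g1 g2; split=> j jN; rewrite /upd /=; case: (eqVneq j y) => // e.
  - exact: g1.
  - by move: jN; rewrite e leqNgt yN.
  - exact: g2.
have [||ops [nx' [h1 h2 h3 h4 h5]]] := IH (upd nx o) (rcons l1' y ++ l2) _ ul' lN' _ gn'.
- by lia.
- by rewrite cat_rcons; apply: linked_delete.
exists (o :: ops), nx'; split=> //=.
- by rewrite h2 /wf_op /= vN B0.
- by exists [::], [::]; split.
Qed.

Lemma report_segments p r cap nx l segs : p < B -> r < B -> cap < B ->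
  uniq l -> all (gtn N) l -> linked nx l -> good_next nx ->
  (forall s, s \in segs -> s != [::] /\ exists l1 l3, l = l1 ++ s ++ l3) ->
  all (fun j => fits cap (nth item0 its j)) (flatten segs) ->
  exists ops, [/\ size ops = size segs, all (wf_op B N) ops &
   exec its nx ops
    (flatten [seq emit p r cap (nth item0 its j) | j <- flatten segs]) nx].
Proof.
move=> pB rB cB ul lN lk [g1 g2].
elim: segs => [|s segs IH] H /=; first by exists [::]; split.
rewrite all_cat => /andP[fs /IH []]; first by move=> s' s'in; apply: H; rewrite inE s'in orbT.
move=> ops [h1 h2 h3]; have [sn0 [l1 [l3 lE]]] := H s (mem_head _ _).
have sN : all (gtn N) (s ++ l3) by move: lN; rewrite lE all_cat => /andP[].
have N0 : 0 < N.
  by move: sn0 sN; case: (s) => //= x s' _ /andP[h _]; apply: leq_ltn_trans h.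
(* Every operation writes a link; a mere report gives item 0 the successor that it already has. *)
exists (Op 0 (nx 0) p r cap (head N (s ++ l3)) (head N l3) :: ops); split=> /=.
- by rewrite h1.
- rewrite h2 /wf_op /= pB rB cB g1 // !head_le //.
  by move: sN; rewrite all_cat => /andP[].
have ue : nx =1 upd nx (Op 0 (nx 0) p r cap (head N (s ++ l3)) (head N l3)).
  by move=> j; rewrite /upd /=; case: eqP => // ->.
exists s, (flatten [seq emit p r cap (nth item0 its j) | j <- flatten segs]); split=> //=.
- apply: chain_ext ue _; apply: (@chain_linked _ l1); rewrite -?lE //.
  by move: ul; rewrite lE cat_uniq => /and3P[].
- apply/allP => j js; rewrite (allP fs) // andbT.
  by move: sN; rewrite all_cat => /andP[/allP /(_ j js)].
- by rewrite map_cat flatten_cat.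
- exact: exec_ext ue h3.
Qed.

Lemma restore nx n : n <= N -> exists ops nx',
  [/\ size ops = n, all (wf_op B N) ops, exec its nx ops [::] nx'
    & forall j, nx' j = if j < n then j.+1 else nx j].
Proof.
elim: n => [|n IH] nN; first by exists [::], nx; split.
have [ops [nx' [h1 h2 h3 h4]]] := IH (ltnW nN).
exists (ops ++ [:: Op n n.+1 0 0 0 0 0]), [eta nx' with n |-> n.+1]; split.
- by rewrite size_cat h1 addn1.
- by rewrite all_cat h2 /wf_op /= nN B0.
- rewrite -[[::]]/([::] ++ [::]); apply: exec_cat h3 _.
  by exists [::], [::]; split.
- by move=> j; rewrite /= h4 ltnS; case: ltngtP => // ->.
Qed.

(* Requests are served in the order of their thresholds [e x]; the items [j] with
   [E j < e x] have been deleted from the list by then, and the others with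
   [j < T x] are reported in one segment more than there are items skipped. *)
Section Requests.
Variables (X : eqType) (p r cap e T : X -> nat) (E : nat -> nat) (P : X -> pred nat).

Definition selected x := [seq j <- iota 0 N | [&& e x <= E j, j < T x & P x j]].
Definition skipped x := count (fun j => [&& e x <= E j, j < T x & ~~ P x j]) (iota 0 N).
Definition group_out (s : seq X) :=
  flatten [seq flatten [seq emit (p x) (r x) (cap x) (nth item0 its j) | j <- selected x]
          | x <- s].

Definition alive k := [seq j <- iota 0 N | k <= E j].

Lemma request_step nx x : p x < B -> r x < B -> cap x < B ->
  all (fun j => fits (cap x) (nth item0 its j)) (selected x) ->
  linked nx (alive (e x)) -> good_next nx ->
  exists ops, [/\ size ops <= (skipped x).+1, all (wf_op B N) ops &
   exec its nx ops (flatten [seq emit (p x) (r x) (cap x) (nth item0 its j)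
      | j <- selected x]) nx].
Proof.
move=> pB rB cB ft lk gn.
have [segs [s1 s2 s3]] := segments (P x) [seq j <- alive (e x) | j < T x].
(* The list is increasing, so its items below [T x] form a prefix, and segments of this prefix are
   segments of the list. *)
have alE : alive (e x) = [seq j <- alive (e x) | j < T x] ++ [seq j <- alive (e x) | T x <= j].
  rewrite /alive -!filter_predI.
  have : sorted ltn (iota 0 N) by apply: iota_ltn_sorted.
  elim: (iota 0 N) => //= y s IH ps.
  have {}IH := IH (path_sorted ps).
  case: (leqP (T x) y) => Ty; case: (e x <= E y) => //=; last by rewrite {1}IH.
  have al := order_path_min ltn_trans ps.
  rewrite [X in _ = X ++ _](_ : _ = [::]) /=.
    congr (_ :: _); apply: eq_in_filter => z /(allP al) /= yz.
    by rewrite (leq_trans Ty (ltnW yz)).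
  apply/eqP; rewrite -(negbK (_ == _)) -has_filter; apply/hasPn => z /(allP al) /= yz.
  by rewrite ltnNge (leq_trans Ty (ltnW yz)).
have selE : selected x = flatten segs.
  rewrite -s1 /alive -!filter_predI /selected.
  by apply: eq_filter => j /=; rewrite andbC -andbA andbC -andbA andbC [RHS]andbC -!andbA; do !bool_congr.
have skE : count (predC (P x)) [seq j <- alive (e x) | j < T x] = skipped x.
  rewrite /skipped /alive -!filter_predI count_filter.
  by apply: eq_count => j /=; rewrite andbC -andbA andbC -andbA; do !bool_congr.
rewrite selE in ft *; rewrite skE in s2.
have [||s ss|ops [h1 h2 h3]] := @report_segments (p x) (r x) (cap x) nx (alive (e x)) segs pB rB cB _ _ lk gn _ ft.
- by rewrite filter_uniq ?iota_uniq.
- by apply/allP => j; rewrite mem_filter mem_iota => /andP[_ /andP[]].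
- have [? [l1 [l3 le]]] := s3 s ss; split=> //; rewrite alE le.
  by exists l1, (l3 ++ [seq j <- alive (e x) | T x <= j]); rewrite -!catA.
by exists ops; split=> //; rewrite h1.
Qed.

(** Amortisation: the length of the list is the potential that pays for deletions. *)
Lemma alive_linked nx k k' : k <= k' -> linked nx (alive k) -> good_next nx ->
  exists ops nx', [/\ size ops + size (alive k') <= size (alive k), all (wf_op B N) ops,
    exec its nx ops [::] nx', linked nx' (alive k') & good_next nx'].
Proof.
move=> kk lk gn.
have fE : [seq j <- alive k | k' <= E j] = alive k'.
  rewrite /alive -filter_predI; apply: eq_filter => j /=.
  by case: leqP => //= h; rewrite (leq_trans kk h).
have [||ops [nx' [h1 h2 h3 h4 h5]]] := @delete_many (fun j => k' <= E j) nx (alive k) _ _ lk gn.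
- by rewrite filter_uniq ?iota_uniq.
- by apply/allP => j; rewrite mem_filter mem_iota => /andP[_ /andP[]].
rewrite fE in h4; exists ops, nx'; split=> //.
rewrite -fE size_filter addnC -(count_predC (fun j => k' <= E j)) leq_add2l //.
Qed.

Lemma requests_run s k nx : path leq k (map e s) ->
  (forall x, x \in s -> [/\ p x < B, r x < B, cap x < B &
     all (fun j => fits (cap x) (nth item0 its j)) (selected x)]) ->
  linked nx (alive k) -> good_next nx ->
  exists ops nx', [/\ size ops <= \sum_(x <- s) (skipped x).+1 + size (alive k),
    all (wf_op B N) ops, exec its nx ops (group_out s) nx' & good_next nx'].
Proof.
elim: s k nx => [|x s IH] k nx /=.
  by move=> _ _ _ gn; exists [::], nx; split.
move=> /andP[kx ps] H lk gn; rewrite big_cons /group_out /=.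
have [ops1 [nx1 [a1 a2 a3 a4 a5]]] := alive_linked kx lk gn.
have [pB rB cB ft] := H x (mem_head _ _).
have [ops2 [b1 b2 b3]] := request_step pB rB cB ft a4 a5.
have [|ops3 [nx3 [c1 c2 c3 c4]]] := IH _ _ ps _ a4 a5.
  by move=> y ys; apply: H; rewrite inE ys orbT.
exists (ops1 ++ ops2 ++ ops3), nx3; split=> //.
- rewrite !size_cat; lia.
- by rewrite !all_cat a2 b2.
- by apply: (exec_cat a3 (exec_cat b3 c3)).
Qed.

(** All deletions together cost at most [N] operations, and restoring the links costs another
    [N]. *)
Lemma sch_group s : sorted leq (map e s) ->
  (forall x, x \in s -> [/\ p x < B, r x < B, cap x < B &
     all (fun j => fits (cap x) (nth item0 its j)) (selected x)]) ->
  sch B (2 * N + \sum_(x <- s) (skipped x).+1) (group_out s).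
Proof.
move=> ss H.
have aE : alive 0 = iota 0 N by apply/all_filterP/allP.
have [|||ops [nx [h1 h2 h3 [g1 g2]]]] := @requests_run s 0 succn _ H.
- by case: (map e s) ss.
- by rewrite aE; apply: linked_iota.
- by split.
have [ops2 [nx2 [r1 r2 r3 r4]]] := @restore nx N (leqnn _).
exists its, (ops ++ ops2); split=> //.
- by rewrite mul2n -addnn -addnA leq_addr.
- by rewrite size_cat r1; move: h1; rewrite aE size_iota; lia.
- by rewrite all_cat h2.
- rewrite -[group_out s]cats0; apply: exec_cat h3 _.
  have e2 : nx2 =1 succn by move=> j; rewrite r4; case: ltnP => // /g2.
  exact: exec_ext_r e2 r3.
Qed.

End Requests.
End Group.

(** * Run-length encodings *)

Section Runs.
Variable Sigma : eqType.
Implicit Types (R V W : seq (Sigma * nat)) (w s X : seq Sigma).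

Definition unrle R : seq Sigma := flatten [seq nseq q.2 q.1 | q <- R].

Definition neqb (a b : Sigma) := a != b.

Definition canon R : bool :=
  all (fun q => 0 < q.2) R && sorted neqb (map fst R).

Lemma unrle_cat R1 R2 : unrle (R1 ++ R2) = unrle R1 ++ unrle R2.
Proof. by rewrite /unrle map_cat flatten_cat. Qed.

Lemma unrle_cons q R : unrle (q :: R) = nseq q.2 q.1 ++ unrle R.
Proof. by []. Qed.

Lemma unrle_rcons R q : unrle (rcons R q) = unrle R ++ nseq q.2 q.1.
Proof. by rewrite -cats1 unrle_cat /unrle /= cats0. Qed.

Lemma canon_cons q R : canon (q :: R) =
  [&& 0 < q.2, path neqb q.1 (map fst R) & all (fun q => 0 < q.2) R].
Proof. by rewrite /canon /=; case: (0 < q.2) => //=; rewrite andbC. Qed.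

Lemma canon_behead q R : canon (q :: R) -> canon R.
Proof. by rewrite canon_cons /canon => /and3P[_ /path_sorted -> ->]. Qed.

Lemma merge_canon R : canon R -> merge_runs R = R.
Proof.
elim: R => //= q R IH cR; rewrite /merge_runs /= -/(merge_runs R) (IH (canon_behead cR)).
by case: R cR {IH} => //= -[c l] R; rewrite canon_cons /= /neqb => /and3P[_ /andP[/negPf-> _] _].
Qed.

Lemma push_canon q R : 0 < q.2 -> canon R -> canon (push_run q R).
Proof.
case: R => [|[c l] R] q0 /=; first by rewrite canon_cons q0.
case: eqP => [_|/eqP ne] cR; last first.
  by move: cR; rewrite !canon_cons /= q0 /neqb ne /= => /and3P[-> -> ->].
by move: cR; rewrite !canon_cons /= addn_gt0 q0 /= => /and3P[_ -> ->].
Qed.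

Lemma canon_merge R : all (fun q => 0 < q.2) R -> canon (merge_runs R).
Proof.
elim: R => //= q R IH /andP[q0 /IH cR]; exact: push_canon.
Qed.

Lemma unrle_push q R : unrle (push_run q R) = nseq q.2 q.1 ++ unrle R.
Proof.
case: R => [|[c l] R] //=; case: eqP => //= e.
by rewrite /unrle /= nseqD e catA.
Qed.

Lemma unrle_merge R : unrle (merge_runs R) = unrle R.
Proof. by elim: R => //= q R IH; rewrite unrle_push IH. Qed.

Lemma unrle_rle w : unrle (rle w) = w.
Proof. by rewrite unrle_merge; elim: w => //= c w IH; rewrite unrle_cons IH. Qed.

Lemma canon_rle w : canon (rle w).
Proof. by apply: canon_merge; rewrite all_map; apply/allP. Qed.

Lemma push_push c k l R : push_run (c, k) (push_run (c, l) R) = push_run (c, k + l) R.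
Proof.
case: R => [|[c' l'] R] /=; first by rewrite eqxx.
by case: (eqVneq c c') => [e|ne] /=; rewrite -?e eqxx ?addnA.
Qed.

Lemma rle_nseq k c s : 0 < k -> rle (nseq k c ++ s) = push_run (c, k) (rle s).
Proof.
case: k => // k _; elim: k => [|k IH] //.
by rewrite /rle /merge_runs /= in IH *; rewrite IH push_push.
Qed.

Lemma rle_unrle R : canon R -> rle (unrle R) = R.
Proof.
move=> cR; rewrite -[RHS](merge_canon cR).
elim: R cR => //= -[c k] R IH cR; rewrite unrle_cons rle_nseq.
  by rewrite (IH (canon_behead cR)).
by move: cR; rewrite canon_cons => /and3P[].
Qed.

Lemma unrle_inj R1 R2 : canon R1 -> canon R2 -> unrle R1 = unrle R2 -> R1 = R2.
Proof. by move=> c1 c2 e; rewrite -(rle_unrle c1) e rle_unrle. Qed.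

Lemma rle_catl s e a : 0 < e ->
  exists R1 l, rle (s ++ nseq e a) = rcons R1 (a, l) /\ e <= l.
Proof.
move=> e0; elim: s => [|c s [R1 [l [E le]]]].
  by exists [::], e; rewrite -[X in rle X]cats0 rle_nseq.
rewrite cat_cons -[c :: _]/(nseq 1 c ++ _) rle_nseq // E.
case: R1 {E} => [|[c' l'] R1] /=.
  case: eqP => _; first by exists [::], (1 + l); split=> //; rewrite (leq_trans le) ?leq_addl.
  by exists [:: (c, 1)], l.
case: eqP => _; first by exists ((c', 1 + l') :: R1), l.
by exists [:: (c, 1), (c', l') & R1], l.
Qed.

Lemma rle_catr s f d : 0 < f ->
  exists R2 l, rle (nseq f d ++ s) = (d, l) :: R2 /\ f <= l.
Proof.
move=> f0; rewrite rle_nseq //; case: (rle s) => [|[c l] R] /=.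
  by exists [::], f.
case: eqP => [->|_]; last by exists ((c, l) :: R), f.
by exists R, (f + l); rewrite leq_addr.
Qed.

Lemma canon_cat_cons R1 q R2 :
  canon (R1 ++ q :: R2) = canon (rcons R1 q) && canon (q :: R2).
Proof.
rewrite /canon map_cat map_rcons !all_cat all_rcons /=.
have -> : sorted neqb (map fst R1 ++ q.1 :: map fst R2) =
   sorted neqb (rcons (map fst R1) q.1) && path neqb q.1 (map fst R2).
  by case: (map fst R1) => //= x y; rewrite cat_path rcons_path /= andbA.
by case: (0 < q.2); case: (all _ R1); case: (all _ R2); case: (sorted _ _); case: (path _ _ _).
Qed.

Lemma canon_head_len a e e' R : 0 < e' -> canon ((a, e) :: R) -> canon ((a, e') :: R).
Proof. by rewrite !canon_cons /= => -> /and3P[_ -> ->]. Qed.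

Lemma canon_last_len a e e' R : 0 < e' -> canon (rcons R (a, e)) -> canon (rcons R (a, e')).
Proof.
by rewrite /canon !map_rcons !all_rcons /= => -> /andP[/andP[_ ->] ->].
Qed.

(** The word has at least two runs, so its inner run boundaries are run boundaries of the text; only
    the two outer runs can be part of longer ones. *)
Lemma infix_runs R a e V d f : canon R -> canon ((a, e) :: rcons V (d, f)) ->
  reflect (exists R1 R2 l l', [/\ R = R1 ++ (a, l) :: V ++ (d, l') :: R2, e <= l & f <= l'])
    (infix (unrle ((a, e) :: rcons V (d, f))) (unrle R)).
Proof.
move=> cR cW; apply: (iffP idP) => [/infixP[s1 [s2]]|].
  rewrite unrle_cons unrle_rcons /= => E.
  have e0 : 0 < e by move: cW; rewrite canon_cons => /and3P[].
  have f0 : 0 < f.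
    by move: cW; rewrite /canon /= all_rcons => /andP[/andP[_ /andP[]]].
  have [R1 [l [E1 le1]]] := rle_catl s1 a e0.
  have [R2 [l' [E2 le2]]] := rle_catr s2 d f0.
  exists R1, R2, l, l'; split=> //.
  (* Canonical encodings of the same string agree. The outer runs are taken with their full lengths
     [l] and [l'] in the text. *)
  apply: unrle_inj => //.
    have c1 := canon_rle (s1 ++ nseq e a); have c2 := canon_rle (nseq f d ++ s2).
    rewrite E1 in c1; rewrite E2 in c2.
    rewrite canon_cat_cons c1 /= -cat_cons canon_cat_cons c2 andbT.
    rewrite rcons_cons; apply: (canon_head_len (e := e)).
      exact: leq_trans le1.
    rewrite -rcons_cons; apply: (@canon_last_len d f l' ((a, e) :: V)) => //.
    exact: leq_trans le2.
  by rewrite E -cat_rcons unrle_cat -E1 unrle_cat -E2 !unrle_rle; rewrite -!catA.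
move=> [R1 [R2 [l [l' [-> le1 le2]]]]].
apply/infixP; exists (unrle R1 ++ nseq (l - e) a), (nseq (l' - f) d ++ unrle R2).
rewrite !unrle_cat !unrle_cons unrle_rcons unrle_cat unrle_cons /=.
rewrite -{1}(subnK le1) -{1}(subnKC le2) !nseqD -!catA; congr (_ ++ (_ ++ _)).
Qed.

Lemma mem_unrle R c : all (fun q => 0 < q.2) R -> (c \in unrle R) = (c \in map fst R).
Proof.
elim: R => //= q R IH /andP[q0 /IH {}IH]; rewrite unrle_cons mem_cat IH inE.
by rewrite mem_nseq q0.
Qed.

Lemma size_unrle_nth R q : q \in R -> q.2 <= size (unrle R).
Proof.
elim: R => //= q' R IH; rewrite inE unrle_cons size_cat size_nseq.
by move=> /orP[/eqP->|/IH le]; [rewrite leq_addr | rewrite (leq_trans le) ?leq_addl].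
Qed.

Lemma size_rle_le R : all (fun q => 0 < q.2) R -> size R <= size (unrle R).
Proof.
elim: R => //= q R IH /andP[q0 /IH {}IH].
by rewrite unrle_cons size_cat size_nseq -add1n leq_add.
Qed.

(** [pmap id] erases the two end markers and leaves the letters in place. *)
Lemma occurs_infix X w : occurs w (None :: rcons [seq Some x | x <- X] None) = infix w X.
Proof.
apply/idP/idP => [/infixP[s1 [s2 E]]|/infixP[s1 [s2 ->]]].
  have pS u : pmap id (map Some u) = u :> seq Sigma by elim: u => //= x u ->.
  have := congr1 (pmap id) E; rewrite /= -cats1 !pmap_cat /= cats0 !pS => ->.
  by apply/infixP; exists (pmap id s1), (pmap id s2).
apply/infixP; exists (None :: map Some s1), (rcons (map Some s2) None).
by rewrite !map_cat -!cats1 /= -!catA.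
Qed.

Definition mawb X w : bool :=
  [&& w != [::], ~~ infix w X, infix (behead w) X & infix (take (size w).-1 w) X].

(** Every proper factor lies in the word without its first letter or in the word without its last
    letter, so these two suffice. *)
Lemma mawP X w : reflect (is_maw (None :: rcons [seq Some x | x <- X] None) w) (mawb X w).
Proof.
apply: (iffP and4P) => [[w0 nw bw tw]|[nw H]].
  split; first by rewrite occurs_infix.
  move=> v /infixP[s1 [s2 E]] vw; rewrite occurs_infix.
  case: s1 E => [|c s1] E.
    case/lastP: s2 E => [|s2 c] E; first by rewrite E /= cats0 eqxx in vw.
    apply: infix_trans tw; rewrite E /= size_cat size_rcons addnS /= -rcons_cat -cats1.
    by rewrite take_size_cat ?size_cat // infix_catr // infix_refl.
  by apply: infix_trans bw; rewrite E /= infix_catl // infix_catr // infix_refl.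
have w0 : w != [::].
  by apply: contraNneq nw => ->; rewrite occurs_infix infix0s.
rewrite occurs_infix in nw; split=> //; rewrite -occurs_infix; apply: H.
- by case: (w) => // c s; rewrite -[c :: s]/([:: c] ++ s) infix_catl // infix_refl.
- by apply: contraNneq w0 => /(congr1 size); rewrite size_behead; case: (w) => //= c s; lia.
- by apply/infixP; exists [::], (drop (size w).-1 w); rewrite /= cat_take_drop.
- apply: contraNneq w0 => /(congr1 size); rewrite size_takel ?leq_pred //.
  by case: (w) => //= c s; lia.
Qed.

End Runs.

(** * Quadruples of minimal absent words *)

Section Words.
Variable Sigma : eqType.
Implicit Types (R V W U : seq (Sigma * nat)) (w s X : seq Sigma) (a b : Sigma).

(** The one-run companion of [infix_runs]: here both ends of the occurrence may cut the same run of
    the text, so a single length has to be compared. *)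
Lemma infix_nseq R a k : canon R -> 0 < k ->
  reflect (exists R1 R2 l, R = R1 ++ (a, l) :: R2 /\ k <= l) (infix (nseq k a) (unrle R)).
Proof.
move=> cR k0; apply: (iffP idP) => [/infixP[s1 [s2 E]]|].
  have [R2 [l [E2 le2]]] := rle_catr s2 a k0.
  have [R1 [l1 [E1 le1]]] := rle_catl s1 a (leq_trans k0 le2).
  exists R1, R2, l1; split; last exact: leq_trans le1.
  have c1 := canon_rle (s1 ++ nseq l a); have c2 := canon_rle (nseq k a ++ s2).
  rewrite E1 in c1; rewrite E2 in c2.
  apply: unrle_inj => //.
    rewrite canon_cat_cons c1; apply: canon_head_len c2.
    exact: leq_trans (leq_trans k0 le2) le1.
  rewrite E -(unrle_rle (nseq k a ++ s2)) E2 unrle_cons catA /=.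
  by rewrite -(unrle_rle (s1 ++ _)) E1 -cat_rcons unrle_cat.
move=> [R1 [R2 [l [-> le]]]].
apply/infixP; exists (unrle R1 ++ nseq (l - k) a), (unrle R2).
by rewrite unrle_cat unrle_cons /= -{1}(subnK le) nseqD -!catA.
Qed.

Lemma take_rcons_nseq s g b :
  take (size (s ++ nseq g.+1 b)).-1 (s ++ nseq g.+1 b) = s ++ nseq g b.
Proof.
by rewrite -addn1 nseqD catA /= size_cat addn1 /= take_size_cat.
Qed.

Lemma canon_belast V q : canon (rcons V q) -> canon V.
Proof.
rewrite /canon map_rcons all_rcons => /andP[/andP[_ ->]].
by rewrite -cats1 => /cat_sorted2[].
Qed.

Section Text.
Variables (R : seq (Sigma * nat)) (n : nat).
Hypothesis cR : canon R.
Hypothesis n_size : size (unrle R) <= n.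
Hypothesis n0 : 0 < n.

Definition occurs_runs W := infix (unrle W) (unrle R).
Definition maw_runs W := mawb (unrle R) (unrle W).

Lemma occ_infix V W : infix (unrle V) (unrle W) -> occurs_runs W -> occurs_runs V.
Proof. exact: infix_trans. Qed.

Lemma mw_ends a U b : maw_runs ((a, 1) :: rcons U (b, 1)) =
  [&& ~~ occurs_runs ((a, 1) :: rcons U (b, 1)), occurs_runs (rcons U (b, 1)) & occurs_runs ((a, 1) :: U)].
Proof.
rewrite /maw_runs /mawb /occurs_runs.
have -> : take (size (unrle ((a, 1) :: rcons U (b, 1)))).-1 (unrle ((a, 1) :: rcons U (b, 1)))
   = unrle ((a, 1) :: U).
  by rewrite -rcons_cons unrle_rcons take_rcons_nseq cats0.
by rewrite !unrle_cons /=.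
Qed.

Lemma mw_absent a (e : nat) V : 1 < e -> maw_runs ((a, e) :: V) ->
  ~~ occurs_runs ((a, e) :: V) /\ occurs_runs ((a, e.-1) :: V).
Proof. by case: e => [|[|e]] // _ /and4P[_ h1 h2 _]; split. Qed.

(** Minimal absent words form an antichain for the factor order. *)
Lemma mw_neq W W' : maw_runs W -> maw_runs W' -> infix (unrle W) (unrle W') -> unrle W = unrle W'.
Proof.
move=> h /mawP[_ H'] inf; apply/eqP; apply: contraTT h => ne.
have := H' _ inf ne; rewrite occurs_infix => o.
by rewrite /maw_runs /mawb o andbF.
Qed.

Lemma nth_runs a d R1 q R2 : R = R1 ++ q :: R2 -> nth (a, d) R (size R1) = q.
Proof. by move->; rewrite nth_cat ltnn subnn. Qed.

Lemma len_le q : q \in R -> q.2 <= n.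
Proof. by move=> qR; apply: leq_trans n_size; apply: size_unrle_nth. Qed.

(** Positions in a quadruple count from one, those in [R] from zero: [p] is the run of [a] and [r]
    the run of [d]. *)
Lemma decode_right a V d f b R1 R2 l l' :
  R = R1 ++ (a, l) :: V ++ (d, l') :: R2 -> f <= n -> 
  let q := (b, f, (size R1).+1, (size R1 + size V).+2) : quad Sigma in
  decode R q = merge_runs ((a, 1) :: rcons V (d, f) ++ [:: (b, 1)])
  /\ quad_ok n (size R) q.
Proof.
move=> E fn q; rewrite /q /decode /=.
have -> : ((size R1).+1 == (size R1 + size V).+2) = false by lia.
have -> : (size R1).+1 < (size R1 + size V).+2 by lia.
rewrite (nth_runs b 0 E).
have E2 : R = (R1 ++ (a, l) :: V) ++ (d, l') :: R2 by rewrite E -catA.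
have s2 : size (R1 ++ (a, l) :: V) = (size R1 + size V).+1 by rewrite size_cat addnS.
rewrite -s2 (nth_runs b 0 E2) E2 take_size_cat //.
have -> : drop (size R1).+1 (R1 ++ (a, l) :: V) = V.
  by rewrite -cat_rcons drop_size_cat // size_rcons.
split; first by rewrite /= -cats1 -catA.
by rewrite /quad_ok fn !size_cat /=; lia.
Qed.

Lemma decode_pair a b k R1 R2 l : R = R1 ++ (a, l) :: R2 -> k <= n ->
  let q := (b, k, (size R1).+1, (size R1).+1) : quad Sigma in
  decode R q = merge_runs [:: (a, k); (b, 1)] /\ quad_ok n (size R) q.
Proof.
move=> E kn q; rewrite /q /decode /= eqxx (nth_runs b 0 E); split=> //.
by rewrite kn E size_cat /=; lia.
Qed.

Lemma mw_single a k : 0 < k -> maw_runs [:: (a, k)] ->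
  (k = 1 /\ a \notin unrle R) \/
  (1 < k /\ exists R1 R2, R = R1 ++ (a, k.-1) :: R2).
Proof.
have e1 : unrle [:: (a, k)] = nseq k a by rewrite /unrle /= cats0.
move=> k0; rewrite /maw_runs /mawb {}e1 => /and4P[_ no bo _].
case: k k0 no bo => [|[|k]] //= _ no bo.
  by left; split=> //; move: no; rewrite /= infix1s.
right; split=> //.
have [R1 [R2 [l [E le]]]] := infix_nseq a cR (ltn0Sn k) bo.
exists R1, R2; suff -> : k.+1 = l by [].
apply/eqP; rewrite eqn_leq le leqNgt; apply: contra no => lt.
by apply/(@infix_nseq R a k.+2 cR erefl); exists R1, R2, l.
Qed.

Lemma canon_pred a (e : nat) V : 1 < e -> canon ((a, e) :: V) -> canon ((a, e.-1) :: V).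
Proof. by move=> e1; apply: canon_head_len; lia. Qed.

Lemma mw_double a (e : nat) V : 1 < e -> canon ((a, e) :: V) -> maw_runs ((a, e) :: V) ->
  exists R1 R2, R = R1 ++ (a, e.-1) :: R2 /\ prefix (unrle V) (unrle R2).
Proof.
move=> e1 cW h; case: (lastP V) cW h => [|V' [d f]] cW h.
  have [[]|[_ [R1 [R2 E]]]] := mw_single (ltnW e1) h; first by lia.
  by exists R1, R2; rewrite prefix0s.
have [no oc] := mw_absent e1 h.
have [R1 [R2 [l [l' [E le1 le2]]]]] := infix_runs cR (canon_pred e1 cW) oc.
(* A longer run would contain [a^e] in front of the same continuation, and the absent word would
   occur. *)
have lE : l = e.-1.
  apply/eqP; rewrite eqn_leq le1 andbT leqNgt; apply: contra no => lt.
  by apply/infix_runs => //; exists R1, R2, l, l'; split=> //; lia.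
exists R1, (V' ++ (d, l') :: R2); rewrite E lE; split=> //.
rewrite unrle_rcons unrle_cat unrle_cons /= -(subnKC le2) nseqD -!catA.
by apply/prefixP; eexists; rewrite -catA.
Qed.

(** The interpreter reserves [p = 0] for words of length one, where it writes [(x, 1, 0, 0)]. *)
Definition emittable (q : quad Sigma) : bool :=
  let: (a, k, p, r) := q in (0 < p) || ((k == 1) && (r == 0)).

Lemma maw_quad W : canon W -> maw_runs W ->
  exists q, [/\ decode R q = W, quad_ok n (size R) q & emittable q].
Proof.
case: W => [|[a e] V] //= cW h.
have := cW; rewrite canon_cons => /and3P[e0 _ _]; rewrite /= in e0.
case: (lastP V) cW h => [|V' [d f]] cW h.
  have [[-> _]|[k1 [R1 [R2 E]]]] := mw_single e0 h.
    exists (a, 1, 0, 0); split=> //=.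
    by rewrite n0.
  (* The power [a^e] is given as a run [a^(e-1)] of the text followed by the letter [a], which
     [decode] merges into one run, because the form with [p = 0] is reserved for single letters. *)
  have [|h1 h2] := @decode_pair a a e.-1 _ _ _ E; last first.
    exists (a, e.-1, (size R1).+1, (size R1).+1); split=> //; rewrite h1 /merge_runs /= eqxx.
    by rewrite addn1 prednK.
  by apply: (@len_le (a, e.-1)); rewrite E mem_cat mem_head orbT.
case: (ltnP 1 e) => e1.
  have [no oc] := mw_absent e1 h.
  have [R1 [R2 [l [l' [E le1 le2]]]]] := infix_runs cR (canon_pred e1 cW) oc.
  have lE : l = e.-1.
    apply/eqP; rewrite eqn_leq le1 andbT leqNgt; apply: contra no => lt.
    by apply/infix_runs => //; exists R1, R2, l, l'; split=> //; lia.
  (* The form with a letter in front: the run at [r] has length exactly [e - 1] and absorbs the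
     added [a]. *)
  exists (a, f, (size R1 + size V').+2, (size R1).+1).
  have E2 : R = (R1 ++ (a, l) :: V') ++ (d, l') :: R2 by rewrite E -catA.
  have s2 : size (R1 ++ (a, l) :: V') = (size R1 + size V').+1 by rewrite size_cat addnS.
  split=> //; last first.
    have -> : size R = (size R1 + size V' + size R2).+2 by rewrite E2 size_cat s2 /=; lia.
    rewrite /quad_ok (leq_trans le2) /=; first by lia.
    by apply: (@len_le (d, l')); rewrite E2 mem_cat mem_head orbT.
  rewrite /decode /=.
  have -> : ((size R1 + size V').+2 == (size R1).+1) = false by lia.
  have -> : (size R1 + size V').+2 < (size R1).+1 = false by lia.
  rewrite -s2 (nth_runs a 0 E2) E2 take_size_cat // drop_size_cat //= lE.
  rewrite cats1 -[push_run (a, e.-1) _]/(merge_runs ((a, e.-1) :: rcons V' (d, f))).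
  rewrite (merge_canon (canon_pred e1 cW)).
  by rewrite /= eqxx add1n prednK.
have {e0 e1} eE : e = 1 by lia.
rewrite {}eE in cW h *.
have tE : take (size (unrle ((a, 1) :: rcons V' (d, f)))).-1 (unrle ((a, 1) :: rcons V' (d, f)))
   = unrle ((a, 1) :: V') ++ nseq f.-1 d.
  have f0 : 0 < f.
    by move: cW; rewrite /canon /= all_rcons => /andP[/andP[]].
  by rewrite -rcons_cons unrle_rcons; case: (f) f0 => // f' _; rewrite take_rcons_nseq.
have := h; rewrite /maw_runs /mawb tE => /and4P[_ _ bo oc].
case: f cW h tE oc bo => [|[|f]] cW h tE oc bo.
- by move: cW; rewrite /canon /= all_rcons /=.
- rewrite cats0 in oc; case: (lastP V') cW h oc tE bo => [|U [c k]] cW h oc tE bo.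
    have aR : infix (nseq 1 a) (unrle R) by rewrite /unrle /= in oc *.
    have [R1 [R2 [l [E le]]]] := infix_nseq a cR (isT : 0 < 1) aR.
    have [|h1 h2] := @decode_pair a d 1 _ _ _ E; last first.
      exists (d, 1, (size R1).+1, (size R1).+1); split=> //; rewrite h1.
      exact: merge_canon.
    by apply: leq_trans le _; apply: (@len_le (a, l)); rewrite E mem_cat mem_head orbT.
  have cU : canon ((a, 1) :: rcons U (c, k)).
    by move: cW; rewrite -rcons_cons => /canon_belast.
  have [R1 [R2 [l [l' [E le1 le2]]]]] := infix_runs cR cU oc.
  have [|h1 h2] := @decode_right a U c k d _ _ _ _ E.
    by apply: leq_trans le2 _; apply: (@len_le (c, l')); rewrite E mem_cat inE mem_cat mem_head !orbT.
  exists (d, k, (size R1).+1, (size R1 + size U).+2); split=> //; rewrite h1 cats1 -rcons_cons.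
  exact: merge_canon.
(* The last run has length [f + 2]. The quadruple stores [f + 1], the length that is known to occur,
   and its final letter [d] supplies the missing one. *)
have cU : canon ((a, 1) :: rcons V' (d, f.+1)).
  by rewrite -rcons_cons; apply: (@canon_last_len _ d f.+2 f.+1 ((a, 1) :: V')).
have {}oc : occurs_runs ((a, 1) :: rcons V' (d, f.+1)) by rewrite /occurs_runs -rcons_cons unrle_rcons.
have [R1 [R2 [l [l' [E le1 le2]]]]] := infix_runs cR cU oc.
have [|h1 h2] := @decode_right a V' d f.+1 d _ _ _ _ E.
  by apply: leq_trans le2 _; apply: (@len_le (d, l')); rewrite E mem_cat inE mem_cat mem_head !orbT.
exists (d, f.+1, (size R1).+1, (size R1 + size V').+2); split=> //; rewrite h1.
rewrite -[RHS](merge_canon cW) /merge_runs -!rcons_cons -!cats1 -catA !foldr_cat /=.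
by rewrite foldr_cat /= eqxx addn1.
Qed.

Definition doubled W := if W is q :: _ then 1 < q.2 else false.

(* A MAW [w = a a z] is determined by any position where [a z] occurs; this
   occurrence is at the start of a run, since [w] is absent. *)
Lemma double_count (s : seq (seq (Sigma * nat))) : uniq s ->
  (forall W, W \in s -> [/\ canon W, maw_runs W & doubled W]) -> size s <= size R.
Proof.
move=> us H.
pose P W i := if W is (a, e) :: V then
  (nth (a, 0) R i == (a, e.-1)) && prefix (unrle V) (unrle (drop i.+1 R)) else false.
pose g W := find (P W) (iota 0 (size R)).
have hasP W : W \in s -> has (P W) (iota 0 (size R)).
  move=> /H[]; case: W => [|[a e] V] //= cW h e1; rewrite /= in e1.
  have [R1 [R2 [E pr]]] := mw_double e1 cW h.
  apply/hasP; exists (size R1); first by rewrite mem_iota E size_cat /=; lia.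
  by rewrite /= (nth_runs a 0 E) eqxx /= E -cat_rcons drop_size_cat ?size_rcons.
have gP W : W \in s -> exists a e V, [/\ W = (a, e) :: V, 1 < e, g W < size R,
    nth (a, 0) R (g W) = (a, e.-1) & prefix (unrle V) (unrle (drop (g W).+1 R))].
  move=> Ws; have h := hasP _ Ws.
  have lt : g W < size R by move: h; rewrite has_find size_iota.
  have := nth_find 0 h; rewrite nth_iota // add0n -/(g W).
  have [_ _] := H _ Ws; case: W {Ws h} lt => [|[a e] V] //= lt e1 /andP[/eqP E pr].
  by exists a, e, V.
(* Two words charged to the same run continue as prefixes of the same string, so one is a prefix of
   the other, and the antichain property makes them equal. *)
have pc (u v t : seq Sigma) : prefix u t -> prefix v t -> prefix u v \/ prefix v u.
  move=> /prefixP[x ->]; rewrite !prefixE => /eqP E.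
  case: (leqP (size u) (size v)) => le.
    by left; rewrite -E take_takel // take_size_cat.
  by right; rewrite -{2}E takel_cat // ltnW.
have gI : {in s &, injective g}.
  move=> W W' Ws W's gg.
  have [cW mW _] := H _ Ws; have [cW' mW' _] := H _ W's.
  have [a [e [V [E e1 lt eW prW]]]] := gP _ Ws.
  have [a' [e' [V' [E' e1' lt' eW' prW']]]] := gP _ W's.
  rewrite -gg in eW' prW'.
  rewrite (set_nth_default (a', 0)) // eW' in eW.
  case: eW => aa ee; have {}ee : e' = e by lia.
  rewrite aa ee in E'; apply: unrle_inj => //.
  case: (pc _ _ _ prW prW') => /prefixP[t Et].
    apply: mw_neq => //; apply/infixP; exists [::], t.
    by rewrite E E' !unrle_cons Et -catA.
  apply/esym/mw_neq => //; apply/infixP; exists [::], t.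
  by rewrite E E' !unrle_cons Et -catA.
rewrite -(size_map g) -[X in _ <= X](size_iota 0); apply: uniq_leq_size.
  by rewrite map_inj_in_uniq.
by move=> _ /mapP[W Ws ->]; rewrite mem_iota; have [? [? [? []]]] := gP _ Ws.
Qed.

End Text.
End Words.

(** * Classes of minimal absent words *)

Lemma uniq_map_count (X Y : eqType) (s : seq X) (t : seq Y) (f : X -> Y) :
  uniq s -> {in s &, injective f} -> (forall x, x \in s -> f x \in t) -> size s <= size t.
Proof.
move=> us fi H; rewrite -(size_map f); apply: uniq_leq_size.
  by rewrite map_inj_in_uniq.
by move=> _ /mapP[x xs ->]; apply: H.
Qed.

(** Double counting: the selected pairs are charged injectively to the entries of [L], typically
    positions or keys of the text. All bounds on skipped items rest on this. *)
Lemma sum_count_le (X Y Z : eqType) (s : seq X) (t : X -> seq Y) (Q : X -> pred Y)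
    (f : X -> Y -> Z) (L : seq Z) :
  uniq s -> (forall x, x \in s -> uniq (t x)) ->
  (forall x x' y y', x \in s -> x' \in s -> y \in t x -> y' \in t x' ->
     Q x y -> Q x' y' -> f x y = f x' y' -> x = x' /\ y = y') ->
  (forall x y, x \in s -> y \in t x -> Q x y -> f x y \in L) ->
  \sum_(x <- s) count (Q x) (t x) <= size L.
Proof.
move=> us ut fi H.
pose A := [seq f x y | x <- s, y <- filter (Q x) (t x)].
have -> : \sum_(x <- s) count (Q x) (t x) = size A.
  by rewrite size_allpairs_dep sumnE big_map; apply: eq_bigr => x _; rewrite size_filter.
apply: uniq_leq_size; last first.
  move=> z /allpairsPdep[x [y [xs]]]; rewrite mem_filter => /andP[q yt] ->; exact: H.
apply: allpairs_uniq_dep => // [x xs|]; first by rewrite filter_uniq ?ut.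
move=> _ _ /allpairsPdep[x [y [xs + ->]]] /allpairsPdep[x' [y' [xs' + ->]]] /=.
rewrite !mem_filter => /andP[q yt] /andP[q' yt'] e.
by have [-> ->] := fi _ _ _ _ xs xs' yt yt' q q' e.
Qed.

Section Enumerations.
Variables (Sigma : eqType) (R : seq (Sigma * nat)) (n B : nat) (code : Sigma -> nat).
Hypothesis cR : canon R.
Hypothesis n_size : size (unrle R) <= n.
Hypothesis n0 : 0 < n.
Hypothesis nB : n < B.
Hypothesis codeB : forall a, code a < B.
Implicit Types (W : seq (Sigma * nat)) (typ : pred (seq (Sigma * nat))).

Notation m := (size R).

Lemma pos_R : all (fun q : Sigma * nat => 0 < q.2) R.
Proof. by case/andP: cR. Qed.

Lemma m_le : m <= n.
Proof. exact: leq_trans (size_rle_le pos_R) n_size. Qed.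

Definition cq (q : quad Sigma) : nquad := let: (a, k, p, r) := q in (code a, k, p, r).

(** The number [k] bounds the schedule only; the list of words may be much longer. *)
Definition enumerates typ (k : nat) : Prop := exists Q : seq (quad Sigma),
  [/\ sch B k (map cq Q), all (quad_ok n m) Q, uniq (map (decode R) Q)
    & forall W, (W \in map (decode R) Q) = [&& typ W, canon W & maw_runs R W]].

Lemma sch_quad q : quad_ok n m q -> emittable q -> sch B 1 [:: cq q].
Proof.
case: q => [[[a k] p] r] /= /and3P[kn pm rm] e.
have mB := leq_ltn_trans m_le nB.
case: (posnP p) e => [->|p0] /= e.
  case/andP: e => /eqP-> /eqP->.
  have := @sch_one B 0 0 0 (code a) (code a); rewrite /emit minnn subnn /=.
  by apply=> //; apply: leq_ltn_trans nB.
have := @sch_one B p r (code a) k k; rewrite /emit minnn subnn /= /emit_at.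
by rewrite gtn_eqF //; apply=> //; [apply: leq_ltn_trans mB|apply: leq_ltn_trans mB|apply: leq_ltn_trans nB].
Qed.

Lemma enum_explicit typ s : uniq s ->
  (forall W, (W \in s) = [&& typ W, canon W & maw_runs R W]) -> enumerates typ (size s).
Proof.
move=> us H.
have [Q [QE Qok Qe]] : exists Q, [/\ map (decode R) Q = s, all (quad_ok n m) Q & all (@emittable _) Q].
  have : all (fun W => canon W && maw_runs R W) s.
    by apply/allP => W; rewrite H => /and3P[_ -> ->].
  elim: s {us H} => [|W s IH] /=; first by exists [::].
  move=> /andP[/andP[cW mW] /IH [Q [e1 e2 e3]]].
  have [q [q1 q2 q3]] := maw_quad cR n_size n0 cW mW.
  by exists (q :: Q); rewrite /= q1 e1 q2 q3.
exists Q; rewrite QE; split=> //.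
rewrite -QE size_map; elim: Q {QE us H s} Qok Qe => [|q Q IH] /=; first by move=> _ _; apply: sch0.
move=> /andP[q1 Q1] /andP[q2 Q2]; rewrite -[cq q :: _]cat1s -add1n.
by apply: sch_cat (sch_quad q1 q2) (IH Q1 Q2).
Qed.

Lemma enum_eq typ typ' k : (forall W, canon W -> maw_runs R W -> typ W = typ' W) ->
  enumerates typ k -> enumerates typ' k.
Proof.
move=> e [Q [h1 h2 h3 h4]]; exists Q; split=> // W; rewrite h4.
by case cW: (canon W); case mW: (maw_runs R W); rewrite ?andbF //= e.
Qed.

Lemma enum_weaken typ k k' : k <= k' -> enumerates typ k -> enumerates typ k'.
Proof.
by move=> le [Q [h1 h2 h3 h4]]; exists Q; split=> //; apply: sch_weaken h1.
Qed.

Lemma enum_union (t1 t2 : pred (seq (Sigma * nat))) k1 k2 : (forall W, t1 W -> t2 W -> False) ->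
  enumerates t1 k1 -> enumerates t2 k2 -> enumerates (predU t1 t2) (k1 + k2).
Proof.
move=> dis [Q1 [a1 a2 a3 a4]] [Q2 [b1 b2 b3 b4]]; exists (Q1 ++ Q2); split.
- by rewrite map_cat; apply: sch_cat.
- by rewrite all_cat a2.
- rewrite map_cat cat_uniq a3 b3 andbT; apply/hasPn => W; rewrite /= a4 b4 => /and3P[t2W _ _].
  by apply/negP => /and3P[t1W _ _]; have := dis _ t1W t2W.
- by move=> W; rewrite map_cat mem_cat a4 b4 /= andb_orl.
Qed.

Lemma enum_pred0 : enumerates pred0 0.
Proof. by exists [::]; split=> //; apply: sch0. Qed.

Lemma enum_family (X : eqType) (s : seq X) (t : X -> pred (seq (Sigma * nat))) (k : X -> nat) :
  uniq s -> (forall x y W, x \in s -> y \in s -> t x W -> t y W -> x = y) ->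
  (forall x, x \in s -> enumerates (t x) (k x)) ->
  enumerates (fun W => has (t^~ W) s) (\sum_(x <- s) k x).
Proof.
elim: s => [_ _ _|x s IH] /=; first by rewrite big_nil; apply: enum_pred0.
move=> /andP[xs us] dis H; rewrite big_cons; apply: enum_union.
- move=> W txW /hasP[y ys tyW]; suff e : x = y by rewrite e ys in xs.
  by apply: dis txW tyW; rewrite inE ?eqxx ?ys ?orbT.
- by apply: H; rewrite mem_head.
- apply: IH => // [y z W ys zs|y ys].
    by apply: dis; rewrite inE ?ys ?zs orbT.
  by apply: H; rewrite inE ys orbT.
Qed.

Section Group.
Variables (X : eqType) (s : seq X) (its : seq (Sigma * nat * nat)).
Variables (p r cap e T : X -> nat) (E : nat -> nat) (P : X -> pred nat).
Variable c0 : Sigma.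
Variables (WF : X -> nat -> nat -> seq (Sigma * nat)) (typ : pred (seq (Sigma * nat))).

Definition cit (it : Sigma * nat * nat) : item := (code it.1.1, it.1.2, it.2).
Definition gits := map cit its.
Notation itb j := (nth (c0, 0, 0) its j).
Notation sel := (selected gits e T E P).

Definition valid x j k := [&& x \in s, j \in sel x,
  (itb j).1.2 <= k & k <= minn (itb j).2 (cap x)].

Hypothesis s_uniq : uniq s.
Hypothesis s_sorted : sorted leq (map e s).
Hypothesis its_le : all (fun it : Sigma * nat * nat => it.2 <= n) its.
Hypothesis s_ok : forall x, x \in s -> [&& 0 < p x, p x <= m, r x <= m & cap x <= n].
Hypothesis s_fits : forall x j, x \in s -> j \in sel x -> (itb j).1.2 <= minn (itb j).2 (cap x).
Hypothesis its_lo : all (fun it : Sigma * nat * nat => it.1.2 <= n) its.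
Hypothesis WFE : forall x j k, valid x j k -> decode R ((itb j).1.1, k, p x, r x) = WF x j k.
Hypothesis WF_inj : forall x j k x' j' k', valid x j k -> valid x' j' k' ->
  WF x j k = WF x' j' k' -> [/\ x = x', j = j' & k = k'].
Hypothesis WF_typ : forall x j k, valid x j k -> [&& typ (WF x j k), canon (WF x j k) & maw_runs R (WF x j k)].
Hypothesis WF_all : forall W, typ W -> canon W -> maw_runs R W -> exists x j k, valid x j k /\ W = WF x j k.

(** Locked, since simplification would unfold [iota] at the successor. *)
Definition krange x j := locked (iota (itb j).1.2 (minn (itb j).2 (cap x) - (itb j).1.2).+1).

Definition triples : seq (X * nat * nat) :=
  flatten [seq flatten [seq [seq (x, j, k) | k <- krange x j]
                       | j <- sel x] | x <- s].

Lemma mem_triples x j k : ((x, j, k) \in triples) = valid x j k.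
Proof.
apply/flatten_mapP/and4P => [[x' xs /flatten_mapP[j' js /mapP[k' ks [-> -> ->]]]]|[xs js k1 k2]].
  move: ks; rewrite /krange -lock mem_iota => /andP[k1 k2]; split=> //.
  (* On an empty range the [.+1] in [krange] would produce a spurious exponent; [s_fits] excludes
     it. *)
  have := s_fits xs js; lia.
exists x => //; apply/flatten_mapP; exists j => //; apply: map_f.
by rewrite /krange -lock mem_iota k1 /=; lia.
Qed.

Lemma sel_uniq x : uniq (sel x).
Proof. by rewrite filter_uniq ?iota_uniq. Qed.

Lemma triples_uniq : uniq triples.
Proof.
have kU x j : uniq (krange x j) by rewrite /krange -lock iota_uniq.
rewrite /triples; elim: s s_uniq => //= x s' IH /andP[xs us].
rewrite cat_uniq IH // andbT; apply/andP; split; last first.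
  apply/hasPn => -[[x' j'] k'] /flatten_mapP[y ys /flatten_mapP[j js]] /= /mapP[k _ [-> _ _]].
  apply/negP => /flatten_mapP[j2 _] /= /mapP[k2 _ [e2 _ _]].
  by rewrite -e2 ys in xs.
elim: (sel x) (sel_uniq x) => //= j js IH2 /andP[jn ju].
rewrite cat_uniq IH2 // andbT map_inj_uniq ?kU /=; last by move=> ? ? [].
apply/hasPn => -[[x' j'] k'] /flatten_mapP[j2 j2s /mapP[k _ [-> -> _]]].
by apply/negP => /= /mapP[k2 _ [e2 _]]; rewrite -e2 j2s in jn.
Qed.

(** The bridge from the sweep to words. Exactly one quadruple is written per valid triple of
    request, item and exponent, so it is enough that [WF] is a bijection from these triples onto the
    class. *)
Lemma enum_group : enumerates typ (2 * size its + \sum_(x <- s) (skipped gits e T E P x).+1).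
Proof.
have mB := leq_ltn_trans m_le nB.
have B0 : 0 < B by apply: leq_ltn_trans nB.
pose qf (t : X * nat * nat) : quad Sigma := ((itb t.1.2).1.1, t.2, p t.1.1, r t.1.1).
have dE : map (decode R) (map qf triples) = [seq WF t.1.1 t.1.2 t.2 | t <- triples].
  rewrite -map_comp; apply/eq_in_map => -[[x j] k]; rewrite mem_triples => v.
  exact: WFE.
have selN x j : j \in sel x -> j < size its.
  by rewrite mem_filter mem_iota size_map => /andP[_ /andP[]].
exists (map qf triples); rewrite dE; split.
- have -> : map cq (map qf triples) = group_out gits p r cap e T E P s.
    rewrite /triples /group_out !map_flatten -!map_comp; congr flatten.
    apply/eq_in_map => x xs /=; rewrite !map_flatten -!map_comp; congr flatten.
    apply/eq_in_map => j js /=; rewrite (nth_map (c0, 0, 0)) ?(selN x) //.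
    rewrite /emit /cit /krange -lock -!map_comp; apply/eq_in_map => k _ /=.
    have /and4P[p0 _ _ _] := s_ok xs.
    by rewrite /emit_at gtn_eqF.
  rewrite -(size_map cit); apply: sch_group => //.
    apply/allP => _ /mapP[it its_in ->]; rewrite /= codeB /=.
    by rewrite !(leq_ltn_trans _ nB) ?(allP its_le) ?(allP its_lo).
  move=> x xs; have /and4P[p0 pm rm cn] := s_ok xs; split.
  + exact: leq_ltn_trans mB.
  + exact: leq_ltn_trans mB.
  + exact: leq_ltn_trans nB.
  + apply/allP => j js; rewrite (nth_map (c0, 0, 0)) ?(selN x) //=.
    exact: s_fits.
- apply/allP => q /mapP[[[x j] k]]; rewrite mem_triples => /and4P[xs js k1 k2] ->.
  have /and4P[p0 pm rm cn] := s_ok xs.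
  by rewrite /= pm rm (leq_trans k2) // geq_min cn orbT.
- rewrite map_inj_in_uniq ?triples_uniq // => -[[x j] k] [[x' j'] k'].
  rewrite !mem_triples /= => v v' e1.
  by case: (WF_inj v v' e1) => ex ej ek; rewrite ex ej ek.
- move=> W; apply/mapP/and3P => [[[[x j] k]]|[tW cW mW]].
    by rewrite mem_triples => v ->; apply/and3P/WF_typ.
  have [x [j [k [v ->]]]] := WF_all tW cW mW.
  by exists (x, j, k); rewrite ?mem_triples.
Qed.

End Group.
End Enumerations.

(** * Words with at most three runs *)

Lemma count_nth (X : Type) (x0 : X) (s : seq X) (Q : pred X) :
  count (fun j => Q (nth x0 s j)) (iota 0 (size s)) = count Q s.
Proof. by rewrite -[in RHS](mkseq_nth x0 s) count_map. Qed.

(** Each maximal interval of admissible values becomes one item with its own operation. *)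
Lemma sch_segments B p r b (P : pred nat) lo len : 0 < B -> p < B -> r < B -> b < B ->
  lo + len <= B ->
  sch B (count (predC P) (iota lo len)).+1 [seq emit_at p r b x | x <- filter P (iota lo len)].
Proof.
move=> B0 pB rB bB le.
have [segs [-> h2 h3]] := segments P (iota lo len).
apply: sch_weaken h2 _.
have -> : [seq emit_at p r b x | x <- flatten segs] =
   flatten [seq [seq emit_at p r b x | x <- s] | s <- segs] by rewrite map_flatten.
rewrite -sum1_size; apply: sch_flatten => s /h3 [s0 [l1 [l3 sE]]].
have := iota_infix sE; move: (congr1 size sE); rewrite size_iota !size_cat.
case: s s0 {sE} => [//|y s] _ sz ->.
have := @sch_one B p r b (lo + size l1) (lo + size l1 + size s) pB rB bB.
rewrite /emit minnn addKn => H; apply: H; first by move: sz; rewrite /=; lia.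
exact: leq_addr.
Qed.

Section MaxK.
Variables (n : nat) (Q : pred nat).
Hypothesis Qn : forall k, Q k -> k <= n.
Hypothesis Q_anti : forall k k', 0 < k -> k <= k' -> Q k' -> Q k.

Definition max_len := \max_(k < n.+1 | Q k) k.

(** The value 0 stays apart because [max_len] is 0 also when no exponent satisfies [Q]. *)
Lemma max_lenP k : 0 < k -> Q k = (k <= max_len).
Proof.
move=> k0; apply/idP/idP => [q|le].
  have kn : k < n.+1 by rewrite ltnS Qn.
  exact: (@leq_bigmax_cond _ (fun i : 'I_n.+1 => Q i) (fun i : 'I_n.+1 => i : nat) (Ordinal kn)).
have : 0 < max_len by apply: leq_trans le.
rewrite /max_len in le *; move: le.
case: (pickP (fun i : 'I_n.+1 => Q i)) => [i0 Qi0|no]; last by rewrite big_pred0 //; lia.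
have [|i Qi ->] := @eq_bigmax_cond _ (fun i : 'I_n.+1 => Q i) (fun i : 'I_n.+1 => i : nat).
  by apply/card_gt0P; exists i0.
by move=> le _; apply: Q_anti le Qi.
Qed.

Lemma max_len_le : max_len <= n.
Proof. by apply/bigmax_leqP => i _; rewrite -ltnS. Qed.

End MaxK.

Section Slices.
Variables (Sigma : Type) (R : seq (Sigma * nat)) (c0 : Sigma).
Notation m := (size R).

Definition run_at i := nth (c0, 0) R i.
Definition slice i j := drop i.+1 (take j R).

Lemma split_run i : i < m -> R = take i R ++ run_at i :: drop i.+1 R.
Proof. by move=> im; rewrite -drop_nth // cat_take_drop. Qed.

Lemma split_runs i j : i < j -> j < m ->
  R = take i R ++ run_at i :: slice i j ++ run_at j :: drop j.+1 R.
Proof.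
move=> ij jm; rewrite [LHS](split_run jm) -[take j R](cat_take_drop i).
rewrite take_takel ?(ltnW ij) // (drop_nth (c0, 0)) ?size_take ?jm //.
by rewrite -catA /= /slice nth_take.
Qed.

Lemma size_mid i j : j <= m -> size (slice i j) = j - i.+1.
Proof. by move=> jm; rewrite size_drop size_takel. Qed.

Lemma nth_mid i j t : i < j -> j <= m -> t < j - i.+1 ->
  nth (c0, 0) (slice i j) t = run_at (i.+1 + t).
Proof. by move=> ij jm tj; rewrite nth_drop nth_take //; lia. Qed.

End Slices.

Arguments run_at : simpl never.

Section ShortWords.
Variables (Sigma : eqType) (R : seq (Sigma * nat)) (n B : nat) (code : Sigma -> nat).
Variable c0 : Sigma.
Implicit Types (W V U : seq (Sigma * nat)) (a b c d : Sigma).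

Notation m := (size R).
Notation enumerates := (enumerates R n B code).
Notation occ := (occurs_runs R).
Notation mw := (maw_runs R).
Notation run := (run_at R c0).
Notation mid := (slice R).

(* The words whose first and last runs have length one. *)
Definition nd W := ~~ doubled W && ~~ doubled (rev W).

Lemma nd_ends W : canon W -> nd W -> 1 < size W ->
  exists a U b, W = (a, 1) :: rcons U (b, 1).
Proof.
case: W => [|[a e] W] //; case/lastP: W => // U [b g] cW /andP[d1 d2] _.
exists a, U, b; move: d2; rewrite -rcons_cons rev_rcons /= in d1 * => d2.
move: cW; rewrite /canon /= all_rcons /= => /andP[/andP[e0 /andP[g0 _]] _].
by rewrite /= in e0 g0 *; congr ((_, _) :: rcons _ (_, _)); lia.
Qed.

Lemma nd_rcons a U b : nd ((a, 1) :: rcons U (b, 1)).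
Proof. by rewrite /nd -rcons_cons rev_rcons. Qed.

Lemma canon2 a b e f : canon [:: (a, e); (b, f)] = [&& 0 < e, 0 < f & a != b].
Proof. by rewrite canon_cons /= /neqb !andbT; case: (0 < e) => //=; rewrite andbC. Qed.

Lemma canon3 a b c e f g : canon [:: (a, e); (c, f); (b, g)] =
  [&& 0 < e, 0 < f, 0 < g, a != c & c != b].
Proof.
rewrite canon_cons /= /neqb !andbT.
by case: (0 < e); case: (0 < f); case: (0 < g); case: (a != c); case: (c != b).
Qed.

Hypothesis cR : canon R.

Definition letters := undup (map fst R).

Lemma letters_size : size letters <= m.
Proof. by rewrite -(size_map fst R) size_undup. Qed.

Lemma mem_letters a : (a \in letters) = (a \in unrle R).
Proof. by rewrite mem_undup mem_unrle // pos_R. Qed.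

Lemma occ_index a e V d f : canon ((a, e) :: rcons V (d, f)) ->
  reflect (exists i j, [/\ i < j, j < m, (run i).1 = a /\ e <= (run i).2, mid i j = V
                         & (run j).1 = d /\ f <= (run j).2])
    (occ ((a, e) :: rcons V (d, f))).
Proof.
move=> cW; apply: (iffP idP).
  move=> /(infix_runs cR cW) [R1 [R2 [l [l' [E le1 le2]]]]].
  exists (size R1), (size R1 + size V).+1.
  have E2 : R = (R1 ++ (a, l) :: V) ++ (d, l') :: R2 by rewrite E -catA.
  have s2 : size (R1 ++ (a, l) :: V) = (size R1 + size V).+1 by rewrite size_cat addnS.
  have r1 : run (size R1) = (a, l) by rewrite /run_at E nth_cat ltnn subnn.
  have r2 : run (size R1 + size V).+1 = (d, l').
    by rewrite /run_at E2 nth_cat s2 ltnn subnn.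
  rewrite r1 r2; split=> //.
  - by lia.
  - by rewrite E2 size_cat s2 /=; lia.
  - rewrite /slice -s2 E2 take_size_cat // -cat_rcons drop_size_cat // size_rcons //.
move=> [i [j [ij jm [e1 le1] mE [e2 le2]]]].
apply/(infix_runs cR cW); exists (take i R), (drop j.+1 R), (run i).2, (run j).2; split=> //.
by rewrite -e1 -e2 -!surjective_pairing -mE; apply: split_runs.
Qed.

Lemma run_pos i : i < m -> 0 < (run i).2.
Proof. by move=> im; apply: (allP (pos_R cR)); apply: mem_nth. Qed.

Lemma run_neq i : i.+1 < m -> (run i).1 != (run i.+1).1.
Proof.
move=> im; have := cR; rewrite {1}(split_runs c0 (ltnSn i) im) canon_cat_cons => /andP[_].
have -> : mid i i.+1 = [::] by apply: size0nil; rewrite size_mid ?subnn // ltnW.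
by rewrite canon_cons /= => /and3P[_ /andP[]].
Qed.

Lemma occ1 a : occ [:: (a, 1)] = (a \in letters).
Proof. by rewrite mem_letters /occurs_runs /= infix1s. Qed.

Lemma mw1 a : mw [:: (a, 1)] = (a \notin letters).
Proof.
rewrite mem_letters /maw_runs /mawb /= infix1s; case: (a \in unrle R) => //=.
by rewrite infix0s.
Qed.

Hypothesis n_size : size (unrle R) <= n.
Hypothesis n0 : 0 < n.
Hypothesis nB : n < B.
Hypothesis codeB : forall a, code a < B.
Hypothesis code_inj : injective code.

Lemma run_len i : i < m -> (run i).2 <= n.
Proof. by move=> im; apply: (len_le n_size); apply: mem_nth. Qed.

(** The absent letters may far outnumber the runs, so they are stored as intervals of codes. At most
    [m] letters are present, and each of them splits an interval at most once. *)
Lemma enum_absent sg : (forall a, code a < sg) -> sg <= B ->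
  (forall x, x < sg -> exists a, code a = x) ->
  enumerates (fun W => nd W && (size W == 1)) m.+1.
Proof.
move=> clt sB surj.
pose P x := x \notin map code letters.
have [s sE] : exists s, map code s = filter P (iota 0 sg).
  have : all (gtn sg) (filter P (iota 0 sg)).
    by apply/allP => x; rewrite mem_filter mem_iota => /andP[_].
  elim: (filter P _) => [|x l IH] /=; first by exists [::].
  by move=> /andP[/surj[a <-] /IH [s <-]]; exists (a :: s).
have B0 : 0 < B by apply: leq_ltn_trans nB.
exists [seq (a, 1, 0, 0) | a <- s]; split.
- have -> : map (cq code) [seq (a, 1, 0, 0) | a <- s] = [seq emit_at 0 0 0 x | x <- filter P (iota 0 sg)].
    by rewrite -sE -!map_comp.
  apply: (sch_weaken _ (@sch_segments B 0 0 0 P 0 sg B0 B0 B0 B0 sB)); rewrite ltnS.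
  have -> : count (predC P) (iota 0 sg) = size [seq x <- iota 0 sg | x \in map code letters].
    by rewrite size_filter; apply: eq_count => x; rewrite /P /= negbK.
  apply: leq_trans letters_size; rewrite -(size_map code).
  apply: uniq_leq_size; first by rewrite filter_uniq ?iota_uniq.
  by move=> x; rewrite mem_filter => /andP[].
- by apply/allP => q /mapP[a _ ->] /=; rewrite n0.
- have us : uniq s by apply: (@map_uniq _ _ code); rewrite sE filter_uniq ?iota_uniq.
  by rewrite -map_comp map_inj_uniq // => a b /= [].
- move=> W; rewrite -map_comp; apply/mapP/and3P => [[a + ->]|[/andP[nW sW] cW mW]].
    move=> /(map_f code); rewrite sE mem_filter /P => /andP[ax _].
    split=> //; change (is_true (mw [:: (a, 1)])); rewrite mw1.
    by apply: contra ax => /(map_f code).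
  case: W nW sW cW mW => [|[a e] [|]] // nW _ cW mW.
  have e1 : e = 1.
    by move: nW cW; rewrite /nd /= canon_cons /= => /andP[]; lia.
  rewrite e1 mw1 in mW *; exists a => //.
  have : code a \in map code s.
    rewrite sE mem_filter mem_iota /= add0n clt andbT /P; apply: contra mW => /mapP[b bl /code_inj->].
    by [].
  by rewrite mem_map.
Qed.

(** The entry of the last run pairs it with the default letter [c0]; it is harmless and makes the
    size exactly [m]. *)
Definition pairs := [seq ((run i).1, (run i.+1).1) | i <- iota 0 m].

Lemma mem_pairs a b : a != b -> occ [:: (a, 1); (b, 1)] -> (a, b) \in pairs.
Proof.
move=> ab oc; have cW : canon ((a, 1) :: rcons [::] (b, 1)) by rewrite canon2.
have [i [j [ij jm [e1 _] mE [e2 _]]]] := occ_index cW oc.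
apply/mapP; exists i; first by rewrite mem_iota; lia.
have jE : j = i.+1 by move/(congr1 size): mE; rewrite size_mid ?(ltnW jm) //=; lia.
by rewrite -jE e1 e2.
Qed.

Lemma index_letter a : a \in letters -> exists l,
  R = take (index a (map fst R)) R ++ (a, l) :: drop (index a (map fst R)).+1 R
  /\ size (take (index a (map fst R)) R) = index a (map fst R).
Proof.
rewrite mem_undup => al.
have im : index a (map fst R) < m by rewrite -(size_map fst R) index_mem.
exists (run (index a (map fst R))).2; split; last by rewrite size_takel // ltnW.
rewrite {1}[R](split_run c0 im); congr (_ ++ _ :: _).
rewrite [LHS]surjective_pairing; congr (_, _).
by rewrite /run_at -(nth_map _ c0) // nth_index.
Qed.

Lemma sum_pairs (s t : seq Sigma) : uniq s -> uniq t ->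
  \sum_(a <- s) count (fun b => (a != b) && occ [:: (a, 1); (b, 1)]) t <= m.
Proof.
move=> us ut; rewrite -[m](size_iota 0) -(size_map (fun i => ((run i).1, (run i.+1).1))).
apply: (@sum_count_le _ _ _ _ _ _ pair) => // [a a' b b' _ _ _ _ _ _ []//|a b _ _ /andP[]].
exact: mem_pairs.
Qed.

(** Every left letter requests all right letters, with constant thresholds, so nothing is ever
    deleted. The cost is [2m] for the items, at most two per request, and [m] for the adjacent pairs
    of the text. *)
Lemma enum_two : enumerates (fun W => nd W && (size W == 2)) (5 * m).
Proof.
pose its := [seq (b, 1, 1) | b <- letters] : seq (Sigma * nat * nat).
pose p a := (index a (map fst R)).+1.
pose P a j := (a != nth c0 letters j) && ~~ occ [:: (a, 1); (nth c0 letters j, 1)].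
pose W2 a (j k : nat) := [:: (a, 1); (nth c0 letters j, 1)].
have itE j : j < size letters -> nth (c0, 0, 0) its j = (nth c0 letters j, 1, 1).
  by move=> jl; rewrite (nth_map c0).
have selE a j : j \in selected (gits code its) (fun=> 0) (fun=> size letters) (fun=> 0) P a =
    (j < size letters) && P a j.
  by rewrite mem_filter mem_iota !size_map /= andbC; case: (j < _).
have vE a j k : valid code letters its (fun=> 1) (fun=> 0) (fun=> size letters) (fun=> 0) P c0 a j k
   -> [/\ a \in letters, j < size letters, P a j & k = 1].
  rewrite /valid selE => /and4P[al /andP[jl pj]]; rewrite itE //= => k1 k2; split=> //.
  by apply/eqP; rewrite eqn_leq k1 k2.
apply: (enum_weaken _ (@enum_group _ R n B code cR n_size n0 nB codeB _ letters its p p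
  (fun=> 1) (fun=> 0) (fun=> size letters) (fun=> 0) P c0 W2 _ _ _ _ _ _ _ _ _ _ _)).
- have sE : size its = size letters by rewrite size_map.
  have : \sum_(x <- letters) (skipped (gits code its) (fun=> 0) (fun=> size letters) (fun=> 0) P x).+1
      <= \sum_(x <- letters) (2 + count (fun b => (x != b) && occ [:: (x, 1); (b, 1)]) letters).
    rewrite big_seq [X in _ <= X]big_seq; apply: leq_sum => a al.
    rewrite /skipped !size_map addSn ltnS.
    (* Skipped are the letter [a] itself, at most once, and the other letters that follow [a]
       somewhere in the text. *)
    apply: (@leq_trans (count (pred1 a) letters + count (fun b => (a != b) && occ [:: (a, 1); (b, 1)]) letters)).
      rewrite -(count_nth c0) -[X in _ <= _ + X](count_nth c0) -count_predUI.
      apply: leq_trans (leq_addr _ _); apply: sub_count => j /=.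
      by rewrite /P negb_and !negbK => /andP[_ /orP[/eqP->|->]]; rewrite ?eqxx //= eq_sym; case: eqP.
    by rewrite leq_add2r count_uniq_mem ?undup_uniq //; case: (a \in _).
  have := sum_pairs (undup_uniq (map fst R)) (undup_uniq (map fst R)).
  have := letters_size; rewrite -/letters big_split /= big_const_seq count_predT iter_addn addn0 sE.
  lia.
- exact: undup_uniq.
- by elim: (letters) => //= a [|b s].
- by apply/allP => it /mapP[b _ ->].
- move=> a; rewrite mem_undup => al; rewrite /p /=.
  by rewrite n0 andbT andbb -(size_map fst R) index_mem.
- by move=> a j al; rewrite selE => /andP[jl _]; rewrite itE.
- by apply/allP => it /mapP[b _ ->].
- move=> a j k /vE[al jl pj ->]; rewrite itE //.
  have [l [E1 E2]] := index_letter al.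
  have [h _] := decode_pair cR n_size n0 (nth c0 letters j) E1 n0.
  by rewrite E2 in h; rewrite [LHS]h merge_canon // canon2; case/andP: pj.
- move=> a j k a' j' k' /vE[al jl pj ->] /vE[al' jl' pj' ->] [-> e]; split=> //.
  by apply/eqP; rewrite -(nth_uniq c0 jl jl') ?undup_uniq // e.
- move=> a j k /vE[al jl /andP[ab no] _]; rewrite canon2 ab.
  have /= -> := mw_ends R a [::] (nth c0 letters j).
  by rewrite no !occ1 al mem_nth // (nd_rcons a [::]).
- move=> W /andP[nW sW] cW mW.
  have [|a [U [b WE]]] := nd_ends cW nW; first by rewrite (eqP sW).
  case: U WE => [|q U] WE; last by move: sW; rewrite WE /= size_rcons.
  rewrite WE /= in cW mW *.
  have := mW; rewrite (mw_ends R a [::] b) /= !occ1 => /and3P[no bl al].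
  exists a, (index b letters), 1.
  have jl : index b letters < size letters by rewrite index_mem.
  rewrite /W2 nth_index //; split=> //.
  rewrite /valid al selE jl /P nth_index // no itE //= andbT.
  by move: cW; rewrite canon2 => /and3P[_ _ ->].
Qed.

Lemma occ_head_len c k k' U : k <= k' -> occ ((c, k') :: U) -> occ ((c, k) :: U).
Proof.
move=> le; apply: occ_infix; apply/infixP; exists (nseq (k' - k) c), [::].
by rewrite !unrle_cons /= -{1}(subnK le) nseqD cats0 -catA.
Qed.

Lemma occ_last_len c k k' U : k <= k' -> occ (rcons U (c, k')) -> occ (rcons U (c, k)).
Proof.
move=> le; apply: occ_infix; apply/infixP; exists [::], (nseq (k' - k) c).
by rewrite !unrle_rcons /= -{1}(subnKC le) nseqD -catA.
Qed.

Definition left_len a c := max_len n (fun k => occ [:: (a, 1); (c, k)]).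
Definition right_len c b := max_len n (fun k => occ [:: (c, k); (b, 1)]).

Lemma left_lenP a c k : a != c -> 0 < k -> occ [:: (a, 1); (c, k)] = (k <= left_len a c).
Proof.
move=> ac k0; apply: (max_lenP (Q := fun k => occ [:: (a, 1); (c, k)])) => // [k1 oc|k1 k2 _ le].
  case: (posnP k1) => [->//|k10].
  have cW : canon ((a, 1) :: rcons [::] (c, k1)) by rewrite canon2 k10.
  have [i [j [ij jm _ _ [_ le]]]] := occ_index cW oc.
  exact: leq_trans le (run_len jm).
exact: (@occ_last_len c k1 k2 [:: (a, 1)] le).
Qed.

Lemma right_lenP c b k : c != b -> 0 < k -> occ [:: (c, k); (b, 1)] = (k <= right_len c b).
Proof.
move=> ac k0; apply: (max_lenP (Q := fun k => occ [:: (c, k); (b, 1)])) => // [k1 oc|k1 k2 _ le].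
  case: (posnP k1) => [->//|k10].
  have cW : canon ((c, k1) :: rcons [::] (b, 1)) by rewrite canon2 k10.
  have [i [j [ij jm [_ le] _ _]]] := occ_index cW oc.
  exact: leq_trans le (run_len (ltn_trans ij jm)).
exact: occ_head_len le.
Qed.

Lemma mw3 a c b k : a != c -> c != b -> 0 < k -> mw [:: (a, 1); (c, k); (b, 1)] =
  [&& ~~ occ [:: (a, 1); (c, k); (b, 1)], k <= right_len c b & k <= left_len a c].
Proof.
by move=> ac cb k0; rewrite (mw_ends R a [:: (c, k)] b) /= right_lenP // left_lenP.
Qed.

(* If [a c^k b] occurs for some [k], then the exponents of [c] are not an interval
   and the pair [(a, c), (c, b)] is treated apart; there are at most [m] of these. *)
Definition exact3 a c b := has (fun k => occ [:: (a, 1); (c, k); (b, 1)]) (iota 1 n).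

Lemma occ3_index a c b k : a != c -> c != b -> 0 < k -> occ [:: (a, 1); (c, k); (b, 1)] ->
  exists i, [/\ i.+2 < m, (run i).1 = a, run i.+1 = (c, k) & (run i.+2).1 = b].
Proof.
move=> ac cb k0 oc; have cW : canon ((a, 1) :: rcons [:: (c, k)] (b, 1)) by rewrite canon3 k0 ac cb.
have [i [j [ij jm [e1 _] mE [e2 _]]]] := occ_index cW oc.
have jE : j = i.+2 by move/(congr1 size): mE; rewrite size_mid ?(ltnW jm) //=; lia.
rewrite {}jE in ij jm mE e2; exists i; split=> //.
have := @nth_mid _ R c0 i i.+2 0 ij (ltnW jm); rewrite mE /= addn0 => -> //; lia.
Qed.

(** A quadruple carries only one letter explicitly; the letters [a] and [c] of [a c^k b] are read at
    this place of the text. *)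
Definition pair_pos a c := find (fun i => ((run i).1 == a) && ((run i.+1).1 == c)) (iota 0 m.-1).

Lemma pair_posP a c : a != c -> occ [:: (a, 1); (c, 1)] ->
  [/\ (pair_pos a c).+1 < m, (run (pair_pos a c)).1 = a & (run (pair_pos a c).+1).1 = c].
Proof.
move=> ac oc; have cW : canon ((a, 1) :: rcons [::] (c, 1)) by rewrite canon2.
have h : has (fun i => ((run i).1 == a) && ((run i.+1).1 == c)) (iota 0 m.-1).
  have [i [j [ij jm [e1 _] mE [e2 _]]]] := occ_index cW oc.
  have jE : j = i.+1 by move/(congr1 size): mE; rewrite size_mid ?(ltnW jm) //=; lia.
  apply/hasP; exists i; first by rewrite mem_iota; lia.
  by rewrite -jE e1 e2 !eqxx.
have := nth_find 0 h; have := h; rewrite has_find size_iota => lt.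
rewrite nth_iota // add0n => /andP[/eqP e1 /eqP e2]; split=> //.
by rewrite /pair_pos; lia.
Qed.

Lemma decode3 a c b k : a != c -> c != b -> 0 < k -> k <= n -> occ [:: (a, 1); (c, 1)] ->
  let q := (b, k, (pair_pos a c).+1, (pair_pos a c).+2) in
  decode R q = [:: (a, 1); (c, k); (b, 1)] /\ quad_ok n m q.
Proof.
move=> ac cb k0 kn oc q; have [im e1 e2] := pair_posP ac oc.
have E := split_runs c0 (ltnSn (pair_pos a c)) im.
have mE : mid (pair_pos a c) (pair_pos a c).+1 = [::].
  by apply: size0nil; rewrite size_mid ?subnn //; lia.
rewrite mE (surjective_pairing (run _)) e1 (surjective_pairing (run _.+1)) e2 in E.
have [] := decode_right cR n_size n0 b E kn.
rewrite addn0 size_takel; last by lia.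
move=> h1 h2; split=> //; rewrite /q [LHS]h1 merge_canon //.
by rewrite canon3 k0 ac.
Qed.

Definition succs c := [seq b <- letters | (c != b) && occ [:: (c, 1); (b, 1)]].
Definition preds c := [seq a <- letters | (a != c) && occ [:: (a, 1); (c, 1)]].

Definition typ3a c W := [&& nd W, size W == 3, (nth (c0, 0) W 1).1 == c
   & ~~ exact3 (nth (c0, 0) W 0).1 c (nth (c0, 0) W 2).1].

Lemma nd_three W : canon W -> nd W -> size W = 3 -> exists a c b k,
  [/\ W = [:: (a, 1); (c, k); (b, 1)], a != c, c != b & 0 < k].
Proof.
move=> cW nW sW; have [|a [U [b WE]]] := nd_ends cW nW; first by rewrite sW.
move: sW; rewrite WE /= size_rcons.
case: U WE => [|[c k] [|? ?]] WE //= _; exists a, c, b, k.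
by move: cW; rewrite WE canon3 => /and5P[_ k0 _ ac cb].
Qed.

Lemma mem_letters_ends a U b : occ ((a, 1) :: U) -> occ (rcons U (b, 1)) ->
  a \in letters /\ b \in letters.
Proof.
move=> h1 h2; rewrite -!occ1; split.
  by apply: occ_infix h1; apply/infixP; exists [::], (unrle U); rewrite !unrle_cons.
apply: occ_infix h2; apply/infixP; exists (unrle U), [::].
by rewrite unrle_rcons !cats0.
Qed.

(** Away from the exact triples [a c^k b] never occurs, so the exponents of its MAWs are all of
    [1 .. minn (left_len a c) (right_len c b)]: the item of [b] carries one bound and the request of
    [a] the other as its cap. *)
Lemma enum_three_a c : enumerates (typ3a c)
  (2 * size (succs c) + \sum_(a <- preds c) (count (exact3 a c) (succs c)).+1).
Proof.
pose its := [seq (b, 1, right_len c b) | b <- succs c] : seq (Sigma * nat * nat).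
pose P a j := ~~ exact3 a c (nth c0 (succs c) j).
pose WF a (j k : nat) := [:: (a, 1); (c, k); (nth c0 (succs c) j, 1)].
pose N := size (succs c).
have itE j : j < N -> nth (c0, 0, 0) its j = (nth c0 (succs c) j, 1, right_len c (nth c0 (succs c) j)).
  by move=> jl; rewrite (nth_map c0).
have scP j : j < N -> let b := nth c0 (succs c) j in
    [/\ c != b, 0 < right_len c b & b \in letters].
  move=> jl; have := mem_nth c0 jl; rewrite mem_filter => /andP[/andP[cb oc] bl] b.
  by rewrite -right_lenP.
have prP a : a \in preds c -> [/\ a != c, 0 < left_len a c & occ [:: (a, 1); (c, 1)]].
  by rewrite mem_filter => /andP[/andP[cb oc] bl]; rewrite -left_lenP.
have selE a j : j \in selected (gits code its) (fun=> 0) (fun=> N) (fun=> 0) P a =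
    (j < N) && P a j.
  by rewrite mem_filter mem_iota !size_map /= andbC -/N; case: (j < _).
have vE a j k : valid code (preds c) its (left_len^~ c) (fun=> 0) (fun=> N) (fun=> 0) P c0 a j k
   = [&& a \in preds c, j < N, P a j, 0 < k, k <= right_len c (nth c0 (succs c) j) & k <= left_len a c].
  rewrite /valid selE; case: (boolP (j < N)) => jl /=; rewrite ?andbF //= itE //=.
  by rewrite leq_min.
have := @enum_group _ R n B code cR n_size n0 nB codeB _ (preds c) its
  (fun a => (pair_pos a c).+1) (fun a => (pair_pos a c).+2)
  (left_len^~ c) (fun=> 0) (fun=> N) (fun=> 0) P c0 WF (typ3a c).
have -> : 2 * size its + \sum_(x <- preds c) (skipped (gits code its) (fun=> 0) (fun=> N) (fun=> 0) P x).+1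
   = 2 * N + \sum_(a <- preds c) (count (exact3 a c) (succs c)).+1.
  rewrite size_map; congr (_ + _); apply: eq_bigr => a _; congr _.+1.
  rewrite -(count_nth c0) /skipped !size_map; apply: eq_in_count => j.
  by rewrite mem_iota /= add0n /P negbK => ->.
apply.
- by rewrite filter_uniq ?undup_uniq.
- by elim: (preds c) => //= a [|b s].
- by apply/allP => it /mapP[b _ ->]; apply: max_len_le.
- move=> a /prP[ac _ oc]; have [im _ _] := pair_posP ac oc.
  by rewrite /= max_len_le (ltnW im) im.
- move=> a j /prP[_ a0 _]; rewrite selE => /andP[jl _]; rewrite itE //= leq_min a0.
  by case: (scP _ jl) => _ ->.
- by apply/allP => it /mapP[b _ ->].
- move=> a j k; rewrite vE => /and5P[ap jl pj k0 /andP[k1 k2]]; rewrite itE //.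
  have [ac a0 oc] := prP _ ap; have [cb _ _] := scP _ jl.
  by have [|->] := decode3 ac cb k0 _ oc; first exact: leq_trans k1 (max_len_le _ _).
- move=> a j k a' j' k'; rewrite !vE => /and5P[ap jl pj k0 _] /and5P[ap' jl' pj' k0' _] [-> -> e]; split=> //.
  by apply/eqP; rewrite -(nth_uniq c0 jl jl') ?filter_uniq ?undup_uniq // e.
- move=> a j k; rewrite vE => /and5P[ap jl pj k0 /andP[k1 k2]].
  have [ac a0 oc] := prP _ ap; have [cb _ _] := scP _ jl.
  rewrite /typ3a (nd_rcons a [:: (c, k)]) /= eqxx canon3 ac cb k0 mw3 // k1 k2 !andbT.
  rewrite [X in X && _]pj /=; apply: contra pj => oc3; apply/hasP; exists k => //.
  by rewrite mem_iota k0 /= add1n ltnS (leq_trans k1) // max_len_le.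
- move=> W /and4P[nW /eqP sW cE ne] cW mW.
  have [a [c' [b [k [WE ac cb k0]]]]] := nd_three cW nW sW.
  rewrite WE /= in cE ne mW; move/eqP: cE => cE; rewrite cE in mW WE ac cb.
  have := mW; rewrite mw3 // => /and3P[no k1 k2].
  have := mW; rewrite (mw_ends R a [:: (c, k)] b) /= => /and3P[_ h1 h2].
  have [al bl] := mem_letters_ends h2 h1.
  have bs : b \in succs c by rewrite mem_filter cb bl right_lenP // (leq_trans k0).
  have jl : index b (succs c) < N by rewrite index_mem.
  exists a, (index b (succs c)), k; rewrite vE /P /WF nth_index //; split=> //.
  by rewrite mem_filter ac al left_lenP // (leq_trans k0) //= jl ne k0 k1.
Qed.

Definition typ3b (t : Sigma * Sigma * Sigma) W := let: (a, c, b) := t in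
  [&& nd W, size W == 3, (nth (c0, 0) W 0).1 == a, (nth (c0, 0) W 1).1 == c
   & (nth (c0, 0) W 2).1 == b].

(** The same interval of exponents, now with the occurring ones removed, which costs one segment per
    occurring exponent. *)
Lemma enum_three_b a c b : a != c -> c != b -> occ [:: (a, 1); (c, 1)] ->
  enumerates (typ3b (a, c, b)) (count (fun k => occ [:: (a, 1); (c, k); (b, 1)]) (iota 1 n)).+1.
Proof.
move=> ac cb oc; pose M := minn (left_len a c) (right_len c b).
pose P k := ~~ occ [:: (a, 1); (c, k); (b, 1)].
have Mn : M <= n by rewrite geq_min max_len_le.
have kP k : k \in filter P (iota 1 M) -> [/\ P k, 0 < k, k <= left_len a c, k <= right_len c b & k <= n].
  rewrite mem_filter mem_iota add1n ltnS => /and3P[pk k0 kM]; split=> //.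
  - by apply: leq_trans kM _; rewrite geq_minl.
  - by apply: leq_trans kM _; rewrite geq_minr.
  - exact: leq_trans Mn.
have [im _ _] := pair_posP ac oc.
have mB := leq_ltn_trans (m_le cR n_size) nB.
pose Q := [seq (b, k, (pair_pos a c).+1, (pair_pos a c).+2) | k <- filter P (iota 1 M)].
have dE : map (decode R) Q = [seq [:: (a, 1); (c, k); (b, 1)] | k <- filter P (iota 1 M)].
  rewrite -map_comp; apply/eq_in_map => k /kP[pk k0 k1 k2 kn].
  by have [] := decode3 ac cb k0 kn oc.
exists Q; rewrite dE; split.
- have -> : map (cq code) Q = [seq emit_at (pair_pos a c).+1 (pair_pos a c).+2 (code b) x
      | x <- filter P (iota 1 M)] by rewrite /Q -map_comp.
  have := @sch_segments B (pair_pos a c).+1 (pair_pos a c).+2 (code b) P 1 M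
     (leq_ltn_trans (leq0n _) nB) (leq_ltn_trans (ltnW im) mB) (leq_ltn_trans im mB) (codeB b)
     (leq_ltn_trans Mn nB).
  apply: sch_weaken; rewrite ltnS.
  rewrite -(subnKC Mn) iotaD count_cat; apply: leq_trans (leq_addr _ _).
  by apply: sub_count => k /=; rewrite /P negbK.
- apply/allP => q /mapP[k /kP[pk k0 k1 k2 kn] ->].
  by have [] := decode3 ac cb k0 kn oc.
- by rewrite map_inj_uniq ?filter_uniq ?iota_uniq // => k k' [].
- move=> W; apply/mapP/and3P => [[k /kP[pk k0 k1 k2 kn] ->]|[/and5P[nW /eqP sW e1 e2 e3] cW mW]].
    rewrite /typ3b (nd_rcons a [:: (c, k)]) /= !eqxx canon3 ac cb k0 mw3 // k1 k2 andbT.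
    by split=> //; rewrite andbT.
  have [a' [c' [b' [k [WE ac' cb' k0]]]]] := nd_three cW nW sW.
  rewrite WE /= in e1 e2 e3 mW; move/eqP: e1 => e1; move/eqP: e2 => e2; move/eqP: e3 => e3.
  rewrite e1 e2 e3 in mW WE; exists k => //.
  move: mW; rewrite mw3 // => /and3P[no k1 k2].
  by rewrite mem_filter mem_iota /P no k0 add1n ltnS leq_min k1 k2.
Qed.

Definition triples3 := [seq ((run i).1, (run i.+1).1, (run i.+2).1) | i <- iota 0 m].
Definition exact_triples := [seq t <- undup triples3 |
  let: (a, c, b) := t in [&& a != c, c != b & exact3 a c b]].

Lemma mem_exact a c b : a != c -> c != b -> ((a, c, b) \in exact_triples) = exact3 a c b.
Proof.
move=> ac cb; rewrite mem_filter ac cb mem_undup /=; case: (boolP (exact3 a c b)) => //=.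
move=> /hasP[k]; rewrite mem_iota => /andP[k0 _] oc.
have [i [im e1 e2 e3]] := occ3_index ac cb k0 oc.
apply/mapP; exists i; first by rewrite mem_iota; lia.
by rewrite e1 e2 e3.
Qed.

Lemma exact_occ a c b : a != c -> c != b -> exact3 a c b -> occ [:: (a, 1); (c, 1)].
Proof.
move=> ac cb /hasP[k]; rewrite mem_iota => /andP[k0 _] oc.
apply: (@occ_last_len c 1 k [:: (a, 1)]) => //.
apply: occ_infix oc; apply/infixP; exists [::], [:: b].
by rewrite -[[:: (a, 1); (c, k); (b, 1)]]/(rcons [:: (a, 1); (c, k)] (b, 1)) unrle_rcons.
Qed.

(** Adjacent pairs, exact triples and triples with their exponent are all read off from consecutive
    runs, so each family has at most [m] members. The total is at most [6m]. *)
Lemma enum_three : enumerates (fun W => nd W && (size W == 3)) (7 * m).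
Proof.
pose t1 W := has (fun c => typ3a c W) letters.
pose t2 W := has (fun t => typ3b t W) exact_triples.
have E1 : enumerates t1 (\sum_(c <- letters) (2 * size (succs c) +
    \sum_(a <- preds c) (count (exact3 a c) (succs c)).+1)).
  apply: enum_family; first exact: undup_uniq.
    by move=> c c' W _ _ /and4P[_ _ /eqP<- _] /and4P[_ _ /eqP<- _].
  by move=> c _; apply: enum_three_a.
have E2 : enumerates t2 (\sum_(t <- exact_triples) (count (fun k => occ [:: (t.1.1, 1); (t.1.2, k); (t.2, 1)]) (iota 1 n)).+1).
  apply: enum_family; first by rewrite filter_uniq ?undup_uniq.
    move=> [[a c] b] [[a' c'] b'] W _ _ /and5P[_ _ /eqP<- /eqP<- /eqP<-].
    by move=> /and5P[_ _ /eqP<- /eqP<- /eqP<-].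
  move=> [[a c] b]; rewrite mem_filter => /andP[/and3P[ac cb ex] _].
  by apply: enum_three_b => //; apply: exact_occ ex.
have dis W : t1 W -> t2 W -> False.
  move=> /hasP[c _ /and4P[_ _ /eqP e1 ne]] /hasP[[[a c'] b]].
  rewrite mem_filter => /andP[/and3P[ac cb ex] _] /and5P[_ _ /eqP ea /eqP ec /eqP eb].
  by rewrite -e1 ea ec eb ex in ne.
apply: (enum_eq _ (enum_weaken _ (enum_union dis E1 E2))).
  move=> W cW mW; rewrite /= /t1 /t2.
  apply/orP/andP => [[/hasP[c _ /and4P[-> -> _ _]]//|/hasP[[[a c] b] _ /and5P[-> -> _ _ _]]//]|[nW /eqP sW]].
  have [a [c [b [k [WE ac cb k0]]]]] := nd_three cW nW sW.
  have cl : c \in letters.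
    rewrite -occ1; rewrite WE in mW.
    move: mW; rewrite (mw_ends R a [:: (c, k)] b) /= => /and3P[_ h _].
    have := occ_head_len k0 h; apply: occ_infix.
    by apply/infixP; exists [::], [:: b].
  case ex : (exact3 a c b).
    right; apply/hasP; exists (a, c, b); first by rewrite mem_exact.
    by rewrite /typ3b nW WE /= !eqxx.
  left; apply/hasP; exists c => //.
  by rewrite /typ3a nW WE /= eqxx ex.
have ul := undup_uniq (map fst R).
have s1 : \sum_(c <- letters) size (succs c) <= m.
  by under eq_bigr do rewrite size_filter; apply: sum_pairs.
have s2 : \sum_(c <- letters) size (preds c) <= m.
  under eq_bigr do rewrite size_filter.
  rewrite -[m](size_iota 0) -(size_map (fun i => ((run i).1, (run i.+1).1))).
  apply: (@sum_count_le _ _ _ _ _ _ (fun c a => (a, c))) => // [a a' b b' _ _ _ _ _ _ [-> ->]//|a b _ _ /andP[]].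
  exact: mem_pairs.
have s3 : \sum_(c <- letters) \sum_(a <- preds c) count (exact3 a c) (succs c) <= m.
  have -> : \sum_(c <- letters) \sum_(a <- preds c) count (exact3 a c) (succs c) =
      \sum_(t <- [seq (c, a) | c <- letters, a <- preds c]) count (exact3 t.2 t.1) (succs t.1).
    by rewrite big_allpairs_dep.
  rewrite -[m](size_iota 0) -(size_map (fun i => ((run i).1, (run i.+1).1, (run i.+2).1))).
  apply: (@sum_count_le _ _ _ _ _ _ (fun t b => (t.2, t.1, b))).
  - apply: allpairs_uniq_dep => // [c _|]; first by rewrite filter_uniq.
    by move=> [c a] [c' a'] _ _ /= [-> ->].
  - by move=> t _; rewrite filter_uniq.
  - by move=> [c a] [c' a'] b b' _ _ _ _ _ _ /= [-> -> ->].
  - move=> t b /allpairsPdep[c [a [cl + ->]]]; rewrite !mem_filter /= => /andP[/andP[ac _] _].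
    move=> /andP[/andP[cb _] _] ex.
    by have := mem_exact ac cb; rewrite ex mem_filter mem_undup => /andP[].
have s4 : size exact_triples <= m.
  by rewrite size_filter (leq_trans (count_size _ _)) // (leq_trans (size_undup _)) // size_map size_iota.
have s5 : \sum_(t <- exact_triples) count (fun k => occ [:: (t.1.1, 1); (t.1.2, k); (t.2, 1)]) (iota 1 n) <= m.
  rewrite -[m](size_iota 0) -(size_map (fun i => ((run i).1, run i.+1, (run i.+2).1))).
  apply: (@sum_count_le _ _ _ _ _ _ (fun t k => (t.1.1, (t.1.2, k), t.2))).
  - by rewrite filter_uniq ?undup_uniq.
  - by move=> t _; apply: iota_uniq.
  - by move=> [[a c] b] [[a' c'] b'] k k' _ _ _ _ _ _ /= [-> -> -> ->].
  - move=> [[a c] b] k; rewrite mem_filter mem_iota => /andP[/and3P[ac cb _] _] /andP[k0 _] oc.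
    have [i [im e1 e2 e3]] := occ3_index ac cb k0 oc.
    apply/mapP; exists i; first by rewrite mem_iota; lia.
    by rewrite e1 e2 e3.
have sS (X : Type) (s : seq X) (f : X -> nat) : \sum_(x <- s) (f x).+1 = size s + \sum_(x <- s) f x.
  by rewrite -sum1_size -big_split.
rewrite big_split /= sS -big_distrr /=.
under [X in _ + X + _]eq_bigr do rewrite sS.
rewrite big_split /=; lia.
Qed.

End ShortWords.

(** * Words with at least four runs *)

Lemma find_iota (P : pred nat) m j : P j -> j < m ->
  P (find P (iota 0 m)) /\ find P (iota 0 m) <= j.
Proof.
move=> Pj jm; have h : has P (iota 0 m) by apply/hasP; exists j => //; rewrite mem_iota.
have := nth_find 0 h; have := h; rewrite has_find size_iota => lt.
rewrite nth_iota // add0n => Pf; split=> //; rewrite leqNgt; apply/negP => ltj.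
by have := before_find 0 ltj; rewrite nth_iota // add0n Pj.
Qed.

Section Laminar.
Variables (Z K : eqType) (core : Z -> K) (ez : Z -> pred nat) (ek : K -> pred nat) (m : nat).

(** For [j] in [ek k2]: this set lies inside [ek k1], and every part of [ek k1] contains either all
    of it or nothing of it. *)
Definition refines (k1 k2 : K) (j : nat) := forall j1, ek k2 j1 ->
  ek k1 j1 /\ forall z, core z = k1 -> ez z j1 = ez z j.

Hypothesis ez_ek : forall z j, ez z j -> ek (core z) j.
Hypothesis ek_lt : forall k j, ek k j -> j < m.
Hypothesis ez_inj : forall z z' j, core z = core z' -> ez z j -> ez z' j -> z = z'.
Hypothesis ek_nested : forall k1 k2 j, k1 != k2 -> ek k1 j -> ek k2 j ->
  refines k1 k2 j \/ refines k2 k1 j.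

(* The sets [ek k] are laminar and split by the sets [ez z]; each proper part is
   charged to its least element if it misses the least element of [ek (core z)],
   and otherwise to the least element of the complement. *)
Lemma laminar_count (s : seq Z) : uniq s ->
  (forall z, z \in s -> exists j, ez z j) ->
  (forall z, z \in s -> exists j, ek (core z) j && ~~ ez z j) ->
  size s <= 2 * m.
Proof.
move=> us ne pr.
pose mn P := find P (iota 0 m).
pose rest z j := ek (core z) j && ~~ ez z j.
pose j0 z := mn (ek (core z)).
(* Nested sets can share their least element, so a part containing it cannot be charged there. The
   boolean separates the two kinds of charge. *)
pose g z := if ez z (j0 z) then (true, mn (rest z)) else (false, mn (ez z)).
have zP z : z \in s -> ez z (mn (ez z)) /\ (forall j, ez z j -> mn (ez z) <= j).
  move=> zs; have [j zj] := ne _ zs; have jm := ek_lt (ez_ek zj).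
  split=> [|j' zj']; first by case: (find_iota zj jm).
  by case: (find_iota zj' (ek_lt (ez_ek zj'))).
have rP z : z \in s -> rest z (mn (rest z)) /\ (forall j, rest z j -> mn (rest z) <= j).
  move=> zs; have [j zj] := pr _ zs; have lt j' : rest z j' -> j' < m by case/andP => /ek_lt.
  split=> [|j' zj']; first by case: (@find_iota (rest z) m j zj (lt _ zj)).
  by case: (@find_iota (rest z) m j' zj' (lt _ zj')).
have kP z : z \in s -> ek (core z) (j0 z) /\ (forall j, ek (core z) j -> j0 z <= j).
  move=> zs; have [j /ez_ek zj] := ne _ zs.
  split=> [|j' zj']; first by case: (find_iota zj (ek_lt zj)).
  by case: (find_iota zj' (ek_lt zj')).
(* By refinement the part [z] contains all of [ek (core z')], so the common least element is also
   that of [ek (core z')]; but the part [z'] misses the latter. *)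
have gF z z' : z \in s -> z' \in s -> refines (core z) (core z') (mn (ez z)) ->
    ez z' (j0 z') = false -> mn (ez z) = mn (ez z') -> False.
  move=> zs zs' rf nz' e; have [z1 z2] := zP _ zs; have [z1' z2'] := zP _ zs'.
  have [k1 k2] := kP _ zs'; have [_ /(_ z erefl) h] := rf _ k1; rewrite z1 in h.
  have le1 := z2 _ h; have le2 := k2 _ (ez_ek z1').
  have je : j0 z' = mn (ez z') by apply/eqP; rewrite eqn_leq le2 -e le1.
  by rewrite je z1' in nz'.
(* The same argument with the complements of the parts. *)
have gT z z' : z \in s -> z' \in s -> refines (core z) (core z') (mn (rest z)) ->
    ez z' (j0 z') -> mn (rest z) = mn (rest z') -> False.
  move=> zs zs' rf nz' e; have [z1 z2] := rP _ zs; have [z1' z2'] := rP _ zs'.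
  have [k1 k2] := kP _ zs'; have [h1 /(_ z erefl) h] := rf _ k1.
  case/andP: (z1) => _ /negPf nz; rewrite nz in h.
  have le1 : mn (rest z) <= j0 z' by apply: z2; rewrite /rest h1 h.
  case/andP: (z1') => ek' nez'; have le2 := k2 _ ek'.
  have je : j0 z' = mn (rest z') by apply/eqP; rewrite eqn_leq le2 -e le1.
  by rewrite -je nz' in nez'.
have gI : {in s &, injective g}.
  move=> z z' zs zs'; rewrite /g.
  have [cc|cn] := eqVneq (core z) (core z').
    case: ifP => h; case: ifP => h' // [e].
      have je : j0 z = j0 z' by rewrite /j0 cc.
      by rewrite -je in h'; apply: ez_inj cc h h'.
    have [z1 _] := zP _ zs; have [z1' _] := zP _ zs'; rewrite -e in z1'.
    exact: ez_inj cc z1 z1'.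
  case: ifP => h; case: ifP => h' // [e]; exfalso.
    have [/andP[z1 _] _] := rP _ zs; have [/andP[z1' _] _] := rP _ zs'; rewrite -e in z1'.
    case: (ek_nested cn z1 z1') => rf; first exact: gT e.
    by rewrite e in rf; apply: gT (esym e).
  have [/ez_ek z1 _] := zP _ zs; have [/ez_ek z1' _] := zP _ zs'; rewrite -e in z1'.
  case: (ek_nested cn z1 z1') => rf; first exact: gF e.
  by rewrite e in rf; apply: gF (esym e).
have -> : 2 * m = size [seq (bb, j) | bb <- [:: true; false], j <- iota 0 m].
  by rewrite size_allpairs size_iota.
apply: uniq_map_count us gI _ => z zs.
apply/allpairsP; rewrite /g; case: ifP => _.
  exists (true, mn (rest z)); split=> //=; rewrite mem_iota.
  by have [/andP[/ek_lt h _] _] := rP _ zs.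
exists (false, mn (ez z)); split=> //=; rewrite mem_iota.
by have [/ez_ek/ek_lt h _] := zP _ zs.
Qed.

End Laminar.

(** Turns a bound on the values of a sorted list into a bound on the indices, as the threshold [T]
    of a request demands. *)
Lemma sorted_count (X : eqType) (x0 : X) (f : X -> nat) (t : seq X) k j :
  sorted leq (map f t) -> j < size t ->
  (j < count (fun x => f x <= k) t) = (f (nth x0 t j) <= k).
Proof.
elim: t j => // x t IH j st; have {}IH := IH _ (path_sorted st).
have al : all (fun y => f x <= f y) t.
  by have := order_path_min leq_trans st; rewrite all_map.
have [xk|xk] := leqP (f x) k.
  by case: j => [|j] /= jt; rewrite xk //= add1n ltnS IH.
have c0 : count (fun x => f x <= k) t = 0.
  apply/eqP; rewrite eqn0Ngt -has_count; apply/hasPn => y.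
  by move=> /(allP al) /= xy; rewrite -ltnNge (leq_trans xk).
have fx : (f x <= k) = false by rewrite leqNgt xk.
rewrite /= fx c0 /=; case: j => [|j] /= jt; first by rewrite fx.
by apply/esym/negbTE; rewrite -ltnNge (leq_trans xk) //; apply: (allP al); apply: mem_nth.
Qed.

Section LongWords.
Variables (Sigma : eqType) (R : seq (Sigma * nat)) (n B : nat) (code : Sigma -> nat).
Hypothesis cR : canon R.
Hypothesis n_size : size (unrle R) <= n.
Hypothesis n0 : 0 < n.
Hypothesis nB : n < B.
Hypothesis codeB : forall a, code a < B.
Variable c0 : Sigma.
Implicit Types (W V U : seq (Sigma * nat)) (a b c d : Sigma).

Notation m := (size R).
Notation enumerates := (enumerates R n B code).
Notation occ := (occurs_runs R).
Notation mw := (maw_runs R).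
Notation run := (run_at R c0).
Notation mid := (slice R).

Let ckey : Type := Sigma * seq (Sigma * nat) * Sigma.
Let lkey : Type := Sigma * nat * ckey.
Let rkey : Type := nat * Sigma * ckey.

(* The word [a c^e V d^f b] has the core [(c, V, d)], the left key [(a, e)] over it
   and the right key [(f, b)] over it. *)
Definition cke i j : ckey := ((run i).1, mid i j, (run j).1).
Definition lke i j : lkey := ((run i.-1).1, (run i).2, cke i j).
Definition rke i j : rkey := ((run j).2, (run j.+1).1, cke i j).

Lemma mid_cons i j : i.+1 < j -> j <= m -> mid i j = run i.+1 :: mid i.+1 j.
Proof.
move=> ij jm; rewrite /slice (drop_nth (c0, 0)) ?size_takel // nth_take //.
Qed.

Lemma mid_rcons i j : i < j -> j < m -> mid i j.+1 = rcons (mid i j) (run j).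
Proof.
move=> ij jm; rewrite /slice (take_nth (c0, 0)) // drop_rcons // size_takel //; exact: ltnW.
Qed.

Lemma mid_drop i u j : i <= u -> mid u j = drop (u - i) (mid i j).
Proof. by move=> iu; rewrite /slice drop_drop; congr drop; lia. Qed.

Lemma mid_take i u j : i < u -> u <= j -> j <= m -> mid i u = take (u - i.+1) (mid i j).
Proof.
move=> iu uj jm; rewrite /slice take_drop subnK // take_takel //.
Qed.

Lemma cke_shift i j i' j' : i < j -> j < m -> i' < j' -> j' < m -> cke i j = cke i' j' ->
  j - i = j' - i' /\ forall t, 0 < t -> t < j - i -> run (i + t) = run (i' + t).
Proof.
move=> ij jm ij' jm' [e1 e2 e3].
have se : j - i = j' - i'.
  by move/(congr1 size): e2; rewrite !size_mid ?(ltnW jm) ?(ltnW jm') //; lia.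
split=> // t t0 tj; have := congr1 (fun s => nth (c0, 0) s t.-1) e2.
by rewrite !(nth_mid c0) ?(ltnW jm) ?(ltnW jm') //; try lia; rewrite !addSn -!addnS prednK.
Qed.

(** Run [u] lies strictly inside the core, so its length is recorded there. The run before it may be
    the outer run [i], of which the core still records the letter, and a left key asks for no
    more. *)
Lemma cke_left i j i' j' u : i < u -> u < j -> j < m -> i' < j' -> j' < m ->
  cke i j = cke i' j' -> let u' := i' + (u - i) in
  [/\ 0 < u', u' < j', cke u j = cke u' j' & lke u j = lke u' j'].
Proof.
move=> iu uj jm ij' jm' e; have [se rn] := cke_shift (ltn_trans iu uj) jm ij' jm' e.
move=> u'; have uE : i + (u - i) = u by lia.
have ru : run u = run u' by rewrite -uE; apply: rn; lia.
have ce : cke u j = cke u' j'.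
  case: e => _ e2 e3; rewrite /cke ru e3 (@mid_drop i) ?(ltnW iu) //.
  rewrite (@mid_drop i' u') ?leq_addr // e2; congr (_, drop _ _, _).
  by rewrite /u' addKn.
split=> //; rewrite /u'; try lia.
rewrite /lke -/u' ce ru; congr (_, _, _).
case: (eqVneq u i.+1) => [u1|un].
  by rewrite /u' u1 subSnn addn1 /=; case: e.
have -> : u.-1 = i + (u - i).-1 by lia.
have -> : u'.-1 = i' + (u - i).-1 by rewrite /u'; lia.
by rewrite rn //; lia.
Qed.

Lemma cke_right i j i' j' u : i < u -> u < j -> j < m -> i' < j' -> j' < m ->
  cke i j = cke i' j' -> let u' := i' + (u - i) in
  [/\ i' < u', u' < j', cke i u = cke i' u' & rke i u = rke i' u'].
Proof.
move=> iu uj jm ij' jm' e; have [se rn] := cke_shift (ltn_trans iu uj) jm ij' jm' e.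
move=> u'; have uE : i + (u - i) = u by lia.
have ru : run u = run u' by rewrite -uE; apply: rn; lia.
have ce : cke i u = cke i' u'.
  case: e => e1 e2 _; rewrite /cke ru e1 (@mid_take i u j) ?(ltnW uj) ?(ltnW jm) //.
  rewrite (@mid_take i' u' j') ?(ltnW jm') //; try (rewrite /u'; lia).
  by rewrite e2; congr (_, take _ _, _); rewrite /u'; lia.
split=> //; rewrite /u'; try lia.
rewrite /rke -/u' ce ru; congr (_, _, _).
case: (eqVneq u.+1 j) => [u1|un].
  have -> : u'.+1 = j' by rewrite /u'; lia.
  by rewrite u1; case: e.
have -> : u.+1 = i + (u - i).+1 by lia.
have -> : u'.+1 = i' + (u - i).+1 by rewrite /u'; lia.
by rewrite rn //; lia.
Qed.

(* Occurrences of a core by the index of its last, resp. first, run. *)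
Definition st (k : ckey) j := j - (size k.1.2).+1.
Definition en (k : ckey) i := i + (size k.1.2).+1.
Definition ends_at (k : ckey) j := [&& size k.1.2 < j, j < m & cke (st k j) j == k].
Definition starts_at (k : ckey) i := (en k i < m) && (cke i (en k i) == k).
Definition l_ends_at (z : lkey) j := ends_at z.2 j && (0 < st z.2 j) && (lke (st z.2 j) j == z).
Definition r_starts_at (z : rkey) i := starts_at z.2 i && ((en z.2 i).+1 < m) && (rke i (en z.2 i) == z).

Lemma ends_atI i j : i < j -> j < m -> ends_at (cke i j) j /\ st (cke i j) j = i.
Proof.
move=> ij jm; have e : st (cke i j) j = i.
  by rewrite /st /= size_mid ?(ltnW jm) //; lia.
by rewrite /ends_at e eqxx jm /= size_mid ?(ltnW jm) //; split=> //; lia.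
Qed.

Lemma starts_atI i j : i < j -> j < m -> starts_at (cke i j) i /\ en (cke i j) i = j.
Proof.
move=> ij jm; have e : en (cke i j) i = j.
  by rewrite /en /= size_mid ?(ltnW jm) //; lia.
by rewrite /starts_at e eqxx jm.
Qed.

Lemma ends_atE k j : ends_at k j -> [/\ st k j < j, j < m & cke (st k j) j = k].
Proof. by move=> /and3P[sj jm /eqP e]; split=> //; rewrite /st; lia. Qed.

Lemma starts_atE k i : starts_at k i -> [/\ i < en k i, en k i < m & cke i (en k i) = k].
Proof. by move=> /andP[jm /eqP e]; split=> //; rewrite /en; lia. Qed.

Lemma l_ends_atI i j : 0 < i -> i < j -> j < m -> l_ends_at (lke i j) j.
Proof.
by move=> i0 ij jm; have [h e] := ends_atI ij jm; rewrite /l_ends_at /= h e i0 eqxx.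
Qed.

Lemma r_starts_atI i j : i < j -> j.+1 < m -> r_starts_at (rke i j) i.
Proof.
by move=> ij jm; have [h e] := starts_atI ij (ltnW jm); rewrite /r_starts_at /= h e jm eqxx.
Qed.

(** Fails when every occurrence of the core carries the left key [z]. Such keys are too many to be
    stored, but by [maw_keys] they belong to no MAW. *)
Definition l_proper (z : lkey) := has (fun j => ends_at z.2 j && ~~ l_ends_at z j) (iota 0 m).
Definition r_proper (z : rkey) := has (fun i => starts_at z.2 i && ~~ r_starts_at z i) (iota 0 m).

(** Of two cores ending at the same run, the shorter is a suffix of the longer. By [cke_left], every
    occurrence of the longer one contains the shorter one with the same left key. *)
Lemma l_refines k1 k2 j : ends_at k1 j -> ends_at k2 j -> st k2 j < st k1 j ->
  refines (fun z : lkey => z.2) l_ends_at ends_at k1 k2 j.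
Proof.
move=> h1 h2 lt j1 h3.
have [a1 a2 a3] := ends_atE h1; have [b1 b2 b3] := ends_atE h2; have [d1 d2 d3] := ends_atE h3.
have e : cke (st k2 j) j = cke (st k2 j1) j1 by rewrite b3 d3.
have [u0 uj ce le] := cke_left lt a1 a2 d1 d2 e.
set u' := _ + _ in u0 uj ce le; rewrite a3 in ce.
have [g1 g2] := ends_atI uj d2; rewrite -ce in g1 g2.
split=> // z zk; rewrite /l_ends_at zk g1 h1 g2 u0 le /=.
by have -> : 0 < st k1 j by lia.
Qed.

Lemma r_refines k1 k2 j : starts_at k1 j -> starts_at k2 j -> en k1 j < en k2 j ->
  refines (fun z : rkey => z.2) r_starts_at starts_at k1 k2 j.
Proof.
move=> h1 h2 lt j1 h3.
have [a1 a2 a3] := starts_atE h1; have [b1 b2 b3] := starts_atE h2; have [d1 d2 d3] := starts_atE h3.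
have e : cke j (en k2 j) = cke j1 (en k2 j1) by rewrite b3 d3.
have [u0 uj ce le] := cke_right a1 lt b2 d1 d2 e.
set u' := _ + _ in u0 uj ce le; rewrite a3 in ce.
have [g1 g2] := starts_atI u0 (ltn_trans uj d2); rewrite -ce in g1 g2.
split=> // z zk; rewrite /r_starts_at zk g1 h1 g2 le /=.
by rewrite (leq_ltn_trans uj d2) (leq_ltn_trans lt b2).
Qed.

Definition spans := [seq (i, j) | i <- iota 0 m, j <- iota i.+1 (m - i.+1)].

Lemma mem_spans i j : ((i, j) \in spans) = (i < j < m).
Proof.
apply/allpairsPdep/andP => [[i' [j' [im + [-> ->]]]]|[ij jm]].
  by rewrite mem_iota in im *; rewrite mem_iota; lia.
by exists i, j; rewrite !mem_iota; split=> //; lia.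
Qed.

Definition lkeys := [seq z <- undup [seq lke x.1 x.2 | x <- spans & 0 < x.1] | l_proper z].
Definition rkeys := [seq z <- undup [seq rke x.1 x.2 | x <- spans & x.2.+1 < m] | r_proper z].

Lemma mem_lkeys z : (z \in lkeys) -> (exists i j, [/\ 0 < i, i < j, j < m & lke i j = z]) /\ l_proper z.
Proof.
rewrite mem_filter mem_undup => /andP[pz /mapP[[i j]]].
rewrite mem_filter mem_spans => /andP[i0 /andP[ij jm]] zE; split=> //.
by exists i, j; rewrite zE.
Qed.

Lemma mem_rkeys z : (z \in rkeys) -> (exists i j, [/\ i < j, j.+1 < m & rke i j = z]) /\ r_proper z.
Proof.
rewrite mem_filter mem_undup => /andP[pz /mapP[[i j]]].
rewrite mem_filter mem_spans => /andP[i0 /andP[ij jm]] zE; split=> //.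
by exists i, j; rewrite zE.
Qed.

Lemma lkeysI i j : 0 < i -> i < j -> j < m -> l_proper (lke i j) -> lke i j \in lkeys.
Proof.
move=> i0 ij jm pz; rewrite mem_filter pz mem_undup; apply/mapP; exists (i, j) => //.
by rewrite mem_filter mem_spans i0 ij.
Qed.

Lemma rkeysI i j : i < j -> j.+1 < m -> r_proper (rke i j) -> rke i j \in rkeys.
Proof.
move=> ij jm pz; rewrite mem_filter pz mem_undup; apply/mapP; exists (i, j) => //.
by rewrite mem_filter mem_spans /= jm ij ltnW.
Qed.

Lemma lkeys_size : size lkeys <= 2 * m.
Proof.
apply: (@laminar_count _ _ (fun z : lkey => z.2) l_ends_at ends_at).
- by move=> z j /andP[/andP[]].
- by move=> k j /and3P[].
- move=> z z' j zz /andP[_ /eqP <-] /andP[_ /eqP <-]; by rewrite zz.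
- move=> k1 k2 j kk h1 h2; have [_ _ e1] := ends_atE h1; have [_ _ e2] := ends_atE h2.
  case: (ltngtP (st k1 j) (st k2 j)) => h; [right|left|].
  + exact: l_refines.
  + exact: l_refines.
  + by rewrite -e1 -e2 h eqxx in kk.
- by rewrite filter_uniq ?undup_uniq.
- by move=> z /mem_lkeys[[i [j [i0 ij jm <-]]] _]; exists j; apply: l_ends_atI.
- by move=> z /mem_lkeys[_ /hasP[j _ h]]; exists j.
Qed.

Lemma rkeys_size : size rkeys <= 2 * m.
Proof.
apply: (@laminar_count _ _ (fun z : rkey => z.2) r_starts_at starts_at).
- by move=> z j /andP[/andP[]].
- by move=> k j /starts_atE[h1 h2 _]; apply: ltn_trans h2.
- move=> z z' j zz /andP[_ /eqP <-] /andP[_ /eqP <-]; by rewrite zz.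
- move=> k1 k2 j kk h1 h2; have [_ _ e1] := starts_atE h1; have [_ _ e2] := starts_atE h2.
  case: (ltngtP (en k1 j) (en k2 j)) => h; [left|right|].
  + exact: r_refines.
  + exact: r_refines.
  + by rewrite -e1 -e2 h eqxx in kk.
- by rewrite filter_uniq ?undup_uniq.
- by move=> z /mem_rkeys[[i [j [ij jm <-]]] _]; exists i; apply: r_starts_atI.
- by move=> z /mem_rkeys[_ /hasP[j _ h]]; exists j.
Qed.

(** * The words built from a left key and a right key *)

Definition lword (z : lkey) f := let: (a, e, (c, V, d)) := z in
  (a, 1) :: rcons ((c, e) :: V) (d, f).
Definition rword (z : rkey) e := let: (f, b, (c, V, d)) := z in
  (c, e) :: rcons (rcons V (d, f)) (b, 1).
Definition word (z : lkey) (z' : rkey) :=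
  let: (a, e, (c, V, d)) := z in let: (f, b, _) := z' in
  (a, 1) :: rcons ((c, e) :: rcons V (d, f)) (b, 1).

Lemma canon_window i j : i < j -> j < m -> canon (run i :: rcons (mid i j) (run j)).
Proof.
move=> ij jm; have := cR; rewrite {1}(split_runs c0 ij jm) canon_cat_cons => /andP[_].
by rewrite -cat_cons canon_cat_cons => /andP[].
Qed.

Lemma canon_lword i j f : 0 < i -> i < j -> j < m -> 0 < f -> canon (lword (lke i j) f).
Proof.
move=> i0 ij jm f0; have ip : i.-1 < j by lia.
have := canon_window ip jm; rewrite mid_cons ?(ltnW jm) ?prednK //.
rewrite (surjective_pairing (run i.-1)) (surjective_pairing (run j)) => /(canon_head_len (ltn0Sn 0)).
rewrite -rcons_cons => /(canon_last_len f0).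
by rewrite /lword /= -surjective_pairing.
Qed.

Lemma canon_rword i j e : i < j -> j.+1 < m -> 0 < e -> canon (rword (rke i j) e).
Proof.
move=> ij jm e0; have ij' : i < j.+1 by lia.
have := canon_window ij' jm; rewrite mid_rcons ?(ltnW jm) //.
rewrite (surjective_pairing (run i)) (surjective_pairing (run j.+1)) => /(canon_head_len e0).
rewrite -rcons_cons => /(canon_last_len (ltn0Sn 0)).
by rewrite /rword /= -surjective_pairing.
Qed.

Lemma wordE z z' : z.2 = z'.2 -> word z z' = rcons (lword z z'.1.1) (z'.1.2, 1).
Proof. by case: z z' => [[a e] [[c V] d]] [[f b] k]. Qed.

Lemma canon_word i j i' j' : 0 < i -> i < j -> j < m -> i' < j' -> j'.+1 < m ->
  cke i j = cke i' j' -> canon (word (lke i j) (rke i' j')).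
Proof.
move=> i0 ij jm ij' jm' ce; have cl := canon_lword i0 ij jm (run_pos c0 cR (ltnW jm')).
have -> : word (lke i j) (rke i' j') = (((run i.-1).1, 1) :: ((run i).1, (run i).2) :: mid i j)
    ++ ((run j).1, (run j').2) :: [:: ((run j'.+1).1, 1)].
  by rewrite wordE //= -cats1 /= cat_rcons.
rewrite canon_cat_cons canon2 run_pos ?(ltnW jm') //=.
have [_ _ de] := ce; rewrite {2}de run_neq // andbT.
exact: cl.
Qed.

Lemma lke_shape i j z f : lke i j = z -> lword z f =
  ((run i.-1).1, 1) :: rcons (((run i).1, (run i).2) :: mid i j) ((run j).1, f).
Proof. by move=> <-. Qed.

Lemma occ_lword z f : canon (lword z f) ->
  reflect (exists i j, [/\ 0 < i, i < j, j < m, lke i j = z & f <= (run j).2]) (occ (lword z f)).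
Proof.
case: z => [[a e] [[c V] d]] cW; apply: (iffP (occ_index c0 cR cW)).
  move=> [i [j [ij jm [e1 _] mE [e2 le]]]].
  have ij' : i.+1 < j.
    by move/(congr1 size): mE; rewrite size_mid ?(ltnW jm) //=; lia.
  rewrite mid_cons ?(ltnW jm) // in mE; case: mE => r1 mE.
  by exists i.+1, j; rewrite /lke /cke r1 mE /= e1 e2.
move=> [i [j [i0 ij jm [<- <- <- <- <-] le]]].
have ip : i.-1.+1 < j by rewrite prednK.
exists i.-1, j; split=> //; try lia.
- by split=> //; apply: run_pos => //; lia.
- by rewrite mid_cons ?(ltnW jm) // prednK // -surjective_pairing.
Qed.

Lemma occ_rword z e : canon (rword z e) ->
  reflect (exists i j, [/\ i < j, j.+1 < m, rke i j = z & e <= (run i).2]) (occ (rword z e)).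
Proof.
case: z => [[f b] [[c V] d]] cW; apply: (iffP (occ_index c0 cR cW)).
  move=> [i [j [ij jm [e1 le] mE [e2 _]]]].
  have ij' : i.+1 < j.
    by move/(congr1 size): mE; rewrite size_mid ?(ltnW jm) // size_rcons /=; lia.
  case: j ij jm mE e2 ij' => // j ij jm mE e2 ij'.
  rewrite mid_rcons ?(ltnW jm) // in mE; case/rcons_inj: mE => mE r1.
  by exists i, j; rewrite /rke /cke r1 mE /= e1 e2.
move=> [i [j [ij jm [<- <- <- <- <-] le]]].
exists i, j.+1; split=> //; try lia.
- by rewrite mid_rcons ?(ltnW jm) // -surjective_pairing.
- by split=> //; apply: run_pos.
Qed.

Lemma occ_word z z' : canon (word z z') -> z.2 = z'.2 ->
  reflect (exists i j, [/\ 0 < i, i < j, j.+1 < m, lke i j = z & rke i j = z']) (occ (word z z')).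
Proof.
case: z => [[a e] [[c V] d]]; case: z' => [[f b] k] /= cW ck.
apply: (iffP (@occ_index _ R c0 cR a 1 ((c, e) :: rcons V (d, f)) b 1 cW)).
  move=> [i [j [ij jm [e1 _] mE [e2 le]]]].
  have ij' : i.+2 < j.
    by move/(congr1 size): mE; rewrite size_mid ?(ltnW jm) //= size_rcons /=; lia.
  case: j ij jm mE e2 le ij' => // j ij jm mE e2 le ij'.
  rewrite mid_cons ?(ltnW jm) // in mE; last by lia.
  case: mE => r1 mE.
  rewrite mid_rcons ?(ltnW jm) // in mE; case/rcons_inj: mE => mE r2.
  by exists i.+1, j; rewrite /lke /rke /cke r1 r2 mE /= e1 e2 -ck.
move=> [i [j [i0 ij jm [<- <- <- <- <-] [<- <- _]]]].
exists i.-1, j.+1; split=> //; try lia.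
- by split=> //; apply: run_pos => //; lia.
- rewrite mid_cons ?(ltnW jm) ?prednK //; last by lia.
  by rewrite mid_rcons ?(ltnW jm) // -!surjective_pairing.
- by split=> //; apply: run_pos.
Qed.

(** This and [right_max] are the functions [F] and [E] of the overview. *)
Definition left_max z := max_len n (fun f => occ (lword z f)).
Definition right_max z := max_len n (fun e => occ (rword z e)).

Lemma left_maxP z f : z \in lkeys -> 0 < f -> occ (lword z f) = (f <= left_max z).
Proof.
move=> /mem_lkeys[[i [j [i0 ij jm <-]]] _] f0.
apply: (max_lenP (Q := fun f => occ (lword (lke i j) f))) => // [f1 oc|f1 f2 f10 le].
  case: (posnP f1) => [->//|f10].
  have [i' [j' [_ _ jm' _ le]]] := occ_lword (canon_lword i0 ij jm f10) oc.
  exact: leq_trans le (run_len c0 n_size jm').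
exact: (@occ_last_len _ R _ _ _ (_ :: _ :: _) le).
Qed.

Lemma right_maxP z e : z \in rkeys -> 0 < e -> occ (rword z e) = (e <= right_max z).
Proof.
move=> /mem_rkeys[[i [j [ij jm <-]]] _] e0.
apply: (max_lenP (Q := fun e => occ (rword (rke i j) e))) => // [f1 oc|f1 f2 f10 le].
  case: (posnP f1) => [->//|f10].
  have [i' [j' [ij' jm' _ le]]] := occ_rword (canon_rword ij jm f10) oc.
  apply: leq_trans le (run_len c0 n_size _); lia.
exact: occ_head_len le.
Qed.

Lemma mw_word z z' : z.2 = z'.2 -> mw (word z z') =
  [&& ~~ occ (word z z'), occ (rword z' z.1.2) & occ (lword z z'.1.1)].
Proof.
by case: z z' => [[a e] [[c V] d]] [[f b] k] /= <-; apply: (mw_ends R a ((c, e) :: rcons V (d, f)) b).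
Qed.

(** The word without its first letter occurs, with the core inside. That occurrence of the core
    cannot have the left key [z], or the whole word would occur; hence [z] is proper. The right key
    is treated symmetrically. *)
Lemma maw_keys z z' : canon (word z z') -> z.2 = z'.2 -> mw (word z z') ->
  z \in lkeys /\ z' \in rkeys.
Proof.
move=> cW zz; rewrite mw_word // => /and3P[no ro lo].
have cl : canon (lword z z'.1.1).
  by move: cW; rewrite wordE // => /canon_belast.
have cr : canon (rword z' z.1.2).
  move: cW zz; case: (z) (z') => [[a e] [[c V] d]] [[f b] k] /= cW <-.
  by move/canon_behead: cW.
have [i [j [i0 ij jm lE lf]]] := occ_lword cl lo.
have [i' [j' [ij' jm' rE le]]] := occ_rword cr ro.
have zE : z.2 = cke i j by rewrite -lE.
have zE' : z'.2 = cke i' j' by rewrite -rE.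
split.
  rewrite -lE; apply: lkeysI => //; apply/hasP; exists j'.
    by rewrite mem_iota; lia.
  have [h1 h2] := ends_atI ij' (ltnW jm').
  rewrite /= -zE zz zE' h1 /l_ends_at /= -zE zz zE' h1 h2 /=.
  apply: contra no => /andP[i0' /eqP e]; apply/(occ_word cW zz).
  by exists i', j'; split=> //; rewrite e.
rewrite -rE; apply: rkeysI => //; apply/hasP; exists i.
  by rewrite mem_iota; lia.
have [h1 h2] := starts_atI ij jm.
rewrite /= -zE' -zz zE h1 /r_starts_at /= -zE' -zz zE h1 h2 /=.
apply: contra no => /andP[i0' /eqP e]; apply/(occ_word cW zz).
by exists i, j; split=> //; rewrite e.
Qed.

(** Reads the core off the word itself, so that the classes of distinct cores are visibly
    disjoint. *)
Definition word_core W : ckey :=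
  ((nth (c0, 0) W 1).1, drop 2 (take (size W).-2 W), (nth (c0, 0) W (size W).-2).1).

Lemma word_coreE z z' : word_core (word z z') = z.2.
Proof.
case: z z' => [[a e] [[c V] d]] [[f b] k].
rewrite /word_core /= !size_rcons /= drop0.
rewrite nth_rcons size_rcons ltnSn nth_rcons ltnn eqxx.
by rewrite -cats1 take_cat size_rcons ltnSn -cats1 take_size_cat.
Qed.

Lemma word_inj z z' y y' : z.2 = z'.2 -> y.2 = y'.2 -> word z z' = word y y' -> z = y /\ z' = y'.
Proof.
case: z z' y y' => [[a e] [[c V] d]] [[f b] k] [[a1 e1] [[c1 V1] d1]] [[f1 b1] k1] /= <- <- [-> -> ->].
by case/rcons_inj => /rcons_inj[-> -> ->] ->.
Qed.

Lemma nd_long W : canon W -> nd W -> 3 < size W -> exists z z', W = word z z' /\ z.2 = z'.2.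
Proof.
move=> cW nW sW; have [|a [U [b WE]]] := nd_ends cW nW; first by apply: leq_trans sW.
rewrite WE /= size_rcons in sW; case: U WE sW => [|[c e] U] // WE.
case/lastP: U WE => [|V [d f]] // WE _.
by exists (a, e, (c, V, d)), (f, b, (c, V, d)).
Qed.

Definition lgroup k := sort (fun z1 z2 : lkey => z1.1.2 <= z2.1.2) [seq z <- lkeys | z.2 == k].
Definition rgroup k := sort (fun z1 z2 : rkey => z1.1.1 <= z2.1.1) [seq z <- rkeys | z.2 == k].

Lemma mem_lgroup k z : (z \in lgroup k) = (z.2 == k) && (z \in lkeys).
Proof. by rewrite mem_sort mem_filter. Qed.

Lemma mem_rgroup k z : (z \in rgroup k) = (z.2 == k) && (z \in rkeys).
Proof. by rewrite mem_sort mem_filter. Qed.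

Lemma lgroup_uniq k : uniq (lgroup k).
Proof. by rewrite sort_uniq !filter_uniq ?undup_uniq. Qed.

Lemma rgroup_uniq k : uniq (rgroup k).
Proof. by rewrite sort_uniq !filter_uniq ?undup_uniq. Qed.

Definition lpos z := nth (0, 0) spans (find (fun x => (0 < x.1) && (lke x.1 x.2 == z)) spans).

Lemma lposP z : z \in lkeys -> [/\ 0 < (lpos z).1, (lpos z).1 < (lpos z).2, (lpos z).2 < m
  & lke (lpos z).1 (lpos z).2 = z].
Proof.
move=> /mem_lkeys[[i [j [i0 ij jm e]]] _].
have h : has (fun x => (0 < x.1) && (lke x.1 x.2 == z)) spans.
  by apply/hasP; exists (i, j); rewrite ?mem_spans ?ij //= i0 e eqxx.
have /andP[p0 /eqP pe] := nth_find (0, 0) h.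
have : lpos z \in spans by rewrite mem_nth // -has_find.
by rewrite (surjective_pairing (lpos z)) mem_spans => /andP[].
Qed.

Lemma decode_word z z' : z \in lkeys -> canon (word z z') -> z.2 = z'.2 -> z'.1.1 <= n ->
  decode R (z'.1.2, z'.1.1, (lpos z).1, (lpos z).2.+1) = word z z'
  /\ quad_ok n m (z'.1.2, z'.1.1, (lpos z).1, (lpos z).2.+1).
Proof.
move=> zl cW zz fn; have [i0 ij jm zE] := lposP zl.
set i := (lpos z).1 in i0 ij zE *; set j := (lpos z).2 in ij jm zE *.
have ip : i.-1 < j by lia.
have E := split_runs c0 ip jm.
rewrite (surjective_pairing (run i.-1)) (surjective_pairing (run j)) in E.
have [] := decode_right cR n_size n0 z'.1.2 E fn.
rewrite size_takel ?size_mid ?(ltnW jm) //; last by lia.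
(* The word starts at run [i - 1], the one of the letter [a]; counted from one, its positions are
   [i] and [j + 1]. *)
have -> : (i.-1 + (j - i.-1.+1)).+2 = j.+1 by lia.
rewrite prednK // => h1 h2; split=> //; rewrite h1 -[RHS](merge_canon cW).
congr merge_runs; rewrite wordE // (lke_shape _ zE) mid_cons ?prednK ?(ltnW jm) //.
by rewrite -surjective_pairing /= cats1.
Qed.

Definition typ4 k W := [&& nd W, 3 < size W & word_core W == k].

Lemma enum_core k : enumerates (typ4 k) (2 * size (rgroup k) +
  \sum_(z <- lgroup k) (count (fun z' => occ (word z z')) (rgroup k)).+1).
Proof.
case E : (lgroup k) => [|z0 l].
  apply: enum_weaken (leq0n _) _; exists [::]; split=> //; first exact: sch0.
  move=> W; rewrite in_nil; apply/esym/negP => /and3P[/and3P[nW sW /eqP kW] cW mW].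
  have [z [z' [WE zz]]] := nd_long cW nW sW; rewrite WE in cW mW kW.
  have [zl _] := maw_keys cW zz mW.
  have : z \in lgroup k by rewrite mem_lgroup zl -kW word_coreE eqxx.
  by rewrite E.
rewrite -{}E.
(* A core without right keys has no MAW; otherwise [y0] is the default for [nth]. *)
case F : (rgroup k) => [|y0 r'].
  apply: enum_weaken (leq0n _) _; exists [::]; split=> //; first exact: sch0.
  move=> W; rewrite in_nil; apply/esym/negP => /and3P[/and3P[nW sW /eqP kW] cW mW].
  have [z [z' [WE zz]]] := nd_long cW nW sW; rewrite WE in cW mW kW.
  have [_ zl] := maw_keys cW zz mW.
  have : z' \in rgroup k by rewrite mem_rgroup zl -kW word_coreE zz eqxx.
  by rewrite F.
rewrite -{}F; set t := rgroup k; set N := size t.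
(* An item carries the single exponent [f], so the cap [n] of the requests never cuts. *)
pose its := [seq (z.1.2, z.1.1, z.1.1) | z <- t] : seq (Sigma * nat * nat).
pose e (z : lkey) := z.1.2.
pose E j := right_max (nth y0 t j).
(* The items are sorted by [f], so [f <= F(a, e)] becomes a bound on the index. *)
pose T z := count (fun z' : rkey => z'.1.1 <= left_max z) t.
pose P z j := ~~ occ (word z (nth y0 t j)).
pose WF z j (x : nat) := word z (nth y0 t j).
have itE j : j < N -> nth (c0, 0, 0) its j = let z := nth y0 t j in (z.1.2, z.1.1, z.1.1).
  by move=> jl; rewrite (nth_map y0).
have tP j : j < N -> (nth y0 t j).2 = k /\ nth y0 t j \in rkeys.
  by move=> jl; have := mem_nth y0 jl; rewrite mem_rgroup => /andP[/eqP].
have tn j : j < N -> (nth y0 t j).1.1 <= n.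
  move=> /tP[_ /mem_rkeys[[i [j' [ij jm <-]]] _]].
  by apply: (run_len c0 n_size); apply: ltnW.
have tpos j : j < N -> 0 < (nth y0 t j).1.1.
  move=> /tP[_ /mem_rkeys[[i [j' [ij jm <-]]] _]].
  by apply: (run_pos c0 cR); apply: ltnW.
have epos z : z \in lkeys -> 0 < z.1.2.
  move=> /mem_lkeys[[i [j' [i0 ij jm <-]]] _].
  by apply: (run_pos c0 cR); apply: ltn_trans jm.
have cwP z j : z \in lgroup k -> j < N -> canon (word z (nth y0 t j)).
  rewrite mem_lgroup => /andP[/eqP zk /mem_lkeys[[i [j1 [i0 ij jm zE]]] _]] /tP[].
  move=> zk' /mem_rkeys[[i' [j' [ij' jm' zE']]] _].
  rewrite -zE -zE'; apply: canon_word => //.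
  by rewrite -[LHS]/(lke i j1).2 -[RHS]/(rke i' j').2 zE zE' zk zk'.
have Ts z j : j < N -> (j < T z) = ((nth y0 t j).1.1 <= left_max z).
  move=> jl; apply: (@sorted_count _ y0 (fun z' : rkey => z'.1.1)) => //.
  by rewrite sorted_map; apply: sort_sorted => x y; apply: leq_total.
have selE z j : j \in selected (gits code its) e T E P z =
    [&& j < N, e z <= E j, (nth y0 t j).1.1 <= left_max z & P z j].
  rewrite mem_filter mem_iota !size_map /= add0n -/N andbC.
  by case: (ltnP j N) => //= jl; rewrite Ts.
have vE z j x : valid code (lgroup k) its (fun=> n) e T E P c0 z j x ->
   [/\ z \in lgroup k, j < N, e z <= E j, (nth y0 t j).1.1 <= left_max z
     & P z j /\ x = (nth y0 t j).1.1].
  rewrite /valid selE => /and4P[zl /and4P[jl h1 h2 h3]]; rewrite itE //= leq_min => h4 /andP[h5 _].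
  by split=> //; split=> //; apply/eqP; rewrite eqn_leq h4 h5.
have lgP z : z \in lgroup k -> z.2 = k /\ z \in lkeys.
  by rewrite mem_lgroup => /andP[/eqP].
have := @enum_group _ R n B code cR n_size n0 nB codeB _ (lgroup k) its
  (fun z => (lpos z).1) (fun z => (lpos z).2.+1) (fun=> n) e T E P c0 WF (typ4 k).
have le : 2 * size its + \sum_(x <- lgroup k) (skipped (gits code its) e T E P x).+1
   <= 2 * N + \sum_(z <- lgroup k) (count (fun z' => occ (word z z')) t).+1.
  rewrite size_map leq_add2l; apply: leq_sum => z _; rewrite ltnS /skipped !size_map.
  rewrite -(count_nth y0); apply: sub_count => j /=.
  by rewrite /P negbK => /and3P[].
move=> H; apply: enum_weaken le _; apply: H.
- exact: lgroup_uniq.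
- by rewrite sorted_map; apply: sort_sorted => x y; apply: leq_total.
- by apply/allP => it /(nthP (c0, 0, 0))[j]; rewrite size_map => jl <-; rewrite itE //=; apply: tn.
- move=> z /lgP[_ zl]; have [i0 ij jm _] := lposP zl.
  by rewrite i0 jm leqnn (leq_trans (ltnW ij) (ltnW jm)).
- move=> z j zl; rewrite selE => /andP[jl _]; rewrite itE //= leq_min leqnn; exact: tn.
- by apply/allP => it /(nthP (c0, 0, 0))[j]; rewrite size_map => jl <-; rewrite itE //=; apply: tn.
- move=> z j x /vE[zl jl h1 h2 [h3 ->]]; rewrite itE //.
  have [zk zl'] := lgP _ zl; have [zk' _] := tP _ jl.
  by have [|->] := decode_word zl' (cwP _ _ zl jl) _ (tn _ jl); first by rewrite zk zk'.
- move=> z j x z1 j1 x1 /vE[zl jl _ _ [_ ->]] /vE[zl1 jl1 _ _ [_ ->]] we.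
  have [zk zl'] := lgP _ zl; have [zk' _] := tP _ jl.
  have [zk1 zl1'] := lgP _ zl1; have [zk1' _] := tP _ jl1.
  have [|| e1 e2] := word_inj _ _ we; first by rewrite zk zk'.
    by rewrite zk1 zk1'.
  split=> //; last by rewrite e2.
  by apply/eqP; rewrite -(nth_uniq y0 jl jl1) ?rgroup_uniq // e2.
- move=> z j x /vE[zl jl h1 h2 [h3 _]].
  have [zk zl'] := lgP _ zl; have [zk' rl] := tP _ jl.
  have zz : z.2 = (nth y0 t j).2 by rewrite zk zk'.
  apply/and3P; split; last 1 first.
  + by rewrite mw_word // right_maxP ?epos // left_maxP ?tpos // h1 h2 !andbT; apply: h3.
  + rewrite /typ4 word_coreE zk eqxx andbT /WF.
    case: (z) (nth y0 t j) => [[a e'] [[c V] d]] [[f b] k'] /=.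
    by rewrite -rcons_cons nd_rcons size_rcons /= size_rcons.
  + exact: cwP.
- move=> W /and3P[nW sW /eqP kW] cW mW.
  have [z [z' [WE zz]]] := nd_long cW nW sW; rewrite WE in cW mW kW.
  have [zl rl] := maw_keys cW zz mW; rewrite word_coreE in kW.
  have zlg : z \in lgroup k by rewrite mem_lgroup zl kW eqxx.
  have zrg : z' \in t by rewrite mem_rgroup rl -zz kW eqxx.
  have jl : index z' t < N by rewrite index_mem.
  have nE := nth_index y0 zrg.
  exists z, (index z' t), z'.1.1; rewrite /WF nE; split=> //.
  move: mW; rewrite mw_word // => /and3P[no ro lo].
  have fp := tpos _ jl; have fn := tn _ jl; rewrite nE in fp fn.
  rewrite /valid zlg selE jl /E nE itE // nE /= leqnn leq_min leqnn fn /P nE no !andbT.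
  by rewrite -right_maxP ?epos // -left_maxP // ro lo.
Qed.

Definition cores := undup (map snd lkeys : seq ckey).

(** Absorbs the left key [(a, e)] into the core: the same [f] and [b], over the longer core that
    starts with the letter [a]. *)
Definition prepend (z : lkey) (z' : rkey) : rkey :=
  let: (a, e, (c, V, d)) := z in (z'.1.1, z'.1.2, (a, (c, e) :: V, d)).

Lemma prepend_rke i j : 0 < i -> i < j -> j < m ->
  prepend (lke i j) (rke i j) = rke i.-1 j.
Proof.
move=> i0 ij jm; rewrite /prepend /rke /cke /=.
by rewrite (@mid_cons i.-1) ?prednK ?(ltnW jm) // -surjective_pairing.
Qed.

Lemma prepend_inj z z' y y' : z.2 = z'.2 -> y.2 = y'.2 ->
  prepend z z' = prepend y y' -> z = y /\ z' = y'.
Proof.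
case: z z' y y' => [[a e] [[c V] d]] [[f b] k] [[a1 e1] [[c1 V1] d1]] [[f1 b1] k1] /= <- <-.
by move=> [-> -> -> -> -> -> ->].
Qed.

Lemma canon_word_keys z z' : z \in lkeys -> z' \in rkeys -> z.2 = z'.2 -> canon (word z z').
Proof.
move=> /mem_lkeys[[i [j [i0 ij jm <-]]] _] /mem_rkeys[[i' [j' [ij' jm' <-]]] _].
exact: canon_word.
Qed.

(* A pair [(z, z')] that occurs in the text is charged to the right key
   [prepend z z'] when that key is proper; otherwise [z] determines [z']. *)
Lemma sum_occurring_pairs : \sum_(k <- cores) \sum_(z <- lgroup k)
  count (fun z' => occ (word z z')) (rgroup k) <= 4 * m.
Proof.
pose f (t : ckey * lkey) (z' : rkey) : rkey + lkey :=
  if r_proper (prepend t.2 z') then inl (prepend t.2 z') else inr t.2.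
have -> : \sum_(k <- cores) \sum_(z <- lgroup k) count (fun z' => occ (word z z')) (rgroup k) =
    \sum_(t <- [seq (k, z) | k <- cores, z <- lgroup k])
      count (fun z' => occ (word t.2 z')) (rgroup t.1) by rewrite big_allpairs_dep.
have tP t z' : t \in [seq (k, z) | k <- cores, z <- lgroup k] -> z' \in rgroup t.1 ->
    [/\ t = (t.2.2, t.2), t.2 \in lkeys, z' \in rkeys & t.2.2 = z'.2].
  move=> /allpairsPdep[k [z [kc zk ->]]] /=; rewrite mem_rgroup => /andP[/eqP zk' rz].
  by move: zk; rewrite mem_lgroup => /andP[/eqP zz lz]; split; rewrite ?zz ?zk'.
have occP t z' : t \in [seq (k, z) | k <- cores, z <- lgroup k] -> z' \in rgroup t.1 ->
    occ (word t.2 z') -> exists i j, [/\ 0 < i, i < j, j.+1 < m, lke i j = t.2 & rke i j = z'].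
  move=> ts zs oc; have [_ lz rz zz] := tP _ _ ts zs.
  exact: (occ_word (canon_word_keys lz rz zz) zz oc).
apply: (@leq_trans (size (map inl rkeys ++ map inr lkeys : seq (rkey + lkey)))); last first.
  rewrite size_cat !size_map; rewrite (mulnDl 2 2); apply: leq_add; [exact: rkeys_size|exact: lkeys_size].
apply: (@sum_count_le _ _ _ _ _ _ f).
- apply: allpairs_uniq_dep => [|k _|]; [exact: undup_uniq|exact: lgroup_uniq|].
  by move=> [k z] [k' z'] _ _ /= [-> ->].
- by move=> t _; apply: rgroup_uniq.
- move=> t t1 z' z1' ts ts1 zs zs1 oc oc1.
  have [tE lz rz zz] := tP _ _ ts zs; have [tE1 lz1 rz1 zz1] := tP _ _ ts1 zs1.
  rewrite /f; case: ifP => pr; case: ifP => pr1 // [].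
    by move=> /(prepend_inj zz zz1)[e1 e2]; rewrite tE tE1 e1.
  move=> e; rewrite tE tE1 e; split=> //.
  have [i [j [i0 ij jm lE rE]]] := occP _ _ ts zs oc.
  have [i1 [j1 [i10 ij1 jm1 lE1 rE1]]] := occP _ _ ts1 zs1 oc1.
  have P0 := prepend_rke i0 ij (ltnW jm); have P1 := prepend_rke i10 ij1 (ltnW jm1).
  rewrite lE rE in P0; rewrite lE1 rE1 in P1.
  (* The longer core occurs from run [i - 1] on. As [prepend t1.2 z1'] is not proper, this
     occurrence carries it as well, so [z'] and [z1'] agree. *)
  have ip : i.-1 < j := leq_ltn_trans (leq_pred i) ij.
  have [h1 h2] := starts_atI ip (ltnW jm).
  have pE : (prepend t.2 z').2 = (prepend t1.2 z1').2 by rewrite e; case: (t1.2) => [[a e'] [[c V] d]].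
  have sE : (rke i.-1 j).2 = (prepend t1.2 z1').2 by rewrite -P0.
  have : r_starts_at (prepend t1.2 z1') i.-1.
    have /hasPn/(_ i.-1) := negbT pr1; rewrite mem_iota negb_and negbK -sE h1 /=; apply.
    exact: ltn_trans ip (ltnW jm).
  rewrite /r_starts_at -sE h2 => /andP[_ /eqP]; rewrite -P0 => pp.
  by have [] := prepend_inj zz zz1 pp.
- move=> t z' ts zs oc; have [tE lz rz zz] := tP _ _ ts zs.
  have [i [j [i0 ij jm lE rE]]] := occP _ _ ts zs oc.
  have P0 := prepend_rke i0 ij (ltnW jm); rewrite lE rE in P0.
  rewrite /f mem_cat; case: ifP => pr; apply/orP; [left|right]; apply: map_f => //.
  by rewrite P0 in pr *; apply: rkeysI => //; apply: leq_ltn_trans (leq_pred i) ij.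
Qed.

(** Two units for each of [2m] right keys, one for each of [2m] left keys, and [4m] for the pairs
    that occur. *)
Lemma enum_long : enumerates (fun W => nd W && (3 < size W)) (10 * m).
Proof.
have E1 : enumerates (fun W => has (typ4^~ W) cores) (\sum_(k <- cores) (2 * size (rgroup k) +
    \sum_(z <- lgroup k) (count (fun z' => occ (word z z')) (rgroup k)).+1)).
  apply: enum_family; first exact: undup_uniq.
    by move=> k k' W _ _ /and3P[_ _ /eqP <-] /and3P[_ _ /eqP <-].
  by move=> k _; apply: enum_core.
apply: (enum_eq _ (enum_weaken _ E1)).
  move=> W cW mW; apply/hasP/andP => [[k _ /and3P[-> -> _]]//|[nW sW]].
  have [z [z' [WE zz]]] := nd_long cW nW sW; rewrite WE in cW mW.
  have [zl _] := maw_keys cW zz mW.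
  exists z.2; first by rewrite mem_undup; apply: map_f.
  by rewrite /typ4 nW sW WE word_coreE eqxx.
have sS (X : Type) (s : seq X) (f : X -> nat) : \sum_(x <- s) (f x).+1 = size s + \sum_(x <- s) f x.
  by rewrite -sum1_size -big_split.
have s1 : \sum_(k <- cores) size (rgroup k) <= size rkeys.
  under eq_bigr do rewrite -count_predT.
  apply: (@sum_count_le _ _ _ _ _ (fun=> predT) (fun _ z' => z')) => [|k _|k k' z z' _ _|k z _].
  - exact: undup_uniq.
  - exact: rgroup_uniq.
  - by rewrite !mem_rgroup => /andP[/eqP<- _] /andP[/eqP<- _] _ _ ->.
  - by rewrite mem_rgroup => /andP[].
have s2 : \sum_(k <- cores) size (lgroup k) <= size lkeys.
  under eq_bigr do rewrite -count_predT.
  apply: (@sum_count_le _ _ _ _ _ (fun=> predT) (fun _ z' => z')) => [|k _|k k' z z' _ _|k z _].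
  - exact: undup_uniq.
  - exact: lgroup_uniq.
  - by rewrite !mem_lgroup => /andP[/eqP<- _] /andP[/eqP<- _] _ _ ->.
  - by rewrite mem_lgroup => /andP[].
have := sum_occurring_pairs; have := lkeys_size; have := rkeys_size.
rewrite big_split /= -big_distrr /=.
under [X in _ -> _ -> _ -> _ + X <= _]eq_bigr do rewrite sS.
rewrite big_split /= => h1 h2 h3.
have -> : 10 * m = 2 * (2 * m) + (2 * m + 4 * m) by rewrite mulnA -!mulnDl.
apply: leq_add; first by rewrite leq_mul2l; exact: leq_trans s1 h1.
by apply: leq_add h3; exact: leq_trans s2 h2.
Qed.

End LongWords.

(** * The data structure *)

Section Reversal.
Variable Sigma : eqType.
Implicit Types (R W : seq (Sigma * nat)) (X w : seq Sigma).

Lemma unrle_rev R : unrle (rev R) = rev (unrle R).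
Proof.
rewrite /unrle rev_flatten -map_comp map_rev; congr (flatten (rev _)).
by apply: eq_map => q /=; rewrite rev_nseq.
Qed.

Lemma canon_rev R : canon (rev R) = canon R.
Proof.
rewrite /canon all_rev map_rev rev_sorted; congr (_ && _).
by case: (map fst R) => //= a s; apply: eq_path => x y; rewrite /neqb eq_sym.
Qed.

Lemma behead_rev w : behead (rev w) = rev (take (size w).-1 w).
Proof.
case/lastP: w => [|w a] //.
by rewrite rev_rcons size_rcons /= -cats1 take_size_cat.
Qed.

Lemma take_rev_pred w : take (size (rev w)).-1 (rev w) = rev (behead w).
Proof.
by rewrite -[in RHS](revK w) behead_rev revK.
Qed.

Lemma mawb_rev X w : mawb (rev X) (rev w) = mawb X w.
Proof.
rewrite /mawb behead_rev take_rev_pred !infix_rev -!size_eq0 size_rev.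
by congr (_ && (_ && _)); apply: andbC.
Qed.

End Reversal.

Lemma exec_wf its nx ops out nx' : exec its nx ops out nx' ->
  all (fun o => o_i o < size its) ops.
Proof.
elim: ops nx out => //= o ops IH nx out [l [out' [-> _ _ _ /IH ->]]] //.
Qed.

Lemma ram_words b R0 its ops : all (is_word b) R0 -> all (wf_item (2 ^ b)) its ->
  all (wf_op (2 ^ b) (size its)) ops -> all (fun o => o_i o < size its) ops ->
  size R0 + mlen its ops < 2 ^ b -> all (is_word b) (ram R0 its ops succn).
Proof.
move=> hR hi ho hx lt; rewrite all_cat hR andTb.
apply/(all_nthP 0) => a; rewrite size_mkseq => am; rewrite nth_mkseq // /is_word.
(* The end marker [ia (size its)] is stored too, but never with the offset 3 of a link. *)
have ia_lt i u : i <= size its -> u <= 3 -> i < size its \/ u = 0 -> ia R0 i + u < 2 ^ b.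
  by move=> h1 h2 h3; apply: leq_ltn_trans lt; rewrite /ia /mlen; lia.
rewrite /cell; case: (ltnP a 2) => h2.
  by case: a h2 {am} => [|[|a]] //= _; apply: leq_ltn_trans lt; rewrite /oa /mlen; lia.
case: (ltnP a (2 + 4 * size its)) => h4.
  have : (a - 2) %/ 4 < size its by rewrite ltn_divLR //; lia.
  have : (a - 2) %% 4 < 4 by rewrite ltn_mod.
  move: (_ %% 4) (_ %/ 4) => u i u4 iN.
  have := all_nthP item0 hi i iN; rewrite /item_cells.
  case: (nth item0 its i) => [[x lo] hi'] /= /and3P[w1 w2 w3].
  case: u u4 => [|[|[|[|//]]]] _ //=.
  by have := ia_lt i.+1 0 iN (leq0n _) (or_intror erefl); rewrite addn0.
have : (a - 2 - 4 * size its) %/ 7 < size ops by rewrite ltn_divLR //; move: am; rewrite /mlen; lia.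
have : (a - 2 - 4 * size its) %% 7 < 7 by rewrite ltn_mod.
move: (_ %% 7) (_ %/ 7) => u i u7 iN.
have := all_nthP op0 ho i iN; have := all_nthP op0 hx i iN; rewrite /op_cells /wf_op.
case: (nth op0 ops i) => oi ov op_ oR oc os oT /= oiN /and5P[v1 v2 v3 w1 /andP[w2 w3]].
have z i' : i' <= size its -> ia R0 i' < 2 ^ b.
  by move=> h; have := ia_lt i' 0 h (leq0n _) (or_intror erefl); rewrite addn0.
case: u u7 => [|[|[|[|[|[|[|//]]]]]]] _ //=; try exact: z.
by apply: ia_lt => //; [exact: ltnW|left].
Qed.

Section Assembly.
Variables (Sigma : eqType) (R : seq (Sigma * nat)) (n B : nat) (code : Sigma -> nat).
Variable allW : seq (seq (Sigma * nat)).
Hypothesis cR : canon R.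
Hypothesis n_size : size (unrle R) <= n.
Hypothesis n0 : 0 < n.
Hypothesis nB : n < B.
Hypothesis codeB : forall a, code a < B.
Hypothesis code_inj : injective code.
Hypothesis allW_uniq : uniq allW.
Hypothesis allWP : forall W, (W \in allW) = canon W && maw_runs R W.
Variable c0 : Sigma.
Variable sg : nat.
Hypothesis code_sg : forall a, code a < sg.
Hypothesis sgB : sg <= B.
Hypothesis code_onto : forall x, x < sg -> exists a, code a = x.

Notation m := (size R).
Notation enumerates := (enumerates R n B code).

Lemma enum_doubled : enumerates (@doubled Sigma) m.
Proof.
have us := filter_uniq (@doubled Sigma) allW_uniq.
apply: enum_weaken (enum_explicit cR n_size n0 nB codeB (typ := @doubled Sigma) us _).
  apply: (double_count cR n_size n0) => // W.
  by rewrite mem_filter allWP => /and3P[].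
by move=> W; rewrite mem_filter allWP.
Qed.

Definition last_doubled (W : seq (Sigma * nat)) := ~~ doubled W && doubled (rev W).

(** Reversing text and words reduces the count to [double_count]. *)
Lemma enum_last_doubled : enumerates last_doubled m.
Proof.
have us := filter_uniq last_doubled allW_uniq.
apply: enum_weaken (enum_explicit cR n_size n0 nB codeB (typ := last_doubled) us _).
  rewrite -(size_map rev) -(size_rev R).
  have cR' : canon (rev R) by rewrite canon_rev.
  have n_size' : size (unrle (rev R)) <= n by rewrite unrle_rev size_rev.
  apply: (double_count cR' n_size' n0) => [|_ /mapP[W + ->]].
    by rewrite map_inj_uniq //; apply: can_inj revK.
  rewrite mem_filter allWP canon_rev /maw_runs !unrle_rev mawb_rev => /and3P[/andP[_ d] -> mW].
  by split.
by move=> W; rewrite mem_filter allWP.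
Qed.

(** With at most [m] MAWs each is stored explicitly. Otherwise the classes cost [m], [m], [m + 1],
    [5m], [7m] and [10m], at most [26m] as [m > 0], and [m] is below the number of MAWs. *)
Lemma enum_all : 0 < m ->
  exists k, [/\ k <= 26 * m, k <= 26 * size allW & enumerates predT k].
Proof.
move=> m0; case: (leqP (size allW) m) => h.
  exists (size allW); split; first by rewrite (leq_trans h) // leq_pmull.
    by rewrite leq_pmull.
  by apply: (enum_explicit cR n_size n0 nB codeB allW_uniq) => W; rewrite allWP.
exists (26 * m); split=> //; first by rewrite leq_mul2l (ltnW h) orbT.
have E1 := enum_doubled; have E2 := enum_last_doubled.
have E3 := enum_absent cR n_size n0 nB code_inj code_sg sgB code_onto.
have E4 := enum_two c0 cR n_size n0 nB codeB.
have E5 := enum_three c0 cR n_size n0 nB codeB.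
have E6 := enum_long cR n_size n0 nB codeB c0.
apply: (enum_eq _ (enum_weaken _ (enum_union _ E1 (enum_union _ E2 (enum_union _ E3
  (enum_union _ E4 (enum_union _ E5 E6))))))).
- move=> W cW mW; rewrite /= /last_doubled /nd.
  case: (doubled W) => //=; case: (doubled (rev W)) => //=.
  case: W cW mW => [|q [|q' [|q'' [|]]]] //.
- lia.
- by move=> W; rewrite /= /last_doubled /nd => ->.
- by move=> W /andP[_ d]; rewrite /= /nd d andbF.
- by move=> W /andP[_ /eqP sW]; rewrite /= sW !andbF.
- by move=> W /andP[_ /eqP sW]; rewrite /= sW !andbF.
- by move=> W /andP[_ /eqP sW]; rewrite /= sW !andbF.
Qed.

End Assembly.

(** A MAW is a letter followed by a factor of the text. *)
Lemma maws_finite (Sigma : finType) (X : seq Sigma) :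
  exists s, uniq s /\ forall w, (w \in s) = mawb X w.
Proof.
pose ks := iota 0 (size X).+1.
pose subs := [seq take l (drop i X) | i <- ks, l <- ks].
exists (undup [seq w <- [seq a :: v | a <- enum Sigma, v <- subs] | mawb X w]).
split; first exact: undup_uniq.
move=> w; rewrite mem_undup mem_filter; case mw: (mawb X w); last by [].
rewrite andTb.
case: w mw => [//|a v] /and4P[_ _ /infixP[s1 [s2 E]] _].
apply/allpairsP; exists (a, v); split; [by rewrite mem_enum| |by []].
apply/allpairsP; exists (size s1, size v); split.
- by rewrite mem_iota E !size_cat /=; lia.
- by rewrite mem_iota E !size_cat /=; lia.
- by rewrite E drop_size_cat // take_size_cat.
Qed.

(** The least absent power of a letter. A nonempty output pays for the constant number of steps at
    the start of a query. *)
Lemma maw_exists (Sigma : eqType) (X : seq Sigma) (a : Sigma) : exists w, mawb X w.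
Proof.
have h : exists k, ~~ infix (nseq k a) X.
  exists (size X).+1; apply/negP => /size_infix.
  by rewrite size_nseq ltnn.
case: (ex_minnP h) => k nk mk; exists (nseq k a).
case: k nk mk => [|k] nk mk; first by rewrite infix0s in nk.
have ik : infix (nseq k a) X.
  by apply: contraT => /mk; rewrite ltnn.
rewrite /mawb nk size_nseq /= ik /=.
by rewrite -[a :: nseq k a]/(nseq k.+1 a) -addn1 nseqD take_size_cat ?size_nseq.
Qed.

Theorem theorem1 :
  exists (P : seq instr) (c C : nat),
  forall (d : Order.disp_t) (Sigma : finOrderType d)
         (T : seq (option Sigma)) (X : seq Sigma) (b : nat),
    3 <= size T ->
    T = None :: rcons [seq Some x | x <- X] None ->
    c * up_log 2 (size T) <= b ->
    #|Sigma| <= 2 ^ b ->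
  exists D : seq nat,
    [/\ all (is_word b) D,
        size D <= C * size (rle X),
        prefix (code_rle (rle X)) D
      & exists (maws : seq (seq Sigma)) (Q : seq (quad Sigma)) (t : nat),
          [/\ uniq maws /\ (forall w : seq Sigma, w \in maws <-> is_maw T w),
              all (quad_ok (size T) (size (rle X))) Q,
              [seq decode (rle X) q | q <- Q] = [seq rle w | w <- maws],
              query b P D t (flatten [seq code_quad q | q <- Q])
            & t <= C * size maws]].
Proof.
(* With schedules of size [26m] the memory has at most [288m + 3] cells, and a query takes at most
   [19 * 26 + 20 + 8 = 522] steps per MAW; 600 covers both. *)
exists prog, 8, 600 => d Sigma T X b sT TE cb sb.
set n := size T; set R := rle X; set m := size R.
have cR : canon R := canon_rle X.
have XE : unrle R = X := unrle_rle X.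
have nE : n = (size X).+2 by rewrite /n TE /= size_rcons size_map.
have n_size : size (unrle R) <= n by rewrite XE nE !leqW.
have n0 : 0 < n by rewrite nE.
have m_n : m <= n := m_le cR n_size.
(* As [n >= 3], the power [n ^ 8] is at least [3 ^ 7 * n], with [3 ^ 7 = 2187]; this leaves room for
   all addresses, which lie below [600 * m]. *)
have B_big : 2187 * n <= 2 ^ b.
  apply: (@leq_trans (n ^ 8)).
    rewrite (expnSr n 7) -[2187]/(3 ^ 7) leq_mul2r leq_exp2r //.
    by rewrite sT orbT.
  apply: (@leq_trans ((2 ^ up_log 2 n) ^ 8)).
    by rewrite leq_exp2r // up_logP.
  by rewrite -expnM leq_exp2l // mulnC.
have nB : n < 2 ^ b by lia.
have [c0 c0X] : exists c0 : Sigma, c0 \in X.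
  case: (X) nE => [nE|x s _]; last by exists x; rewrite mem_head.
  by move: sT; rewrite -/n nE.
have m0 : 0 < m.
  rewrite lt0n size_eq0; apply/eqP => R0; move: c0X; rewrite -XE R0 //.
have code_sg (a : Sigma) : code a < #|Sigma| := ltn_ord (Order.enum_rank a).
have codeB (a : Sigma) : code a < 2 ^ b by apply: leq_trans (code_sg a) sb.
have code_inj : injective (@code d Sigma).
  by move=> x y /val_inj/Order.enum_rank_inj.
have code_onto x : x < #|Sigma| -> exists a : Sigma, code a = x.
  move=> xS; exists (Order.enum_val (Ordinal xS)).
  by rewrite /code Order.enum_valK.
have [s [us sP]] := maws_finite X.
pose allW := map (@rle Sigma) s.
have uW : uniq allW by rewrite map_inj_uniq //; apply: can_inj (@unrle_rle Sigma).
have allWP W : (W \in allW) = canon W && maw_runs R W.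
  apply/mapP/andP => [[w ws ->]|[cW mW]].
    by rewrite canon_rle /maw_runs unrle_rle XE -sP.
  by exists (unrle W); rewrite ?rle_unrle // sP -XE.
have [k [k1 k2 [Q [[its [ops [i1 o1 wi wo ex]]] Qok Qu QP]]]] :=
  enum_all cR n_size n0 nB codeB code_inj uW allWP c0 code_sg sb code_onto m0.
have sQ : size Q = size allW.
  rewrite -(size_map (decode R)); apply: perm_size; apply: uniq_perm => // W.
  by rewrite QP allWP.
have W0 : 0 < size allW.
  have [w mw] := maw_exists X c0; rewrite size_map.
  by case: (s) (sP w) => //; rewrite mw.
have R0s : size (code_rle R) = (2 * nth 0 (code_rle R) 0).+1.
  rewrite /= mul2n; congr _.+1; elim: (R) => //= q R' ->; lia.
have R0m : size (code_rle R) = (2 * m).+1 by rewrite R0s.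
have sD : size (code_rle R) + mlen its ops <= 600 * m by rewrite R0m /mlen; lia.
have small : size (code_rle R) + mlen its ops < 2 ^ b.
  by apply: leq_ltn_trans sD _; lia.
have its_s : all (fun it : item => it.2 < 2 ^ b) its.
  by apply: sub_all wi => -[[x lo] hi] /and3P[].
have [t [tle q]] := run_all R0s small its_s ex.
have words : all (is_word b) (code_rle R).
  rewrite /= {1}/is_word (leq_ltn_trans m_n nB) /=.
  apply/allP => x /flatten_mapP[[a l] al]; rewrite !inE => /orP[/eqP->|/eqP->].
    exact: codeB.
  by apply: leq_ltn_trans nB; apply: (len_le n_size al).
exists (ram (code_rle R) its ops succn); split.
- exact: ram_words words wi wo (exec_wf ex) small.
- by rewrite size_ram.
- exact: prefix_prefix.
exists (map (@unrle Sigma) (map (decode R) Q)), Q, t; split=> //.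
- split.
    rewrite map_inj_in_uniq // => W W'; rewrite !QP => /and3P[_ cW _] /and3P[_ cW' _].
    exact: unrle_inj.
  move=> w; rewrite TE; split=> [/mapP[W + ->]|/mawP mw].
    by rewrite QP => /and3P[_ _ mW]; apply/mawP; rewrite -XE.
  apply/mapP; exists (rle w); last by rewrite unrle_rle.
  by rewrite QP canon_rle /maw_runs unrle_rle XE.
- rewrite -map_comp map_id_in // => W; rewrite QP => /and3P[_ cW _].
  exact: rle_unrle.
- suff <- : flatten (map flat4 (map (cq code) Q)) = flatten [seq code_quad q | q <- Q] by [].
  by rewrite -map_comp; congr flatten; apply: eq_map => -[[[a x] p] r].
- by rewrite !size_map sQ; move: tle; rewrite size_map sQ; lia.
Qed.
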